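(* Let $0\le k,l,m\leq n$, and let $\lambda\vdash k$, $\mu\vdash l$, $\nu\vdash m$. Then the multiplicity of the simple $\Bbbk[PI_n^*]$-module $\mathbf{N}^{\nu}$ in $\mathbf{N}^{\lambda}\otimes_\Bbbk\mathbf{N}^{\mu}$ equals $$\sum_{M}\left[\mathrm{Ind}^{S_m}_{H_M}\mathrm{Res}^{S_k\times S_l}_{H_M}\big(\mathbf{S}^\lambda\otimes_\Bbbk\mathbf{S}^\mu\big):\mathbf{S}^\nu\right],$$ where $M$ runs over a set of representatives of the $(S_k\times S_l)$-orbits on $\tilde{Q}_{k,l}^m$, and $H_M$ is the stabilizer of $M$ in $S_k\times S_l$, also regarded as a subgroup of $S_m$ via its permutation action on the $m$ entries of $M$ equal to $1$.
   Context: $\Bbbk$ is an algebraically closed field of characteristic zero; $\underline{n}=\{1,\dots,n\}$; $\mathbf{S}^\lambda$ denotes the Specht module of a symmetric group; $[V:\mathbf{S}^\nu]$ denotes the multiplicity of $\mathbf{S}^\nu$ in $V$. The semigroup $PI_n^*$ of all bijections between subquotients of $\underline{n}$: an element $\xi$ consists of a set partition $\mathrm{dom}(\xi)$ of a subset $X$ of $\underline{n}$, a set partition $\mathrm{cod}(\xi)$ of a subset $Y$ of $\underline{n}$ with the same number of parts (the rank of $\xi$), and a bijection $\overline{\xi}$ from the parts of $\mathrm{dom}(\xi)$ to the parts of $\mathrm{cod}(\xi)$. The product $\xi\zeta$ (right to left): let $\omega$ be the set partition of $\underline{n}$ corresponding to the equivalence relation generated by ''lying in the same part of $\mathrm{cod}(\zeta)$''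 and ''lying in the same part of $\mathrm{dom}(\xi)$''. For each part $B$ of $\omega$ all of whose elements lie both in the union of the parts of $\mathrm{cod}(\zeta)$ and in the union of the parts of $\mathrm{dom}(\xi)$, $\xi\zeta$ has a domain part equal to the union of all $\overline{\zeta}^{-1}(C)$, with $C\subseteq B$ a part of $\mathrm{cod}(\zeta)$, mapped to the codomain part equal to the union of all $\overline{\xi}(D)$, with $D\subseteq B$ a part of $\mathrm{dom}(\xi)$; the other parts of $\omega$ contribute nothing. For a set partition $\rho$ of a subset of $\underline{n}$, $\mathbf{L}_\rho=\{\xi\in PI_n^*:\mathrm{dom}(\xi)=\rho\}$, and $S_\rho=\{\xi:\mathrm{dom}(\xi)=\mathrm{cod}(\xi)=\rho\}$ is the symmetric group on the parts of $\rho$. The cell module $\Bbbk[\mathbf{L}_\rho]$ has basis $\mathbf{L}_\rho$ with $\xi\cdot\zeta=\xi\zeta$ if $\xi\zeta\in\mathbf{L}_\rho$ and $\xi\cdot\zeta=0$ otherwise; $S_\rho$ acts on it by right multiplication. For $\rho$ with $k$ parts and $\lambda\vdash k$, $\mathbf{N}^\lambda:=\Bbbk[\mathbf{L}_\rho]\otimes_{\Bbbk[S_\rho]}\mathbf{S}^\lambda$ (with $S_\rho\cong S_k$); it is simple and, up to isomorphism, depends only on $\lambda$; all simple $\Bbbk[PI_n^*]$-modules are of this form, and $\Bbbk[PI_n^*]$ is semisimple. Tensor products of $\Bbbk[PI_n^*]$-modules carry the diagonal action of $PI_n^*$. $\tilde{Q}_{k,l}^{m}$ is the set of all $0/1$-matrices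 with rows indexed by $\{0,1,\dots,k\}$ and columns indexed by $\{0,1,\dots,l\}$ such that: the $(0,0)$-entry is $0$; exactly $m$ entries are equal to $1$; all rows with positive indices are non-zero; all columns with positive indices are non-zero. $S_k\times S_l$ acts on it by independent permutations of rows and columns with positive indices. Each element of the stabilizer $H_M$ of $M$ permutes the $m$ entries of $M$ equal to $1$; after fixing a bijection between these entries and $\underline{m}$ this gives an injective homomorphism $H_M\to S_m$. *)

(* Defs.v *)
From HB Require Import structures.
From mathcomp Require Import all_boot all_order all_algebra all_fingroup.
From mathcomp Require Import mxrepresentation mxtens.
From mathcomp Require classical_sets.

Set Implicit Arguments.
Unset Strict Implicit.
Unset Printing Implicit Defensive.

Import GroupScope GRing.Theory.
Local Open Scope ring_scope.

(* A finite dimensional module over the (semi)group T is given by matrices    *)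
(* r x : 'M_d acting on row vectors: x : T maps v to v *m r x.  Thus          *)
(* r (x y) = r y *m r x for left modules and a product x y written right to   *)
(* left.  As the MathComp product of permutations is written left to right,   *)
(* left modules of the symmetric group in the right to left convention are    *)
(* exactly the mx_representations of [set: 'S_k].                             *)
(* Submodules, simplicity and isomorphism only involve the operators r x.     *)

Section Multiplicity.

Variables (F : fieldType) (T : Type).

Definition is_submodule d (r : T -> 'M[F]_d) (U : 'M[F]_d) : Prop :=
  forall x, stablemx U (r x).

Definition is_simple d (r : T -> 'M[F]_d) (U : 'M[F]_d) : Prop :=
  [/\ is_submodule r U, U != 0
    & forall W : 'M[F]_d,
        is_submodule r W -> (W <= U)%MS -> W != 0 -> (U <= W)%MS].

(* The submodule U of r is isomorphic to the module s. *)
Definition is_iso_to d (r : T -> 'M[F]_d) (U : 'M[F]_d)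
    e (s : T -> 'M[F]_e) : Prop :=
  exists f : 'M[F]_(e, d),
    [/\ row_free f, (f :=: U)%MS & forall x, s x *m f = f *m r x].

(* r is a direct sum of simple submodules, exactly c of them isomorphic to s. *)
Definition has_multiplicity d (r : T -> 'M[F]_d) e (s : T -> 'M[F]_e)
    (c : nat) : Prop :=
  exists (p : nat) (U : 'I_p -> 'M[F]_d) (A : {set 'I_p}),
    [/\ forall i, is_simple r (U i),
        mxdirect (\sum_i U i)%MS /\ (\sum_i U i :=: 1%:M)%MS,
        forall i, i \in A <-> is_iso_to r (U i) s
      & c = #|A|].

(* [r : s] for r semisimple and s simple; by Krull-Schmidt, such a c is unique.*)
(* (The default value 0 is for r not semisimple.)                             *)
Definition multiplicity d (r : T -> 'M[F]_d) e (s : T -> 'M[F]_e) : nat :=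
  classical_sets.xget 0%N (fun c => has_multiplicity r s c).

End Multiplicity.

(* The endomorphism of the space with basis A that sends x to f x if f x \in A,*)
(* and to 0 otherwise.                                                        *)
Definition basis_mx (F : fieldType) (X : finType) (A : {set X}) (f : X -> X)
  : 'M[F]_#|A| := \matrix_(i, j) (f (enum_val i) == enum_val j)%:R.

Section BalancedTensor.

Variables (F : fieldType) (T : Type) (H : finType) (a d : nat).
Variables (L : T -> 'M[F]_a) (B : {set H}) (R : H -> 'M[F]_a).
Variable (V : H -> 'M[F]_d).

(* The span of all u h (x) v - u (x) h v with h in B, R h being the right     *)
(* action of h.                                                               *)
Definition balanced_relations : 'M[F]_(a * d) :=
  (\sum_(h in B) <<R h *t 1%:M - 1%:M *t V h>>)%MS.

(* For a (T, B)-bimodule with left action L and right action R and a B-module *)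
(* V, the T-module (bimodule) (x)_B V: the quotient of the tensor product over*)
(* F by balanced_relations.                                                   *)
Definition balanced_tensor (x : T) : 'M[F]_(\rank (cokermx balanced_relations)) :=
  in_factmod balanced_relations
    (val_factmod (U := balanced_relations) 1%:M *m (L x *t 1%:M)).

End BalancedTensor.

Definition tensor_module (F : fieldType) (T : Type) d e
    (r : T -> 'M[F]_d) (s : T -> 'M[F]_e) (x : T) : 'M[F]_(d * e) :=
  r x *t s x.

Definition is_partition_of (lam : seq nat) (k : nat) : bool :=
  [&& sorted geq lam, 0%N \notin lam & sumn lam == k].

Section Specht.

Variables (F : fieldType) (k : nat) (lam : seq nat).

(* A tabloid is the sequence of the sets of entries of its rows. *)
Definition rows_type := {ffun 'I_(size lam) -> {set 'I_k}}.

Definition tabloids : {set rows_type} :=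
  [set t : rows_type | [forall r, #|t r| == nth 0%N lam r]
                    && [forall i, #|[set r | i \in t r]| == 1%N]].

Definition tabloid_act (t : rows_type) (s : 'S_k) : rows_type :=
  [ffun r => s @: t r].

Definition tabloid_mx (s : 'S_k) : 'M[F]_#|tabloids| :=
  basis_mx F tabloids (tabloid_act^~ s).

Lemma tabloid_act1 t : tabloid_act t 1 = t.
Proof.
by apply/ffunP=> r; rewrite ffunE (eq_imset _ (@perm1 _)) imset_id.
Qed.

Lemma tabloid_actM t s1 s2 :
  tabloid_act t (s1 * s2)%g = tabloid_act (tabloid_act t s1) s2.
Proof.
apply/ffunP=> r; rewrite !ffunE -imset_comp.
by apply: eq_imset => i; rewrite permM.
Qed.

Lemma tabloid_act_in t s : t \in tabloids -> tabloid_act t s \in tabloids.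
Proof.
rewrite !inE => /andP[/forallP sz /forallP one]; apply/andP; split.
  by apply/forallP=> r; rewrite ffunE card_imset //; exact: perm_inj.
apply/forallP=> i; rewrite -(eqP (one (s^-1 i)%g)); apply/eqP/eq_card => r.
rewrite !inE ffunE; apply/imsetP/idP => [[j jt ->]|it]; first by rewrite permK.
by exists (s^-1 i)%g; rewrite // permKV.
Qed.

Lemma tabloid_mx_repr : mx_repr [set: 'S_k]%G tabloid_mx.
Proof.
split=> [|s1 s2 _ _].
  by apply/matrixP=> i j; rewrite !mxE tabloid_act1 (inj_eq enum_val_inj).
apply/matrixP=> i j; rewrite !mxE tabloid_actM.
have t1in := tabloid_act_in s1 (enum_valP i).
set t1 := tabloid_act (enum_val i) s1 in t1in *.
rewrite (bigD1 (enum_rank_in t1in t1)) //= big1 => [|j' nej]; last first.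
  rewrite !mxE; case: eqP => [et1|_]; last by rewrite mul0r.
  by case/eqP: nej; apply: enum_val_inj; rewrite enum_rankK_in.
by rewrite !mxE enum_rankK_in // -/t1 eqxx mul1r addr0.
Qed.

Definition tabloid_repr : mx_representation F [set: 'S_k]%G #|tabloids| :=
  MxRepresentation tabloid_mx_repr.

(* The tableau whose boxes are filled with 0, 1, 2, ... row by row: the entry *)
(* i stands in row reshape_index lam i and column reshape_offset lam i.       *)
Definition row_tabloid : rows_type :=
  [ffun r : 'I_(size lam) => [set i : 'I_k | reshape_index lam i == r]].

Definition column_stabilizer : {set 'S_k} :=
  [set s : 'S_k |
    [forall i, reshape_offset lam (s i) == reshape_offset lam i]].

Definition polytabloid : 'rV[F]_#|tabloids| :=
  \row_j \sum_(s in column_stabilizer)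
     (-1) ^+ s * (tabloid_act row_tabloid s == enum_val j)%:R.

(* The translates of polytabloid are the polytabloids of all tableaux, so this*)
(* is the span of all polytabloids.                                           *)
Definition specht_space := cyclic_mx tabloid_repr polytabloid.

Definition specht : mx_representation F [set: 'S_k]%G (\rank specht_space) :=
  submod_repr (cyclic_mx_module tabloid_repr polytabloid).

End Specht.

Section DualInverse.

Variable n : nat.

Local Notation raw := {set {set 'I_n} * {set 'I_n}}.

(* A set partition of a subset (namely cover rho) of 'I_n. *)
Definition is_subquotient (rho : {set {set 'I_n}}) : bool :=
  trivIset rho && (set0 \notin rho).

Definition raw_dom (x : raw) : {set {set 'I_n}} := [set p.1 | p in x].
Definition raw_cod (x : raw) : {set {set 'I_n}} := [set p.2 | p in x].

(* x is the graph of a bijection between two subquotients. *)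
Definition is_PIstar (x : raw) : bool :=
  [&& is_subquotient (raw_dom x), is_subquotient (raw_cod x)
    & [forall p in x, forall q in x, (p.1 == q.1) == (p.2 == q.2)]].

Record PIstar := MkPIstar { PIgraph :> raw; PIgraphP : is_PIstar PIgraph }.

HB.instance Definition _ := [isSub for PIgraph].
HB.instance Definition _ := [Finite of PIstar by <:].

Definition PIdom (x : PIstar) := raw_dom x.
Definition PIcod (x : PIstar) := raw_cod x.

Section Product.

Variables x z : PIstar.

Definition same_part : rel 'I_n := fun i j =>
  [exists C in PIcod z :|: PIdom x, (i \in C) && (j \in C)].

(* same_part is symmetric, so connect same_part is the equivalence relation   *)
(* it generates.                                                              *)
Definition PIomega : {set {set 'I_n}} :=
  equivalence_partition (connect same_part) [set: 'I_n].

Definition contributing : {set {set 'I_n}} :=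
  [set B in PIomega | (B \subset cover (PIcod z)) && (B \subset cover (PIdom x))].

Definition merged_pair (B : {set 'I_n}) : {set 'I_n} * {set 'I_n} :=
  (\bigcup_(p in PIgraph z | p.2 \subset B) p.1,
   \bigcup_(p in PIgraph x | p.1 \subset B) p.2).

Definition PImul_graph : raw := [set merged_pair B | B in contributing].

Let ceq : equivalence_rel (connect same_part).
Proof.
apply/equivalence_relP; split=> [i|i j ij]; first exact: connect0.
move=> l; apply: same_connect ij l.
move=> {}i {}j.
suff imp a b : connect same_part a b -> connect same_part b a.
  by apply/idP/idP; apply: imp.
have ssym c d : same_part c d = same_part d c.
  by rewrite /same_part; apply: eq_existsb => C; rewrite [_ && (d \in C)]andbC.
by rewrite (sym_connect_sym ssym).
Qed.

Let omega_part : partition PIomega [set: 'I_n].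
Proof. by apply: equivalence_partitionP => i j l _ _ _; exact: ceq. Qed.

Let omega_triv : trivIset PIomega.
Proof. by case/and3P: omega_part. Qed.

Let omega_n0 B : B \in PIomega -> exists i, i \in B.
Proof.
move=> Bo; apply/set0Pn; apply: contraTneq Bo => ->.
by case/and3P: omega_part.
Qed.

Let omega_closed B C i :
  B \in PIomega -> C \in PIcod z :|: PIdom x -> i \in B -> i \in C -> C \subset B.
Proof.
move=> Bo Co iB iC; apply/subsetP => j jC.
have inT a : a \in [set: 'I_n] by rewrite inE.
have eqr : {in [set: 'I_n] & &, equivalence_rel (connect same_part)}.
  by move=> ? ? ? _ _ _; exact: ceq.
have := pblock_equivalence_partition eqr (inT i) (inT j).
rewrite -/PIomega (def_pblock omega_triv Bo iB) => ->.
by apply: connect1; apply/existsP; exists C; rewrite Co iC jC.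
Qed.

Let omega_eq B C i :
  B \in PIomega -> C \in PIomega -> i \in B -> i \in C -> B = C.
Proof.
move=> Bo Co iB iC.
by rewrite -(def_pblock omega_triv Bo iB) -(def_pblock omega_triv Co iC).
Qed.

Let part_inj (w : PIstar) p q :
  p \in PIgraph w -> q \in PIgraph w -> (p.1 = q.1) <-> (p.2 = q.2).
Proof.
have /and3P[_ _ /forall_inP h] := PIgraphP w => pw qw.
have /forall_inP/(_ q qw)/eqP e := h p pw.
by split=> /eqP; [rewrite e | rewrite -e] => /eqP.
Qed.

Let raw_triv (w : PIstar) : [/\ trivIset (PIdom w), set0 \notin PIdom w,
  trivIset (PIcod w) & set0 \notin PIcod w].
Proof. by have /and3P[/andP[? ?] /andP[? ?] _] := PIgraphP w. Qed.

Let triv_eq (P : {set {set 'I_n}}) C D i :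
  trivIset P -> C \in P -> D \in P -> i \in C -> i \in D -> C = D.
Proof.
by move=> tP CP DP iC iD; rewrite -(def_pblock tP CP iC) -(def_pblock tP DP iD).
Qed.

Let merged1_eq B C i : B \in contributing -> C \in contributing ->
  i \in (merged_pair B).1 -> i \in (merged_pair C).1 -> B = C.
Proof.
rewrite !inE => /andP[Bo _] /andP[Co _] /bigcupP[p /andP[pz pB] ip].
move=> /bigcupP[q /andP[qz qC] iq].
have [t1 _ _ n2] := raw_triv z.
have e1 : p.1 = q.1 by apply: (triv_eq t1 _ _ ip iq); apply: imset_f.
have e2 : p.2 = q.2 by apply/(part_inj pz qz).
have [j jp] : exists j, j \in p.2.
  by apply/set0Pn; apply: contraNneq n2 => <-; apply: imset_f.
by apply: (omega_eq Bo Co (subsetP pB j jp)); apply: (subsetP qC); rewrite -e2.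
Qed.

Let merged2_eq B C i : B \in contributing -> C \in contributing ->
  i \in (merged_pair B).2 -> i \in (merged_pair C).2 -> B = C.
Proof.
rewrite !inE => /andP[Bo _] /andP[Co _] /bigcupP[p /andP[pz pB] ip].
move=> /bigcupP[q /andP[qz qC] iq].
have [_ n1 t2 _] := raw_triv x.
have e2 : p.2 = q.2 by apply: (triv_eq t2 _ _ ip iq); apply: imset_f.
have e1 : p.1 = q.1 by apply/(part_inj pz qz).
have [j jp] : exists j, j \in p.1.
  by apply/set0Pn; apply: contraNneq n1 => <-; apply: imset_f.
by apply: (omega_eq Bo Co (subsetP pB j jp)); apply: (subsetP qC); rewrite -e1.
Qed.

Let merged1_n0 B : B \in contributing -> exists i, i \in (merged_pair B).1.
Proof.
rewrite !inE => /andP[Bo /andP[Bz _]]; have [i iB] := omega_n0 Bo.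
have /bigcupP[_ /imsetP[p pz ->] ip] := subsetP Bz i iB.
have [_ n1 _ _] := raw_triv z.
have [j jp] : exists j, j \in p.1.
  by apply/set0Pn; apply: contraNneq n1 => <-; apply: imset_f.
exists j; apply/bigcupP; exists p => //; rewrite pz /=.
by apply: (omega_closed Bo _ iB ip); rewrite inE imset_f.
Qed.

Let merged2_n0 B : B \in contributing -> exists i, i \in (merged_pair B).2.
Proof.
rewrite !inE => /andP[Bo /andP[_ Bx]]; have [i iB] := omega_n0 Bo.
have /bigcupP[_ /imsetP[p px ->] ip] := subsetP Bx i iB.
have [_ _ _ n2] := raw_triv x.
have [j jp] : exists j, j \in p.2.
  by apply/set0Pn; apply: contraNneq n2 => <-; apply: imset_f.
exists j; apply/bigcupP; exists p => //; rewrite px /=.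
by apply: (omega_closed Bo _ iB ip); rewrite inE imset_f ?orbT.
Qed.

Lemma PImul_graphP : is_PIstar PImul_graph.
Proof.
have sub (g : {set 'I_n} -> {set 'I_n}) :
    (forall B, B \in contributing -> exists i, i \in g B) ->
    (forall B C i, B \in contributing -> C \in contributing ->
       i \in g B -> i \in g C -> B = C) ->
    is_subquotient [set g B | B in contributing].
  move=> n0 inj; apply/andP; split.
    apply/trivIsetP => _ _ /imsetP[B Bc ->] /imsetP[C Cc ->] neq.
    apply/pred0P => i /=; apply: contraNF neq => /andP[iB iC].
    by rewrite (inj B C i).
  by apply/imsetP => -[B /n0[i iB] e]; rewrite -e inE in iB.
have dE : raw_dom PImul_graph = [set (merged_pair B).1 | B in contributing].
  by rewrite /raw_dom -imset_comp.
have cE : raw_cod PImul_graph = [set (merged_pair B).2 | B in contributing].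
  by rewrite /raw_cod -imset_comp.
apply/and3P; split.
- by rewrite dE; apply: sub; [exact: merged1_n0 | exact: merged1_eq].
- by rewrite cE; apply: sub; [exact: merged2_n0 | exact: merged2_eq].
apply/forall_inP => _ /imsetP[B Bc ->]; apply/forall_inP => _ /imsetP[C Cc ->].
apply/eqP; apply/eqP/eqP => e.
  have [i iB] := merged1_n0 Bc.
  by rewrite (merged1_eq Bc Cc iB) // -e.
have [i iB] := merged2_n0 Bc.
by rewrite (merged2_eq Bc Cc iB) // -e.
Qed.

(* The product x z, right to left. *)
Definition PImul : PIstar := MkPIstar PImul_graphP.

End Product.

(* A subquotient with k parts, together with a numbering of its parts; the    *)
(* numbering is what identifies S_rho with 'S_k.                              *)
Definition is_numbered k (b : {ffun 'I_k -> {set 'I_n}}) : bool :=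
  [forall i, b i != set0]
  && [forall i, forall j, (i != j) ==> [disjoint b i & b j]].

Record numbered_subquotient (k : nat) := NumberedSubquotient {
  part_of :> {ffun 'I_k -> {set 'I_n}};
  part_ofP : is_numbered part_of }.

Section Cell.

Variables (k : nat) (rho : numbered_subquotient k).

Definition parts : {set {set 'I_n}} := [set rho i | i : 'I_k].

Definition sym_graph (s : 'S_k) : raw := [set (rho i, rho (s i)) | i : 'I_k].

Lemma sym_graphP s : is_PIstar (sym_graph s).
Proof.
have /andP[/forallP n0 /forallP dis] := part_ofP rho.
have disE i j : i != j -> [disjoint rho i & rho j].
  by move/forallP: (dis i) => /(_ j)/implyP.
have rho_inj : injective rho.
  move=> i j e; apply: contraTeq (n0 j) => /disE.
  by rewrite e -setI_eq0 setIid negbK.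
have sq (f : 'I_k -> 'I_k) : is_subquotient [set rho (f i) | i : 'I_k].
  apply/andP; split; last first.
    by apply/imsetP => -[i _ e]; have := n0 (f i); rewrite -e eqxx.
  apply/trivIsetP => _ _ /imsetP[i _ ->] /imsetP[j _ ->] neq.
  by apply: disE; apply: contraNneq neq => ->.
apply/and3P; split.
- by rewrite /raw_dom -imset_comp; exact: (sq id).
- by rewrite /raw_cod -imset_comp; exact: (sq s).
apply/forall_inP => _ /imsetP[i _ ->]; apply/forall_inP => _ /imsetP[j _ ->] /=.
by rewrite !(inj_eq rho_inj) (inj_eq perm_inj).
Qed.

(* The isomorphism from 'S_k to S_rho. *)
Definition sym_elt (s : 'S_k) : PIstar := MkPIstar (sym_graphP s).

Definition cell_basis : {set PIstar} := [set x | PIdom x == parts].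

Variables (F : fieldType) (lam : seq nat).

Definition cell_left (x : PIstar) : 'M[F]_#|cell_basis| :=
  basis_mx F cell_basis (PImul x).

Definition cell_right (s : 'S_k) : 'M[F]_#|cell_basis| :=
  basis_mx F cell_basis (fun z => PImul z (sym_elt s)).

Definition simpleN :=
  balanced_tensor cell_left [set: 'S_k] cell_right (specht F k lam).

End Cell.

End DualInverse.

Section Matrices.

Variables k l : nat.

(* 0/1-matrices, with the index 0 of the statement being ord0. *)
Local Notation mx01 := 'M[bool]_(k.+1, l.+1).
Local Notation gT := ('S_k * 'S_l)%type.

Definition ones (M : mx01) : {set 'I_k.+1 * 'I_l.+1} := [set c | M c.1 c.2].

Definition Qtilde (m : nat) : {set mx01} :=
  [set M : mx01 | [&& ~~ M ord0 ord0, #|ones M| == m,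
     [forall i, (i != ord0) ==> [exists j, M i j]]
   & [forall j, (j != ord0) ==> [exists i, M i j]]]].

Definition entry_act (c : 'I_k.+1 * 'I_l.+1) (g : gT) : 'I_k.+1 * 'I_l.+1 :=
  (lift_perm ord0 ord0 g.1 c.1, lift_perm ord0 ord0 g.2 c.2).

(* The value of M at the entry c is moved to the entry entry_act c g. *)
Definition mx01_act (M : mx01) (g : gT) : mx01 :=
  \matrix_(i, j) let c := entry_act (i, j) g^-1%g in M c.1 c.2.

Lemma mx01_act1 M : mx01_act M 1%g = M.
Proof. by apply/matrixP => i j; rewrite !mxE /= !invg1 !lift_perm1 !perm1. Qed.

Lemma mx01_actM M : act_morph mx01_act M.
Proof.
move=> g h; apply/matrixP => i j; rewrite !mxE /=.
by rewrite !invMg mxE /= -!(lift_permM ord0 ord0 ord0) !permM.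
Qed.

Definition mx01_action : {action gT &-> mx01} := TotalAction mx01_act1 mx01_actM.

Definition orbit_representatives (m : nat) (X : {set mx01}) : bool :=
  is_transversal X (orbit mx01_action [set: gT] @: Qtilde m) (Qtilde m).

Variables (m : nat) (F : fieldType).

Definition stabilizer (M : mx01) : {set gT} := 'C[M | mx01_action].

(* e numbers the entries of M equal to 1. *)
Definition is_ones_numbering (M : mx01) (e : 'I_m -> 'I_k.+1 * 'I_l.+1) : Prop :=
  injective e /\ e @: [set: 'I_m] = ones M.

(* The permutation of 'I_m induced by g through the numbering e; for g in the *)
(* stabilizer and e a numbering of the ones, it exists and is unique.         *)
Definition ones_perm (e : 'I_m -> 'I_k.+1 * 'I_l.+1) (g : gT) : 'S_m :=
  odflt 1%g [pick s : 'S_m | [forall i, e (s i) == entry_act (e i) g]].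

Definition specht_outer (lam mu : seq nat) (g : gT) :=
  specht F k lam g.1 *t specht F l mu g.2.

(* k[S_m] (x)_{k[H_M]} Res (S^lam (x) S^mu).  The MathComp product of         *)
(* permutations is left to right, so that left multiplication by s on k[S_m]  *)
(* is t |-> t * s, and right multiplication by s is t |-> s * t.              *)
Definition ind_res (lam mu : seq nat) (M : mx01)
    (e : 'I_m -> 'I_k.+1 * 'I_l.+1) :=
  balanced_tensor
    (fun s : 'S_m => basis_mx F [set: 'S_m] (fun t => t * s)%g)
    (stabilizer M)
    (fun g : gT => basis_mx F [set: 'S_m] (fun t => ones_perm e g * t)%g)
    (specht_outer lam mu).

End Matrices.

(* Main.v *)
Require Import Defs.
From HB Require Import structures.
From mathcomp Require Import all_boot all_order all_algebra all_fingroup.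
From mathcomp Require Import mxrepresentation mxtens.
From mathcomp Require Import boolp.
From mathcomp Require classical_sets.

(** The semigroup of block bijections is inverse, and a module over it is the
    same thing as a representation of a groupoid: the objects are the
    subquotients of {1,...,n}, the arrows are the bijections between them.
    Write s <= t when each part of the subquotient s is a union of parts of t.
    The idempotent of t acts as the sum of orthogonal projections p_s for
    s <= t, which Moebius inversion recovers from the idempotents (gr_mobius).
    On the image of p_s an element x acts as its restriction to s if
    s <= dom x, and by 0 otherwise. In the module N^lambda, the image of p_s
    is spanned by the basis elements with codomain s: it is a copy of S^lambda
    when s has k parts, and 0 otherwise.

    Averaging over the groupoid shows that all these modules are semisimple
    (graded_projections). Fix a subquotient t with m parts. The functor that
    sends a module V to V p_t, a representation of S_m, maps simple modules to
    simple ones or to 0 (restriction_simple), and V p_t is isomorphic to S^nu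
    exactly if the simple module V is isomorphic to N^nu (iso_restrict,
    iso_induce). So the multiplicity of N^nu in any V is that of S^nu in V p_t
    (mult_in_restrict).

    Take for V the tensor product of N^lambda and N^mu. If both a <= s and
    b <= s then the coarsest common refinement of a and b, whose parts are the
    nonempty intersections of a part, or the complement of the support, of a
    with one of b, except for the intersection of the two complements, is
    below s, and conversely. Hence V p_t is the sum of the tensor products of
    N^lambda p_a and N^mu p_b for all pairs a, b with common refinement t.
    After numbering the parts of a and b by positive integers, and the
    complements by 0, a part of t is described by a row and a column; a pair
    (a, b) becomes a matrix in Q together with a bijection from its ones to the
    parts of t. The group S_m permutes the bijections simply transitively,
    S_k x S_l changes the numberings, and the contribution of the orbit of M
    is the representation induced from the stabilizer of M (ind_embedding,
    lab_span_sum, lab_span_direct).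

    Three devices keep the computations small. A block bijection is replaced
    by the relation x Q y that holds when the part of x is sent to the part of
    y; these are the relations with Q Q^-1 Q = Q, domains and codomains are the
    partial equivalence relations Q Q^-1 and Q^-1 Q, and most of the groupoid
    is algebra of relations. A numbered subquotient is a function from
    {1,...,n} to {0,...,k}, and a pair of them is a function to pairs, so that
    the combinatorics of common refinements disappears. Finally a balanced
    tensor product is handled through the maps v |-> z (x) v and their duals
    (frame), in terms of which homomorphisms are given by balanced maps and
    tensor products of modules are computed factor by factor. *)

Set Implicit Arguments.
Unset Strict Implicit.
Unset Printing Implicit Defensive.

Import GroupScope GRing.Theory.
Local Open Scope ring_scope.

(** * Modules and multiplicities *)

Section SemisimpleModules.

Variables (F : fieldType) (T : Type).

(** The subspace V is the direct sum of the simple submodules U i. Comparing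
    ranks expresses directness, and survives reindexing, concatenation and the
    passage to isomorphic submodules more easily than a predicate on the shape
    of the sum. *)
Definition simple_sum d (r : T -> 'M[F]_d) (V : 'M[F]_d) (I : finType)
    (U : I -> 'M[F]_d) : Prop :=
  [/\ forall i, is_simple r (U i), (\sum_i U i :=: V)%MS
    & (\sum_i \rank (U i) = \rank V)%N].

Definition iso_count d (r : T -> 'M[F]_d) (I : finType) (U : I -> 'M[F]_d)
    e (s : T -> 'M[F]_e) : nat := #|[set i | `[< is_iso_to r (U i) s >]]|.

(** Multiplicity of s in a submodule V of r. No module structure is put on V
    itself: below, the operators of a group are defined on a whole module, but
    form a representation on one summand only. *)
Definition mult_in d (r : T -> 'M[F]_d) (V : 'M[F]_d) e (s : T -> 'M[F]_e)
    (c : nat) : Prop :=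
  exists (I : finType) (U : I -> 'M[F]_d),
    simple_sum r V U /\ c = iso_count r U s.

Lemma simple_sum_direct d (r : T -> 'M[F]_d) V (I : finType) U :
  simple_sum r V U -> mxdirect (\sum_(i : I) U i)%MS.
Proof. by case=> _ eV rV; rewrite mxdirectE /= eV rV. Qed.

Lemma has_multiplicityE d (r : T -> 'M[F]_d) e (s : T -> 'M[F]_e) c :
  has_multiplicity r s c <-> mult_in r 1%:M s c.
Proof.
split.
  case=> p [U [A [simU [dirU sumU] AP ->]]].
  exists 'I_p, U; split; first split=> //.
    by have := mxdirectP dirU; rewrite /= sumU => ->.
  apply: eq_card => i; rewrite inE; apply/idP/asboolP => [/AP //|h].
  exact/AP.
case=> I [U [sU ->]].
have [simU sumU rU] := sU.
exists #|I|, (U \o enum_val), [set i | `[< is_iso_to r (U (enum_val i)) s >]].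
have bijv : {on [pred i : I | true], bijective (@enum_val I predT)}.
  by apply: onW_bij; exact: enum_val_bij.
have reU : (\sum_(i < #|I|) U (enum_val i) :=: \sum_i U i)%MS.
  by rewrite (reindex _ bijv).
split=> [i|||]; first exact: simU.
- split; last by apply: eqmx_trans reU sumU.
  by rewrite mxdirectE /= reU sumU -rU [in X in X == _](reindex _ bijv).
- by move=> i; rewrite inE; split=> [/asboolP|h]; last exact/asboolP.
rewrite /iso_count -(card_imset _ enum_rank_inj).
apply: eq_card => i; rewrite inE; apply/imsetP/idP.
  by case=> j; rewrite inE => h ->; rewrite enum_rankK.
by move=> h; exists (enum_val i); rewrite ?inE ?enum_valK.
Qed.

Section OneModule.

Variables (d : nat) (r : T -> 'M[F]_d).

(** Schur's lemma for operators that form neither a group nor an algebra: a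
    homomorphism g that does not vanish on the simple U is injective on U, with
    image all of W. *)
Lemma simple_image_iso (U W g : 'M[F]_d) e (s : T -> 'M[F]_e) :
    is_simple r U -> is_simple r W ->
    (forall x, U *m g *m r x = U *m r x *m g) -> (U *m g <= W)%MS ->
    U *m g != 0 ->
  is_iso_to r U s -> is_iso_to r W s.
Proof.
move=> [sU _ minU] [_ _ minW] gr UgW n0 [f [ff fU fs]].
have sUg : is_submodule r <<U *m g>>%MS.
  move=> x; rewrite genmxE (eqmxMr _ (genmxE _)) gr.
  by apply: submxMr; apply: sU.
have eW : (U *m g :=: W)%MS.
  apply/eqmxP; rewrite UgW -(genmxE (U *m g)) minW ?genmxE //.
  by rewrite -mxrank_eq0 genmxE mxrank_eq0.
have gK : (U :&: kermx g)%MS = 0.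
  apply/eqP; apply: contraNT n0 => n0.
  have : (U <= U :&: kermx g)%MS.
    apply: minU => //; last exact: capmxSl.
    move=> x; rewrite sub_capmx.
    have [w ew] := submxP (capmxSl U (kermx g)).
    rewrite {1}ew -mulmxA (submx_trans (submxMl _ _) (sU x)) /=.
    apply/sub_kermxP; rewrite ew -mulmxA -mulmxA [U *m _]mulmxA -gr 2!mulmxA
      -ew.
    by rewrite (sub_kermxP (capmxSr _ _)) mul0mx.
  by rewrite sub_capmx => /andP[_ /sub_kermxP->].
exists (f *m g); split=> [||x].
- apply: inj_row_free => v; rewrite mulmxA => vfg0.
  have : (v *m f <= U :&: kermx g)%MS.
    rewrite sub_capmx -fU submxMl; exact/sub_kermxP.
  by rewrite gK submx0 mulmx_free_eq0 // => /eqP.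
- exact: eqmx_trans (eqmxMr g fU) eW.
have /submxP[w ew] : (f <= U)%MS by rewrite fU.
by rewrite mulmxA fs ew -!mulmxA; congr (w *m _); rewrite !mulmxA gr.
Qed.

(** S is the sum of its projections to the summands U i, and by Schur's lemma
    such a projection can only be nonzero when U i is isomorphic to S. So the
    isotypic component of a decomposition contains every simple submodule of its
    type. *)
Lemma simple_le_isotypic (V : 'M[F]_d) (I : finType) (U : I -> 'M[F]_d) S
    e (s : T -> 'M[F]_e) :
    simple_sum r V U -> is_simple r S -> (S <= V)%MS -> is_iso_to r S s ->
  (S <= \sum_(i | `[< is_iso_to r (U i) s >]) U i)%MS.
Proof.
move=> sU simS SV isoS; have [simU sumU _] := sU.
have /mxdirect_sumsP dx := simple_sum_direct sU.
pose C i := (\sum_(j | j != i) U j)%MS.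
have UC i : (U i :&: C i)%MS = 0 by rewrite -[RHS](dx i isT).
pose p i := proj_mx (U i) (C i).
have pE i (u : I -> 'M[F]_d) : (\sum_j u j *m U j) *m p i = u i *m U i.
  rewrite mulmx_suml (bigD1 i) //= big1 ?addr0 => [|j ji].
    by rewrite proj_mx_id ?submxMl ?UC.
  rewrite proj_mx_0 ?UC // (submx_trans (submxMl _ _)) //.
  by rewrite (sumsmx_sup j).
have Sp (W : 'M[F]_d) : (W <= V)%MS -> W = \sum_i W *m p i.
  rewrite -sumU => /sub_sumsmxP[u eW].
  by rewrite {1}eW; apply: eq_bigr => i _; rewrite eW pE.
have pr (W : 'M[F]_d) i x : (W <= V)%MS -> W *m p i *m r x = W *m r x *m p i.
  rewrite -sumU => /sub_sumsmxP[u ->]; rewrite pE.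
  have Ur j : U j *m r x = (U j *m r x *m pinvmx (U j)) *m U j.
    by rewrite mulmxKpV //; have [/(_ x)] := simU j.
  have -> : (\sum_j u j *m U j) *m r x
      = \sum_j (u j *m (U j *m r x *m pinvmx (U j))) *m U j.
    rewrite mulmx_suml; apply: eq_bigr => j _.
    by rewrite -mulmxA [in LHS]Ur !mulmxA.
  by rewrite pE -mulmxA [in LHS]Ur !mulmxA.
rewrite [X in (X <= _)%MS]Sp // (bigID (fun i => `[< is_iso_to r (U i) s >]))
  /=.
rewrite addmx_sub ?summx_sub // => i Pi.
  apply: (sumsmx_sup i) => //; exact: proj_mx_sub.
have [-> | n0] := eqVneq (S *m p i) 0; first exact: sub0mx.
case/asboolP: Pi; apply: (simple_image_iso simS (simU i) _ _ n0 isoS).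
  by move=> x; apply: pr.
exact: proj_mx_sub.
Qed.

Lemma rank_iso (U : 'M[F]_d) e (s : T -> 'M[F]_e) :
  is_iso_to r U s -> \rank U = e.
Proof. by case=> f [ff <- _]; apply/eqP. Qed.

Lemma isotypic_rank (V : 'M[F]_d) (I : finType) (U : I -> 'M[F]_d)
    e (s : T -> 'M[F]_e) : simple_sum r V U ->
  \rank (\sum_(i | `[< is_iso_to r (U i) s >]) U i)%MS
    = (iso_count r U s * e)%N.
Proof.
move=> sU; pose P i := `[< is_iso_to r (U i) s >].
have dP : mxdirect (\sum_(i | P i) U i)%MS.
  have /mxdirect_sumsP dx := simple_sum_direct sU.
  apply/mxdirect_sumsP => i Pi; apply/eqP; rewrite -submx0
    -[X in (_ <= X)%MS](dx i isT).
  rewrite capmxS //; apply/sumsmx_subP => j /andP[_ ji].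
  exact: (sumsmx_sup j).
rewrite (mxdirectP dP) /= (eq_bigr (fun=> e)) => [|i /asboolP/rank_iso //].
by rewrite sum_nat_const /iso_count cardsE.
Qed.

(** Krull-Schmidt: by the previous lemmas the isotypic components of two
    decompositions contain each other, and their common rank is the number of
    summands times the dimension of s. *)
Lemma mult_in_unique (V : 'M[F]_d) e (s : T -> 'M[F]_e) c c' :
  mult_in r V s c -> mult_in r V s c' -> c = c'.
Proof.
case=> I [U [sU ->]] [J [W [sW ->]]].
have sub (I1 I2 : finType) (U1 : I1 -> 'M_d) (U2 : I2 -> 'M_d) :
    simple_sum r V U1 -> simple_sum r V U2 ->
    (\sum_(i | `[< is_iso_to r (U1 i) s >]) U1 i <=
     \sum_(i | `[< is_iso_to r (U2 i) s >]) U2 i)%MS.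
  move=> s1 s2; apply/sumsmx_subP => i /asboolP isoi.
  have [sim1 sum1 _] := s1.
  apply: (simple_le_isotypic s2) => //.
  by rewrite -sum1 (sumsmx_sup i).
have e0 (I1 : finType) (U1 : I1 -> 'M_d) :
    simple_sum r V U1 -> e = 0%N -> iso_count r U1 s = 0%N.
  move=> s1 e0; apply/eqP; rewrite cards_eq0; apply/eqP/setP => i.
  rewrite !inE; apply/asboolP => /rank_iso; rewrite e0 => /eqP.
  by rewrite mxrank_eq0; have [/(_ i)[_ /negPf->]] := s1.
have [e00 | e_gt0] := posnP e; first by rewrite !e0.
apply/eqP; rewrite -(eqn_pmul2r e_gt0) -(isotypic_rank s sU)
  -(isotypic_rank s sW).
by rewrite eqn_leq !mxrankS ?sub.
Qed.

Lemma mult_in_eqmx (V W : 'M[F]_d) e (s : T -> 'M[F]_e) c :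
  (V :=: W)%MS -> mult_in r V s c -> mult_in r W s c.
Proof.
move=> eVW [I [U [[simU sumU rU] ->]]]; exists I, U; split=> //.
by split=> //; [apply: eqmx_trans eVW | rewrite rU eVW].
Qed.

Lemma simple_sum_add (V1 V2 : 'M[F]_d) (I1 I2 : finType) U1 U2 :
    simple_sum r V1 U1 -> simple_sum r V2 U2 ->
    \rank (V1 + V2)%MS = (\rank V1 + \rank V2)%N ->
  simple_sum r (V1 + V2)%MS
    (fun i : I1 + I2 => match i with inl a => U1 a | inr b => U2 b end).
Proof.
move=> [sim1 sum1 r1] [sim2 sum2 r2] rV; split; first by case.
  by rewrite big_sumType /=; apply: adds_eqmx.
by rewrite big_sumType /= r1 r2 rV.
Qed.

Lemma mult_in_add (V1 V2 : 'M[F]_d) e (s : T -> 'M[F]_e) c1 c2 :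
    mult_in r V1 s c1 -> mult_in r V2 s c2 ->
    \rank (V1 + V2)%MS = (\rank V1 + \rank V2)%N ->
  mult_in r (V1 + V2)%MS s (c1 + c2).
Proof.
move=> [I1 [U1 [s1 ->]]] [I2 [U2 [s2 ->]]] rV.
exists (I1 + I2)%type, (fun i => match i with inl a => U1 a | inr b => U2 b
  end).
split; first exact: simple_sum_add.
by rewrite /iso_count -!sum1dep_card big_sumType.
Qed.

Lemma mult_in_sum (K : finType) (P : pred K) (V : K -> 'M[F]_d) e
    (s : T -> 'M[F]_e) (c : K -> nat) :
    (forall k, P k -> mult_in r (V k) s (c k)) ->
      mxdirect (\sum_(k | P k) V k)%MS ->
  mult_in r (\sum_(k | P k) V k)%MS s (\sum_(k | P k) c k).
Proof.
move=> mV /mxdirectP /=; pose ks := [seq k <- index_enum K | P k].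
have bigks R idx op (G : K -> R) :
    \big[op/idx]_(k | P k) G k = \big[op/idx]_(k <- ks) G k.
  by rewrite [RHS]big_filter.
rewrite !bigks; have : all P ks by apply: filter_all.
elim: (ks) => [|k {}ks IH] {bigks}.
  rewrite !big_nil => _ _; exists 'I_0, (fun=> 0); split.
    by split=> [[]||]; rewrite ?big_ord0 ?mxrank0.
  by rewrite /iso_count; apply/esym/eqP; rewrite cards_eq0; apply/eqP/setP;
    case.
rewrite !big_cons /= => /andP[Pk Pks] rk.
have leks : (\rank (\sum_(j <- ks) V j)%MS <= \sum_(j <- ks) \rank (V j))%N.
  elim: ks {IH Pks rk} => [|j ks IH]; first by rewrite !big_nil mxrank0.
  rewrite !big_cons (leq_trans _ (leq_add (leqnn _) IH)) //.
  by rewrite mxrank_adds_leqif.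
have le := mxrank_adds_leqif (V k) (\sum_(j <- ks) V j)%MS.
have eks : \rank (\sum_(j <- ks) V j)%MS = (\sum_(j <- ks) \rank (V j))%N.
  apply/eqP; rewrite eqn_leq leks -(leq_add2l (\rank (V k))) -rk.
  by rewrite le.
by apply: mult_in_add; [exact: mV | exact: IH | rewrite rk eks].
Qed.

Lemma simple_in (V : 'M[F]_d) : is_submodule r V -> V != 0 ->
  exists2 S, is_simple r S & (S <= V)%MS.
Proof.
have [k] := ubnP (\rank V); elim: k V => // k IH V leVk sV nV.
have [[W [sW WV nW VW]] | noW] := EM (exists W, [/\ is_submodule r W,
    (W <= V)%MS, W != 0 & ~~ (V <= W)%MS]).
  have [|S simS SW] := IH W _ sW nW; last by exists S => //; apply:
    submx_trans WV.
  rewrite ltnS in leVk; apply: leq_trans leVk.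
  by rewrite (ltn_leqif (mxrank_leqif_sup WV)).
exists V => //; split=> // W sW WV nW; apply: contrapT => /negP VW.
by case: noW; exists W.
Qed.

(** Complete reducibility, in the form that averaging arguments produce. *)
Definition has_projections : Prop := forall W : 'M[F]_d, is_submodule r W ->
  exists g : 'M[F]_d, [/\ forall x, g *m r x = r x *m g, (g <= W)%MS & W *m g =
    W].

Lemma simple_sum_exists (V : 'M[F]_d) : has_projections -> is_submodule r V ->
  exists (I : finType) (U : I -> 'M[F]_d), simple_sum r V U.
Proof.
move=> proj; have [k] := ubnP (\rank V); elim: k V => // k IH V leVk sV.
have [-> | nV] := eqVneq V 0.
  exists 'I_0, (fun=> 0).
  by split=> [[]||]; rewrite ?big_ord0 ?mxrank0.
have [S simS SV] := simple_in sV nV.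
have [g [gr gS Sg]] := proj S (let: And3 s _ _ := simS in s).
have ggE : g *m g = g by have /submxP[w {1 3}->] := gS; rewrite -mulmxA Sg.
pose V' := V *m (1%:M - g).
have sV' : is_submodule r V'.
  move=> x; rewrite /V' -mulmxA mulmxBl gr mul1mx -[X in X - _]mulmx1 -mulmxBr.
  by rewrite mulmxA submxMr.
have eV : (S + V' :=: V)%MS.
  apply/eqmxP/andP; split.
    rewrite addsmx_sub SV /V' mulmxBr mulmx1 addmx_sub // -mulmxN.
    by rewrite mulmxN eqmx_opp (submx_trans _ SV) //
      (submx_trans (submxMl _ _)).
  rewrite -[X in (X <= _)%MS](subrK (V *m g)) -{1}[V]mulmx1 -mulmxBr addrC.
  by rewrite addmx_sub_adds // (submx_trans (submxMl _ _)).
have SV'0 : (S :&: V')%MS = 0.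
  have : (S :&: V' <= S)%MS by apply: capmxSl.
  case/submxP=> u eu; have : (S :&: V' <= V')%MS by apply: capmxSr.
  case/submxP=> w ew; have : (S :&: V')%MS *m g = (S :&: V')%MS.
    by rewrite eu -mulmxA Sg.
  by rewrite {1}ew /V' -!mulmxA mulmxBl mul1mx ggE subrr !mulmx0.
have rV : \rank (S + V')%MS = (\rank S + \rank V')%N.
  by have := introT mxdirect_addsP SV'0; rewrite mxdirectE /= => /eqP.
have [_ nS _] := simS.
have [|I [U sU]] := IH V' _ sV'.
  rewrite ltnS in leVk; apply: leq_trans leVk.
  by rewrite -eV rV -[X in (X < _)%N]add0n ltn_add2r lt0n mxrank_eq0.
have sS : simple_sum r S (fun _ : unit => S).
  by split=> //; rewrite ?(big_pred1 tt) //; case.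
exists (unit + I)%type, (fun i => match i with inl _ => S | inr j => U j end).
have [sim sumU rU] := simple_sum_add sS sU rV.
by split=> //; [apply: eqmx_trans eV | rewrite rU eV].
Qed.

(** Maschke's theorem in terms of a separability idempotent, the sum of the a j
    (x) b j. Averaging a linear projection to W over it gives a homomorphism,
    and this is still a projection to W since the a j and b j preserve W and the
    sum of the a j b j is 1. *)
Lemma separable_projections (J : finType) (a b : J -> 'M[F]_d) :
    (forall W, is_submodule r W -> forall j, stablemx W (a j)) ->
    (forall W, is_submodule r W -> forall j, stablemx W (b j)) ->
    \sum_j a j *m b j = 1%:M ->
    (forall x g, (\sum_j a j *m g *m b j) *m r x = r x *m \sum_j a j *m g *m b
      j) ->
  has_projections.
Proof.
move=> sa sb ab1 comm W sW; exists (\sum_j a j *m proj_mx W W^C%MS *m b j).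
split=> [x||]; first exact: comm.
  apply: summx_sub => j _; apply: submx_trans (sb _ sW j).
  by apply: submxMr; apply: proj_mx_sub.
rewrite mulmx_sumr -[RHS]mulmx1 -ab1 mulmx_sumr; apply: eq_bigr => j _.
rewrite [LHS]mulmxA [RHS]mulmxA; congr (_ *m _); rewrite mulmxA.
by apply: proj_mx_id; [exact: capmx_compl | exact: sa].
Qed.

(** For completely reducible modules the default value of multiplicity is never
    taken. *)
Lemma multiplicity_in e (s : T -> 'M[F]_e) :
  has_projections -> mult_in r 1%:M s (multiplicity r s).
Proof.
move=> proj; apply/has_multiplicityE; apply: classical_sets.xgetPex.
have [x|I [U sU]] := @simple_sum_exists 1%:M proj _; first exact: submx1.
by exists (iso_count r U s); apply/has_multiplicityE; exists I, U.
Qed.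

End OneModule.

(** A multiplicity in the module r' can be computed in the image of an embedding
    j of r' in r. *)
Lemma mult_in_transport d e (r : T -> 'M[F]_d) (r' : T -> 'M[F]_e)
  (j : 'M[F]_(e, d))
    a (s : T -> 'M[F]_a) c :
    row_free j -> (forall x, r' x *m j = j *m r x) ->
  mult_in r' 1%:M s c -> mult_in r <<j>>%MS s c.
Proof.
move=> fj jr [I [U [[simU sumU rU] ->]]].
exists I, (fun i => <<U i *m j>>%MS); split; first split.
- move=> i; have [sU nU minU] := simU i; split.
  + move=> x; rewrite genmxE (eqmxMr _ (genmxE _)) -mulmxA -jr mulmxA.
    exact: submxMr.
  + by rewrite -mxrank_eq0 genmxE mxrank_eq0 mulmx_free_eq0.
  move=> W sW; rewrite genmxE => WU nW; rewrite genmxE.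
  have /submxP[w eW] := WU; pose W' := <<w *m U i>>%MS.
  have eW' : (W' *m j :=: W)%MS.
    by apply: eqmx_trans (eqmxMr j (genmxE _)) _; rewrite -mulmxA -eW.
  rewrite -eW' submxMr // minU //.
  + move=> x; rewrite genmxE (eqmxMr _ (genmxE _)) -(submxMfree _ _ fj).
    by rewrite -mulmxA jr mulmxA -[w *m _ *m j]mulmxA -eW.
  + by rewrite genmxE submxMl.
  rewrite -mxrank_eq0 genmxE mxrank_eq0 -(mulmx_free_eq0 _ fj) -mulmxA -eW.
  exact: nW.
- apply: eqmx_trans (eqmx_sym (genmxE _)).
  apply: eqmx_trans (eqmx_sym (sumsmxMr_gen _ _ _)) _.
  by rewrite -[X in (_ :=: X)%MS]mul1mx; apply: eqmxMr.
- rewrite genmxE -[X in _ = \rank X]mul1mx mxrankMfree // -rU.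
  by apply: eq_bigr => i _; rewrite genmxE mxrankMfree.
apply: eq_card => i; rewrite !inE; apply: asbool_equiv_eq; split.
  case=> f [ff fU fs]; exists (f *m j); split=> [||x].
  - by rewrite /row_free mxrankMfree.
  - apply: eqmx_trans (eqmx_sym (genmxE _)); exact: eqmxMr.
  by rewrite mulmxA fs -!mulmxA jr.
case=> f [ff fU fs]; have /submxP[w ef] : (f <= U i *m j)%MS.
  by rewrite fU genmxE.
rewrite mulmxA in ef; exists (w *m U i); split=> [||x].
- by rewrite /row_free -(mxrankMfree _ fj) -ef.
- apply/eqmxP; rewrite -(submxMfree _ (U i) fj) -(submxMfree (U i) _ fj) -ef.
  by apply/eqmxP; apply: eqmx_trans fU (genmxE _).
by apply: (row_free_inj fj); rewrite -[LHS]mulmxA -ef fs ef -!mulmxA jr.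
Qed.

End SemisimpleModules.

(** * Difunctional relations *)

(** Composition, converse, the graph of a function and the relation of a block
    bijection are locked: comparing two distinct terms built from them would
    otherwise unfold the finite sets behind. *)
HB.lock Definition rcomp (A B C : finType) (Q : {set A * B}) (R : {set B * C})
  : {set A * C} :=
  [set ac | [exists b, ((ac.1, b) \in Q) && ((b, ac.2) \in R)]].

HB.lock Definition conv (A B : finType) (Q : {set A * B}) : {set B * A} :=
  [set ba | (ba.2, ba.1) \in Q].

HB.lock Definition graph (A P : finType) (pt : P) (f : {ffun A -> P}) :
  {set A * P} :=
  [set xc | (f xc.1 == xc.2) && (xc.2 != pt)].

HB.lock Definition rel_of (n : nat) (x : PIstar n) : {set 'I_n * 'I_n} :=
  [set ij | [exists p in PIgraph x, (ij.1 \in p.1) && (ij.2 \in p.2)]].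

Notation "Q ** R" := (rcomp Q R) (at level 40, left associativity).
Notation "Q ^v" := (conv Q) (at level 2, format "Q ^v").

Lemma rcompP (A B C : finType) (Q : {set A * B}) (R : {set B * C}) a c :
  reflect (exists2 b, (a, b) \in Q & (b, c) \in R) ((a, c) \in Q ** R).
Proof.
rewrite rcomp.unlock inE; apply: (iffP existsP) => [[b /andP[h1 h2]]|[b h1 h2]];
  exists b => //.
by rewrite h1 h2.
Qed.

Lemma mem_conv (A B : finType) (Q : {set A * B}) a b :
  ((b, a) \in Q^v) = ((a, b) \in Q).
Proof. by rewrite conv.unlock inE. Qed.

Lemma rcompA (A B C D : finType) (Q : {set A * B}) (R : {set B * C})
  (S : {set C * D}) : Q ** (R ** S) = Q ** R ** S.
Proof.
apply/setP=> -[a d]; apply/rcompP/rcompP.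
  by case=> b Qab /rcompP[c Rbc Scd]; exists c => //; apply/rcompP; exists b.
by case=> c /rcompP[b Qab Rbc] Scd; exists b => //; apply/rcompP; exists c.
Qed.

Lemma convK (A B : finType) (Q : {set A * B}) : Q^v^v = Q.
Proof. by apply/setP=> -[a b]; rewrite !mem_conv. Qed.

Lemma conv_rcomp (A B C : finType) (Q : {set A * B}) (R : {set B * C}) :
  (Q ** R)^v = R^v ** Q^v.
Proof.
apply/setP=> -[c a]; rewrite mem_conv; apply/rcompP/rcompP.
  by case=> b h1 h2; exists b; rewrite mem_conv.
by case=> b; rewrite !mem_conv => h1 h2; exists b.
Qed.

Section Difunctional.

Variables A B : finType.
Implicit Type Q : {set A * B}.

(** The relations Q between A and B that are block bijections: x Q y, x' Q y and
    x' Q y' imply x Q y'. *)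
Definition difun Q : bool := Q ** Q^v ** Q == Q.
(** The domain of a block bijection, as a partial equivalence relation on A: two
    points are related when they lie in the same part. The codomain is dom_per
    Q^v. *)
Definition dom_per Q : {set A * A} := locked (Q ** Q^v).

Lemma dom_perE Q : dom_per Q = Q ** Q^v.
Proof. by rewrite /dom_per -lock. Qed.

Lemma difunP Q : reflect (forall x y x' y', (x, y) \in Q -> (x', y) \in Q ->
   (x', y') \in Q -> (x, y') \in Q) (difun Q).
Proof.
apply: (iffP eqP) => [eQ x y x' y' h1 h2 h3|h].
  rewrite -eQ; apply/rcompP; exists x' => //; apply/rcompP; exists y => //.
  by rewrite mem_conv.
apply/setP=> -[x y']; apply/rcompP/idP.
  case=> x' /rcompP[y h1]; rewrite mem_conv => h2 h3; exact: h h1 h2 h3.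
move=> h1; exists x => //; apply/rcompP; exists y' => //; by rewrite mem_conv.
Qed.

Lemma conv_dom_per Q : (dom_per Q)^v = dom_per Q.
Proof. by rewrite dom_perE conv_rcomp convK. Qed.

Lemma dom_per_rcomp Q : difun Q -> dom_per Q ** Q = Q.
Proof. by rewrite dom_perE => /eqP. Qed.

End Difunctional.

Lemma difun_conv (A B : finType) (Q : {set A * B}) : difun Q -> difun Q^v.
Proof.
by move/eqP=> e; apply/eqP; rewrite convK -[in RHS]e !conv_rcomp convK rcompA.
Qed.

Lemma rcomp_cod_per (A B : finType) (Q : {set A * B}) : difun Q ->
  Q ** dom_per Q^v = Q.
Proof. by move/eqP=> e; rewrite dom_perE convK rcompA. Qed.

Lemma dom_per_idem (A B : finType) (Q : {set A * B}) :
  difun Q -> dom_per Q ** dom_per Q = dom_per Q.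
Proof. by move/dom_per_rcomp=> e; rewrite {2}dom_perE rcompA e -dom_perE. Qed.

(** For partial equivalence relations s and t, the equation s ** t = s says that
    each part of s is a union of parts of t. This is the natural order of the
    semigroup; below, the codomain of Q is below the domain of R, so that
    composing with R loses no part of Q. *)
Section ComposableArrows.
Variables (A B C : finType) (Q : {set A * B}) (R : {set B * C}).
Hypothesis dQ : difun Q.

Lemma dom_per_rcomp_le : dom_per Q^v ** dom_per R = dom_per Q^v ->
  dom_per (Q ** R) = dom_per Q.
Proof.
move=> le; have -> : dom_per (Q ** R) = Q ** dom_per R ** Q^v.
  by rewrite !dom_perE conv_rcomp !rcompA.
by rewrite [RHS]dom_perE -[X in X ** dom_per R](rcomp_cod_per dQ)
  -[X in X ** _]rcompA le rcomp_cod_per.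
Qed.

Lemma difun_rcomp_le : dom_per Q^v ** dom_per R = dom_per Q^v -> difun (Q ** R).
Proof.
move=> le; apply/eqP; rewrite -(dom_perE _) dom_per_rcomp_le // rcompA.
by rewrite dom_per_rcomp.
Qed.
End ComposableArrows.

Section PartialEquivalence.
Variable A : finType.
Implicit Types s t : {set A * A}.

Definition per s : bool := (s^v == s) && (s ** s == s).

Lemma perP s : reflect (s^v = s /\ s ** s = s) (per s).
Proof. by apply: (iffP andP) => [[/eqP ? /eqP ?]|[-> ->]]. Qed.

Lemma per_dom_per (B : finType) (Q : {set A * B}) : difun Q -> per (dom_per Q).
Proof. by move=> dQ; apply/perP; rewrite conv_dom_per dom_per_idem. Qed.

Lemma dom_per_per s : per s -> dom_per s = s.
Proof. by move/perP=> [e1 e2]; rewrite dom_perE e1. Qed.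

Lemma difun_per s : per s -> difun s.
Proof. by move=> ps; rewrite /difun -(dom_perE s) dom_per_per //; case/perP:
  ps => _ ->. Qed.

Lemma per_conv s : per s -> s^v = s.
Proof. by case/perP. Qed.

Lemma per_idem s : per s -> s ** s = s.
Proof. by case/perP. Qed.

Lemma per_anti s t : per s -> per t -> s ** t = s -> t ** s = t -> s = t.
Proof.
move=> ps pt e1 e2.
by rewrite -(per_conv ps) -e1 conv_rcomp !per_conv.
Qed.

End PartialEquivalence.

(** * Functions to a pointed set *)

Section PointedFunctions.

Variables (A P : finType) (pt : P).
Implicit Types (f g : {ffun A -> P}) (Q : {set A * A}).

Local Notation graph := (graph pt).

Lemma mem_graph f x c : ((x, c) \in graph f) = (f x == c) && (c != pt).
Proof. by rewrite graph.unlock inE. Qed.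

(** The subquotient whose parts are the fibers of f away from pt. *)
Definition fibers f : {set A * A} := dom_per (graph f).

Lemma mem_fibers f x y : ((x, y) \in fibers f) = (f x == f y) && (f x != pt).
Proof.
rewrite /fibers dom_perE; apply/rcompP/andP=> [[c]|[/eqP e n0]].
  by rewrite mem_conv !mem_graph => /andP[/eqP<- n0] /andP[/eqP->].
by exists (f x); rewrite ?mem_conv mem_graph ?e ?eqxx ?n0 // -e n0.
Qed.

Lemma difun_graph f : difun (graph f).
Proof.
apply/difunP=> x y x' y'; rewrite !mem_graph.
by move=> /andP[/eqP<- _] /andP[/eqP<- _] /andP[/eqP-> ->]; rewrite eqxx.
Qed.

Lemma per_fibers f : per (fibers f).
Proof. exact/per_dom_per/difun_graph. Qed.

Lemma fibers_graph f : fibers f ** graph f = graph f.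
Proof. exact/dom_per_rcomp/difun_graph. Qed.

Lemma graph_inj f g : graph f = graph g -> f = g.
Proof.
move=> e; apply/ffunP=> x.
have : ((x, f x) \in graph f) = ((x, f x) \in graph g) by rewrite e.
have : ((x, g x) \in graph f) = ((x, g x) \in graph g) by rewrite e.
rewrite !mem_graph !eqxx /= [g x == f x]eq_sym.
by case: eqP => //= _; case: eqP => [->|_ //]; case: eqP => [->|].
Qed.

Lemma fibers_le_rcomp f Q : (fibers f ** Q == fibers f) =
  (Q^v ** graph f == graph f).
Proof.
apply/eqP/eqP => e.
  rewrite -[in LHS](fibers_graph f) rcompA -[in LHS](per_conv (per_fibers f)).
  by rewrite -conv_rcomp e per_conv ?per_fibers // fibers_graph.
by rewrite /fibers dom_perE -rcompA -{1}[Q]convK -conv_rcomp e.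
Qed.

(** Each fiber of f, except that of pt, is a union of parts of the domain of Q. *)
Definition compat Q f : bool := fibers f ** dom_per Q == fibers f.

Lemma compatE Q f : compat Q f = (dom_per Q ** graph f == graph f).
Proof. by rewrite /compat fibers_le_rcomp conv_dom_per. Qed.

(** Transport along Q of a function that is constant on the parts of the domain
    of Q; points outside the codomain of Q go to pt. The value does not depend
    on the point that is picked when Q and f are compatible. *)
Definition push Q f : {ffun A -> P} :=
  [ffun y => oapp f pt [pick x | (x, y) \in Q]].

Lemma graph_push Q f : compat Q f -> graph (push Q f) = Q^v ** graph f.
Proof.
rewrite compatE => /eqP e; apply/setP=> -[y c]; rewrite mem_graph ffunE.
case: pickP => [x /= Qxy|noQ] /=; last first.
  rewrite eq_sym andbN; apply/esym/negbTE/rcompP => -[x].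
  by rewrite mem_conv noQ.
apply/idP/rcompP => [h|[x' Qx'y h]].
  by exists x; rewrite ?mem_conv ?mem_graph.
rewrite -mem_graph -e; apply/rcompP; exists x' => //; rewrite dom_perE.
by apply/rcompP; exists y => //; rewrite mem_conv in Qx'y *.
Qed.

Lemma compat_fibers f : compat (fibers f) f.
Proof. by rewrite /compat dom_per_per ?per_idem ?per_fibers. Qed.

Lemma push_fibers f : push (fibers f) f = f.
Proof.
by apply: graph_inj; rewrite graph_push ?compat_fibers // per_conv
  ?per_fibers // fibers_graph.
Qed.

Lemma fibers_push Q f : compat Q f -> fibers (push Q f) = dom_per
  (fibers f ** Q)^v.
Proof.
move=> cf; have -> : fibers (push Q f) = Q^v ** fibers f ** Q.
  by rewrite /fibers !dom_perE graph_push // conv_rcomp convK !rcompA.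
rewrite dom_perE convK conv_rcomp (per_conv (per_fibers f)) !rcompA.
by rewrite -[X in _ = X ** _]rcompA (per_idem (per_fibers f)).
Qed.

Lemma push_restr Q f : compat Q f ->
  compat (fibers f ** Q) f /\ push (fibers f ** Q) f = push Q f.
Proof.
move=> cf; have cQ : compat (fibers f ** Q) f.
  move: (cf); rewrite !compatE => /eqP e; apply/eqP.
  rewrite dom_perE conv_rcomp (per_conv (per_fibers f)) -!rcompA.
  by rewrite fibers_graph (rcompA Q) -(dom_perE Q) e fibers_graph.
split=> //; apply: graph_inj; rewrite !graph_push // conv_rcomp.
by rewrite (per_conv (per_fibers f)) -rcompA fibers_graph.
Qed.

Lemma push_comp Q R f : compat Q f -> compat R (push Q f) ->
  compat (Q ** R) f /\ push (Q ** R) f = push R (push Q f).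
Proof.
move=> cQ cR; have cQR : compat (Q ** R) f.
  move: (cQ) (cR); rewrite !compatE graph_push // => /eqP e1 /eqP e2.
  by rewrite dom_perE conv_rcomp -!rcompA (rcompA R) -(dom_perE R) e2 rcompA
    -(dom_perE Q) e1.
by split=> //; apply: graph_inj; rewrite !graph_push // conv_rcomp rcompA.
Qed.

Lemma compat_dom_per Q f : difun Q -> fibers f = dom_per Q -> compat Q f.
Proof. by move=> dQ e; rewrite /compat e dom_per_idem. Qed.

Lemma fibers_push_dom_per Q f : difun Q -> fibers f = dom_per Q ->
  fibers (push Q f) = dom_per Q^v.
Proof.
by move=> dQ e; rewrite fibers_push ?compat_dom_per // e dom_per_rcomp.
Qed.

End PointedFunctions.

(** * Block bijections as difunctional relations *)

Section PIstarRelations.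

Variable n : nat.
Implicit Types x z : PIstar n.
Local Notation rel := {set 'I_n * 'I_n}.

Lemma rel_ofP x i j :
  reflect (exists2 p, p \in PIgraph x & i \in p.1 /\ j \in p.2)
    ((i, j) \in rel_of x).
Proof.
rewrite rel_of.unlock inE; apply: (iffP exists_inP) =>
  [[p px /andP[]]|[p px [h1 h2]]].
  by exists p.
by exists p; rewrite ?h1.
Qed.

Lemma PIpart_eq x p q : p \in PIgraph x -> q \in PIgraph x ->
  (p.1 == q.1) = (p.2 == q.2).
Proof.
have /and3P[_ _ /forall_inP h] := PIgraphP x => px qx.
by have /forall_inP/(_ q qx)/eqP := h p px.
Qed.

Lemma PIpart1 x p q i : p \in PIgraph x -> q \in PIgraph x ->
  i \in p.1 -> i \in q.1 -> p = q.
Proof.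
have /and3P[/andP[t1 _] _ _] := PIgraphP x => px qx ip iq.
have e1 : p.1 = q.1.
  by rewrite -(def_pblock t1 _ ip) ?(def_pblock t1 _ iq) //; apply: imset_f.
have e2 : p.2 = q.2 by apply/eqP; rewrite -(PIpart_eq px qx) e1.
by apply/eqP; rewrite -pair_eqE /= /pair_eq e1 e2 !eqxx.
Qed.

Lemma PIpart2 x p q i : p \in PIgraph x -> q \in PIgraph x ->
  i \in p.2 -> i \in q.2 -> p = q.
Proof.
have /and3P[_ /andP[t1 _] _] := PIgraphP x => px qx ip iq.
have e2 : p.2 = q.2.
  by rewrite -(def_pblock t1 _ ip) ?(def_pblock t1 _ iq) //; apply: imset_f.
have e1 : p.1 = q.1 by apply/eqP; rewrite (PIpart_eq px qx) e2.
by apply/eqP; rewrite -pair_eqE /= /pair_eq e1 e2 !eqxx.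
Qed.

Lemma PIpart_n0 x p : p \in PIgraph x -> (exists i, i \in p.1) /\
  (exists j, j \in p.2).
Proof.
have /and3P[/andP[_ n1] /andP[_ n2] _] := PIgraphP x => px; split.
  by apply/set0Pn; apply: contraNneq n1 => <-; apply: imset_f.
by apply/set0Pn; apply: contraNneq n2 => <-; apply: imset_f.
Qed.

Lemma difun_rel_of x : difun (rel_of x).
Proof.
apply/difunP=> i j i' j' /rel_ofP[p px [ip jp]] /rel_ofP[q qx [iq jq]]
  /rel_ofP[r rx [ir jr]].
rewrite -(PIpart1 qx rx iq ir) -(PIpart2 px qx jp jq) in jr *.
by apply/rel_ofP; exists p.
Qed.

(** The relation of x determines the parts of x: the part of i in the domain
    consists of the points related to the same points as i. *)
Lemma PIgraphE x p i j : p \in PIgraph x -> i \in p.1 -> j \in p.2 ->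
  p = ([set i' | (i', j) \in rel_of x], [set j' | (i, j') \in rel_of x]).
Proof.
move=> px ip jp; rewrite [LHS]surjective_pairing; congr (_, _).
  apply/setP=> i'; rewrite inE; apply/idP/rel_ofP => [i'p|[q qx [iq jq]]].
    by exists p.
  by rewrite (PIpart2 px qx jp jq).
apply/setP=> j'; rewrite inE; apply/idP/rel_ofP => [i'p|[q qx [iq jq]]].
  by exists p.
by rewrite (PIpart1 px qx ip iq).
Qed.

Lemma rel_of_inj : injective (@rel_of n).
Proof.
have sub (x z : PIstar n) : rel_of x = rel_of z -> PIgraph x \subset PIgraph z.
  move=> e; apply/subsetP=> p px; have [[i ip] [j jp]] := PIpart_n0 px.
  rewrite (PIgraphE px ip jp) e.
  have /rel_ofP[q qz [iq jq]] : (i, j) \in rel_of z by rewrite -e;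
    apply/rel_ofP; exists p.
  by rewrite -(PIgraphE qz iq jq).
by move=> x z e; apply/val_inj/eqP; rewrite eqEsubset !sub.
Qed.

Definition arrow_graph (Q : rel) : {set {set 'I_n} * {set 'I_n}} :=
  [set ([set i | (i, ij.2) \in Q], [set j | (ij.1, j) \in Q]) | ij in Q].

Lemma is_PIstar0 : @is_PIstar n set0.
Proof.
by rewrite /is_PIstar /raw_dom /raw_cod !imset0 /is_subquotient !inE;
  apply/and3P;
  split; rewrite ?andbT; try (by apply/trivIsetP=> A B; rewrite inE);
  apply/forall_inP => p; rewrite inE.
Qed.

Lemma arrow_graphP Q : difun Q -> is_PIstar (arrow_graph Q).
Proof.
move/difunP=> dQ; apply/and3P; split.
- rewrite /raw_dom -imset_comp; apply/andP; split.
    apply/trivIsetP=> _ _ /imsetP[[i j] ij ->] /imsetP[[i' j'] ij' ->] /=.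
    apply: contraR => /pred0Pn[a /=]; rewrite !inE => /andP[h1 h2].
    by apply/eqP/setP=> b; rewrite !inE; apply/idP/idP => h;
      [exact: dQ h h1 h2 | exact: dQ h h2 h1].
  apply/imsetP => -[[i j] ij /= /setP/(_ i)]; by rewrite !inE ij.
- rewrite /raw_cod -imset_comp; apply/andP; split.
    apply/trivIsetP=> _ _ /imsetP[[i j] ij ->] /imsetP[[i' j'] ij' ->] /=.
    apply: contraR => /pred0Pn[a /=]; rewrite !inE => /andP[h1 h2].
    by apply/eqP/setP=> b; rewrite !inE; apply/idP/idP => h;
      [exact: dQ h2 h1 h | exact: dQ h1 h2 h].
  apply/imsetP => -[[i j] ij /= /setP/(_ j)]; by rewrite !inE ij.
apply/forall_inP=> _ /imsetP[[i j] ij ->]; apply/forall_inP=> _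
  /imsetP[[i' j'] ij' ->].
rewrite /= in ij ij' *; apply/eqP; apply/eqP/eqP=> /setP e; apply/setP=> b;
  rewrite !inE.
  have := e i; have := e i'; rewrite !inE ij ij' => h1 /esym h2.
  by apply/idP/idP => h; [exact: dQ ij' h2 h | exact: dQ ij h1 h].
have := e j; have := e j'; rewrite !inE ij ij' => h1 /esym h2.
by apply/idP/idP => h; [exact: dQ h ij h1 | exact: dQ h h1 ij].
Qed.

(** The parts are the sections of the relation; a relation that is not
    difunctional yields the empty bijection. *)
Lemma PI_of_exists Q : {x : PIstar n | difun Q -> rel_of x = Q}.
Proof.
have [dQ|nQ] := boolP (difun Q); last by exists (MkPIstar is_PIstar0).
exists (MkPIstar (arrow_graphP dQ)) => _.
apply/setP=> -[i j]; apply/rel_ofP/idP => [[p]|ij].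
  case/imsetP=> -[i' j'] /= ij' ->.
  by rewrite !inE => -[h1 h2]; move/difunP: dQ => dQ; exact: dQ h1 ij' h2.
exists ([set i' | (i', j) \in Q], [set j' | (i, j') \in Q]);
  last by rewrite !inE.
by apply/imsetP; exists (i, j).
Qed.

Definition PI_of (Q : rel) : PIstar n := sval (PI_of_exists Q).

Lemma rel_of_PI_of Q : difun Q -> rel_of (PI_of Q) = Q.
Proof. by rewrite /PI_of; case: (PI_of_exists Q). Qed.

Lemma PI_of_rel_of x : PI_of (rel_of x) = x.
Proof. by apply: rel_of_inj; rewrite rel_of_PI_of ?difun_rel_of. Qed.

Lemma PIdom_dom_per x z : (PIdom x == PIdom z) =
  (dom_per (rel_of x) == dom_per (rel_of z)).
Proof.
have mem (y : PIstar n) i i' : ((i, i') \in dom_per (rel_of y)) =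
  [exists C in PIdom y, (i \in C) && (i' \in C)].
  rewrite dom_perE; apply/rcompP/exists_inP =>
    [[j /rel_ofP[p py [ip jp]]]|[_ /imsetP[p py ->] /andP[h1 h2]]].
    rewrite mem_conv => /rel_ofP[q qy [iq jq]]; exists p.1; first exact:
      imset_f.
    by rewrite ip (PIpart2 py qy jp jq).
  have [_ [j jp]] := PIpart_n0 py.
  by exists j; rewrite ?mem_conv; apply/rel_ofP; exists p.
apply/eqP/eqP => e; first by apply/setP=> -[i i']; rewrite !mem e.
have sub (y y' : PIstar n) : dom_per (rel_of y) = dom_per (rel_of y') ->
  PIdom y \subset PIdom y'.
  move=> {}e; apply/subsetP=> _ /imsetP[p py ->].
  have [[i ip] _] := PIpart_n0 py.
  have : (i, i) \in dom_per (rel_of y').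
    by rewrite -e mem; apply/exists_inP; exists p.1; rewrite ?imset_f ?ip.
  rewrite mem => /exists_inP[_ /imsetP[q qy' ->] /andP[iq _]].
  suff -> : p.1 = q.1 by apply: imset_f.
  apply/setP=> i'; have := mem y i i'; rewrite e mem => eq.
  apply/idP/idP => h.
    have : [exists C in PIdom y, (i \in C) && (i' \in C)].
      by apply/exists_inP; exists p.1; rewrite ?imset_f ?ip.
    rewrite -eq => /exists_inP[_ /imsetP[q' q'y ->] /andP[h1 h2]].
    by rewrite (PIpart1 qy' q'y iq h1).
  have : [exists C in PIdom y', (i \in C) && (i' \in C)].
    by apply/exists_inP; exists q.1; rewrite ?imset_f ?iq.
  rewrite eq => /exists_inP[_ /imsetP[q' q'y ->] /andP[h1 h2]].
  by rewrite (PIpart1 py q'y ip h1).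
by apply/eqP; rewrite eqEsubset !sub.
Qed.

End PIstarRelations.

(** * Products that restrict to a composition *)

Section SemigroupProduct.

Variables (n : nat) (x z : PIstar n).
Local Notation cz := (dom_per (rel_of z)^v).
Local Notation dx := (dom_per (rel_of x)).

Lemma mem_dom (y : PIstar n) i :
  ((i, i) \in dom_per (rel_of y)) = (i \in cover (PIdom y)).
Proof.
rewrite dom_perE; apply/rcompP/bigcupP =>
  [[j /rel_ofP[p py [ip _]] _]|[_ /imsetP[p py ->] ip]].
  by exists p.1; first exact: imset_f.
have [_ [j jp]] := PIpart_n0 py.
by exists j; rewrite ?mem_conv; apply/rel_ofP; exists p.
Qed.

Lemma mem_cod (y : PIstar n) i :
  ((i, i) \in dom_per (rel_of y)^v) = (i \in cover (PIcod y)).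
Proof.
rewrite dom_perE; apply/rcompP/bigcupP.
  by case=> j; rewrite mem_conv => /rel_ofP[p py [_ ip]] _; exists p.2;
    first exact: imset_f.
case=> _ /imsetP[p py ->] ip; have [[j jp] _] := PIpart_n0 py.
by exists j; rewrite ?mem_conv; apply/rel_ofP; exists p.
Qed.

Lemma dom_per_rel_ofP (y : PIstar n) i j :
  reflect (exists2 p, p \in PIgraph y & i \in p.1 /\ j \in p.1)
    ((i, j) \in dom_per (rel_of y)).
Proof.
rewrite dom_perE; apply: (iffP (rcompP _ _ _ _)).
  case=> a /rel_ofP[p py [ip ap]]; rewrite mem_conv => /rel_ofP[q qy [jq aq]].
  by exists p => //; rewrite (PIpart2 py qy ap aq) in ip *.
case=> p py [ip jp]; have [_ [a ap]] := PIpart_n0 py.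
by exists a; rewrite ?mem_conv; apply/rel_ofP; exists p.
Qed.

Lemma cod_per_rel_ofP (y : PIstar n) i j :
  reflect (exists2 p, p \in PIgraph y & i \in p.2 /\ j \in p.2)
    ((i, j) \in dom_per (rel_of y)^v).
Proof.
rewrite dom_perE convK; apply: (iffP (rcompP _ _ _ _)).
  case=> a; rewrite mem_conv => /rel_ofP[p py [ap ip]] /rel_ofP[q qy [aq jq]].
  by exists p => //; rewrite (PIpart1 py qy ap aq) in ip *.
case=> p py [ip jp]; have [[a ap] _] := PIpart_n0 py.
by exists a; rewrite ?mem_conv; apply/rel_ofP; exists p.
Qed.

Lemma same_partE i j : same_part x z i j = ((i, j) \in cz) || ((i, j) \in dx).
Proof.
apply/exists_inP/orP.
  case=> C; rewrite inE => /orP[] /imsetP[p py ->] /andP[ip jp]; [left|right].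
    by apply/cod_per_rel_ofP; exists p.
  by apply/dom_per_rel_ofP; exists p.
case=> [/cod_per_rel_ofP|/dom_per_rel_ofP] [p py [ip jp]].
  by exists p.2; rewrite ?ip // inE; apply/orP; left; apply: imset_f.
by exists p.1; rewrite ?ip // inE; apply/orP; right; apply: imset_f.
Qed.

Lemma conv_mem (A : finType) (s : {set A * A}) a b :
  s^v = s -> ((a, b) \in s) = ((b, a) \in s).
Proof. by move=> e; rewrite -{1}e mem_conv. Qed.

Lemma same_part_sym : connect_sym (same_part x z).
Proof.
apply: sym_connect_sym => i j.
by rewrite !same_partE (conv_mem _ _ (conv_dom_per _))
  (conv_mem _ _ (conv_dom_per (rel_of x))).
Qed.

Lemma PIomegaP B : reflect (exists i, B = [set j | connect (same_part x z) i j])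
  (B \in PIomega x z).
Proof.
apply: (iffP imsetP) => [[i _ ->]|[i ->]]; exists i => //.
  by apply/setP=> j; rewrite !inE.
by apply/setP=> j; rewrite !inE.
Qed.

Lemma PIomega_connect B i j : B \in PIomega x z -> i \in B ->
  (j \in B) = connect (same_part x z) i j.
Proof.
case/PIomegaP=> k ->; rewrite !inE => ki.
by rewrite -(same_connect same_part_sym ki).
Qed.

(** Under the hypothesis that each part of the codomain of z is a union of parts
    of the domain of x, gluing by omega adds nothing to the parts of cod z:
    these are exactly the contributing blocks, and the product is the
    composition of relations. *)
Lemma rel_of_PImul : cz ** dx = cz -> rel_of (PImul x z) = rel_of z ** rel_of x.
Proof.
move=> le; have dz := difun_rel_of z; have dxx := difun_rel_of x.
(* A part of cod z is closed under both generators of omega. *)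
have closed i j : (i, i) \in cz -> connect (same_part x z) i j -> (i, j) \in cz.
  move=> ii /connectP[p]; elim/last_ind: p j => [|p k IH] j;
    first by move=> _ ->.
  rewrite rcons_path last_rcons => /andP[pp]; rewrite same_partE => lk ->.
  have h := IH _ pp erefl; case/orP: lk => lk.
    by rewrite -(dom_per_idem (difun_conv dz)); apply/rcompP; exists (last i p).
  by rewrite -le; apply/rcompP; exists (last i p).
apply/setP=> -[a b]; apply/rel_ofP/rcompP.
  case=> pp /imsetP[B]; rewrite inE => /andP[Bo _] {pp}-> /= [].
  move=> /bigcupP[p /andP[pz pB] ap] /bigcupP[q /andP[qx qB] bq].
  have [_ [i ip]] := PIpart_n0 pz; have [[k kq] _] := PIpart_n0 qx.
  exists k; last by apply/rel_ofP; exists q.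
  rewrite -(rcomp_cod_per dz); apply/rcompP; exists i; first by apply/rel_ofP;
    exists p.
  apply: closed; first by apply/cod_per_rel_ofP; exists p.
  by rewrite -(PIomega_connect k Bo (subsetP pB i ip)) (subsetP qB).
case=> k ak kb; have [p pz [ap kp]] := rel_ofP _ _ _ ak; have [q qx [kq bq]] :=
  rel_ofP _ _ _ kb.
have kk : (k, k) \in cz by apply/cod_per_rel_ofP; exists p.
pose B := [set j | connect (same_part x z) k j].
have Bo : B \in PIomega x z by apply/PIomegaP; exists k.
exists (merged_pair x z B).
  apply: imset_f; rewrite inE Bo /=; apply/andP; split; apply/subsetP=> j;
    rewrite inE => kj.
    rewrite -mem_cod -(dom_per_idem (difun_conv dz)); apply/rcompP; exists k;
      last exact: closed.
    by rewrite (conv_mem _ _ (conv_dom_per _)); apply: closed.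
  rewrite -mem_dom; have := closed _ _ kk kj; rewrite -le => /rcompP[l _ lj].
  by rewrite -(dom_per_idem dxx); apply/rcompP; exists l;
    rewrite // (conv_mem _ _ (conv_dom_per _)).
split; apply/bigcupP; [exists p | exists q] => //; rewrite ?pz ?qx /=;
  apply/subsetP=> j jp; rewrite inE; apply: connect1; rewrite same_partE;
    apply/orP.
  by left; apply/cod_per_rel_ofP; exists p.
by right; apply/dom_per_rel_ofP; exists q.
Qed.

(** A product that keeps the domain of z cannot merge two parts of cod z nor
    lose one, so each part of cod z is a block of omega contained in the support
    of dom x. With rel_of_PImul this gives the action on the basis of a cell
    module. *)
Lemma PIdom_PImul : PIdom (PImul x z) = PIdom z -> cz ** dx = cz.
Proof.
move=> eD.
have key p i : p \in PIgraph z -> i \in p.2 -> exists B, [/\ B \in PIomega x z,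
    B = p.2 & B \subset cover (PIdom x)].
  move=> pz ip; have [[a ap] _] := PIpart_n0 pz.
  have : p.1 \in PIdom (PImul x z) by rewrite eD; apply: imset_f.
  case/imsetP=> pp /imsetP[B]; rewrite inE => /and3P[Bo Bz Bx] {pp}-> /= eB.
  exists B; split=> //; apply/eqP; rewrite eqEsubset.
  have pB : p.2 \subset B.
    move: ap; rewrite eB => /bigcupP[q /andP[qz qB] aq].
    suff <- : q = p by [].
    apply: (PIpart1 qz pz aq); rewrite eB; apply/bigcupP; exists q => //.
    by rewrite qz.
  rewrite pB andbT; apply/subsetP=> j jB.
  have /bigcupP[_ /imsetP[q qz ->] jq] := subsetP Bz j jB.
  have qB : q.2 \subset B.
    apply/subsetP=> l lq; rewrite (PIomega_connect l Bo jB).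
    by apply: connect1; rewrite same_partE; apply/orP; left;
      apply/cod_per_rel_ofP; exists q.
  have [[b bq] _] := PIpart_n0 qz.
  suff <- : q = p by [].
  by apply: (PIpart1 qz pz bq); rewrite eB; apply/bigcupP; exists q;
    rewrite // qz.
apply/setP=> -[i j]; apply/rcompP/idP.
  case=> k /cod_per_rel_ofP[p pz [ip kp]] kj; have [B [Bo eB Bx]] :=
    key p i pz ip.
  apply/cod_per_rel_ofP; exists p => //; split=> //;
    rewrite -eB (PIomega_connect j Bo (_ : k \in B)) ?eB //.
  by apply: connect1; rewrite same_partE kj orbT.
move=> ij; exists j => //; have /cod_per_rel_ofP[p pz [ip jp]] := ij.
have [B [Bo eB Bx]] := key p i pz ip.
by rewrite mem_dom (subsetP Bx) // eB.
Qed.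

End SemigroupProduct.

(** * Numbered subquotients as functions *)

Section ActionOnFunctions.

Variables (n : nat) (P : finType) (pt : P) (gT : finGroupType).
Variable to : {action gT &-> P}.
Hypothesis to_pt : forall g, to pt g = pt.
Implicit Types (f : {ffun 'I_n -> P}) (g : gT) (Q : {set 'I_n * 'I_n}).

(** The group acts on values. The inverse makes this a right action when
    products of permutations are read from right to left, as for right
    multiplication on the basis of a cell module. *)
Definition relabel f g : {ffun 'I_n -> P} := [ffun x => to (f x) g^-1%g].

Lemma relabel1 f : relabel f 1%g = f.
Proof. by apply/ffunP=> x; rewrite ffunE invg1 act1. Qed.

Lemma relabelM f g h : relabel f (g * h)%g = relabel (relabel f h) g.
Proof. by apply/ffunP=> x; rewrite !ffunE invMg actM. Qed.

Lemma relabel_eq_pt f g x : (relabel f g x == pt) = (f x == pt).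
Proof. by rewrite ffunE -{1}(to_pt g^-1%g) (inj_eq (@act_inj _ _ _ to _)). Qed.

Lemma fibers_relabel f g : fibers pt (relabel f g) = fibers pt f.
Proof.
apply/setP=> -[x y]; rewrite !mem_fibers relabel_eq_pt !ffunE.
by rewrite (inj_eq (@act_inj _ _ _ to _)).
Qed.

Lemma compat_relabel Q f g : compat pt Q (relabel f g) = compat pt Q f.
Proof. by rewrite /compat fibers_relabel. Qed.

Lemma push_relabel Q f g : push pt Q (relabel f g) = relabel (push pt Q f) g.
Proof.
by apply/ffunP=> y; rewrite !ffunE; case: pickP => [x _|_] /=;
  rewrite ?ffunE ?to_pt.
Qed.

End ActionOnFunctions.

Section OntoFunctions.

Variables n k : nat.
Implicit Types (f g h : {ffun 'I_n -> 'I_k.+1}) (Q : {set 'I_n * 'I_n}).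
Local Notation graph := (graph ord0).
Local Notation fibers := (fibers ord0).
Local Notation push := (push ord0).
Local Notation compat := (compat ord0).

(** A function with this property is a subquotient with k parts numbered from 1
    to k, the value ord0 standing for the points outside of the support. *)
Definition onto f : bool := [forall i : 'I_k, [exists x, f x == lift ord0 i]].

Lemma ontoP f : reflect (forall c, c != ord0 -> exists x, f x = c) (onto f).
Proof.
apply: (iffP forallP) => h c.
  move=> n0; have [i ->|/eqP] := unliftP ord0 c; last by rewrite (negPf n0).
  by have /existsP[x /eqP] := h i; exists x.
by have [x e] := h (lift ord0 c) isT; apply/existsP; exists x; rewrite e.
Qed.

Definition row_act (c : 'I_k.+1) (s : 'S_k) : 'I_k.+1 :=
  lift_perm ord0 ord0 s c.

Lemma row_act1 c : row_act c 1%g = c.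
Proof. by rewrite /row_act lift_perm1 perm1. Qed.

Lemma row_actM c : act_morph row_act c.
Proof. by move=> s t; rewrite /row_act -(lift_permM _ ord0) permM. Qed.

Definition row_action : {action 'S_k &-> 'I_k.+1} :=
  TotalAction row_act1 row_actM.

Lemma row_action0 s : row_action ord0 s = ord0.
Proof. exact: lift_perm_id. Qed.

Lemma row_action_lift i s : row_action (lift ord0 i) s = lift ord0 (s i).
Proof. exact: lift_perm_lift. Qed.

Lemma onto_relabel f s : onto (relabel row_action f s) = onto f.
Proof.
apply/ontoP/ontoP => h c n0.
  have [|x e] := h (row_action c s^-1%g).
    by rewrite -(row_action0 s^-1%g) (inj_eq (@act_inj _ _ _ row_action _)).
  by exists x; apply: (@act_inj _ _ _ row_action s^-1%g); rewrite -e ffunE.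
have [|x e] := h (row_action c s).
  by rewrite -(row_action0 s) (inj_eq (@act_inj _ _ _ row_action _)).
by exists x; rewrite ffunE e actK.
Qed.

Lemma onto_push Q f : compat Q f -> onto f -> onto (push Q f).
Proof.
move=> cQ /ontoP of_; apply/ontoP=> c n0; have [x fx] := of_ c n0.
have : (x, x) \in dom_per Q.
  have : (x, x) \in fibers f by rewrite mem_fibers eqxx fx.
  move: (cQ) => /eqP e; rewrite -e => /rcompP[a _ ax].
  move: ax; rewrite dom_perE => /rcompP[y _]; rewrite mem_conv => xy.
  by apply/rcompP; exists y; rewrite ?mem_conv.
rewrite dom_perE => /rcompP[y xy _]; exists y; apply/eqP.
have : (y, c) \in graph (push Q f).
  rewrite graph_push //; apply/rcompP; exists x; rewrite ?mem_conv //.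
  by rewrite mem_graph fx eqxx n0.
by rewrite mem_graph => /andP[].
Qed.

(** As f is onto, the composition of its converse graph with its graph is the
    identity of the nonzero values. *)
Lemma onto_id f g : onto f -> graph g ** ((graph f)^v ** graph f) = graph g.
Proof.
move/ontoP=> of_; apply/setP=> -[x c]; apply/rcompP/idP.
  case=> c' gx /rcompP[y]; rewrite mem_conv !mem_graph.
  by case/andP=> /eqP e1 _ /andP[/eqP <- _]; rewrite e1 -mem_graph.
move=> gx; exists c => //; move: gx; rewrite mem_graph => /andP[_ n0].
have [y fy] := of_ c n0; apply/rcompP; exists y;
  first by rewrite mem_conv mem_graph fy eqxx.
by rewrite mem_graph fy eqxx.
Qed.

Lemma onto_idl f g : onto f -> (graph f)^v ** graph f ** (graph g)^v =
  (graph g)^v.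
Proof.
by move=> of_; rewrite -[in RHS](onto_id g of_) !conv_rcomp convK.
Qed.

(** The bijection between the subquotients of f and g that matches the parts
    with the same number. *)
Definition arrow f g : {set 'I_n * 'I_n} := graph f ** (graph g)^v.

Lemma arrow_conv f g : (arrow f g)^v = arrow g f.
Proof. by rewrite /arrow conv_rcomp convK. Qed.

Lemma arrow_comp f g h : onto g -> arrow f g ** arrow g h = arrow f h.
Proof.
by move=> og; rewrite /arrow -rcompA (rcompA (graph g)^v) onto_idl.
Qed.

Lemma arrow_id f : arrow f f = fibers f.
Proof. by rewrite /fibers dom_perE. Qed.

Lemma dom_per_arrow f g : onto g -> dom_per (arrow f g) = fibers f.
Proof. by move=> og; rewrite dom_perE arrow_conv arrow_comp // arrow_id. Qed.

Lemma difun_arrow f g : onto f -> onto g -> difun (arrow f g).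
Proof. by move=> of_ og; apply/eqP; rewrite arrow_conv !arrow_comp. Qed.

Lemma compat_arrow f g : onto g -> compat (arrow f g) f.
Proof. by move=> og; rewrite /compat dom_per_arrow // per_idem ?per_fibers. Qed.

Lemma push_arrow f g : onto f -> onto g -> push (arrow f g) f = g.
Proof.
move=> of_ og; apply: (@graph_inj _ _ ord0); rewrite graph_push
  ?compat_arrow //.
by rewrite arrow_conv /arrow -rcompA onto_id.
Qed.

Lemma arrow_push f g Q : compat Q g -> arrow f g ** Q = arrow f (push Q g).
Proof.
by move=> cQ; rewrite /arrow graph_push // conv_rcomp convK rcompA.
Qed.

(** So the arrows out of a fixed subquotient are parametrised by the numberings
    of their codomains. *)
Lemma arrow_of Q f : difun Q -> dom_per Q = fibers f -> Q = arrow f (push Q f).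
Proof.
move=> dQ e; rewrite -arrow_push ?arrow_id; last by apply: compat_dom_per.
by rewrite -e dom_per_rcomp.
Qed.

Lemma arrow_relabel f g s : arrow (relabel row_action f s)
  (relabel row_action g s) = arrow f g.
Proof.
apply/setP=> -[x y]; apply/rcompP/rcompP => -[c];
  rewrite mem_conv !mem_graph ?ffunE.
  move=> /andP[/eqP<- n0] /andP[/eqP/(@act_inj _ _ _ row_action _) e _].
  exists (f x); rewrite ?mem_conv mem_graph ?e eqxx;
    by apply: contraNneq n0 => ->; rewrite row_action0.
move=> /andP[/eqP<- n0] /andP[/eqP e _]; exists (row_action (f x) s^-1%g);
  rewrite ?mem_conv mem_graph ffunE ?e eqxx;
  by apply: contraNneq n0 => h; apply/eqP;
     apply: (@act_inj _ _ _ row_action s^-1%g); rewrite row_action0.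
Qed.

Lemma onto_fibers_eq f g : onto f -> onto g -> fibers f = fibers g ->
  exists s, g = relabel row_action f s.
Proof.
move=> /ontoP of_ /ontoP og e.
have h i : exists j : 'I_k, exists x, g x = lift ord0 i /\ f x = lift ord0 j.
  have [//|x gx] := og (lift ord0 i).
  have : (x, x) \in fibers f by rewrite e mem_fibers eqxx gx.
  rewrite mem_fibers eqxx /= => n0.
  have [j fx|/eqP] := unliftP ord0 (f x); last by rewrite (negPf n0).
  by exists j, x.
have [s hs] := choice h.
have eq x y : f x != ord0 -> (f x == f y) = (g x == g y).
  move=> n0; have : ((x, y) \in fibers f) = ((x, y) \in fibers g) by rewrite e.
  have : ((x, x) \in fibers f) = ((x, x) \in fibers g) by rewrite e.
  by rewrite !mem_fibers !eqxx n0 /= => <-; rewrite !andbT.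
have s_inj : injective s.
  move=> i i' es; have [x [gx fx]] := hs i; have [x' [gx' fx']] := hs i'.
  apply: (@lift_inj _ ord0); rewrite -gx -gx'; apply/eqP; rewrite -eq.
    by rewrite fx fx' es.
  by rewrite fx.
exists (perm s_inj); apply/ffunP=> x; rewrite ffunE.
apply: (@act_inj _ _ _ row_action (perm s_inj)); rewrite actKV.
have [i gx|gx] := unliftP ord0 (g x); last first.
  rewrite gx row_action0; apply/esym/eqP; apply/negP=> /negP n0.
  have : (x, x) \in fibers g by rewrite -e mem_fibers eqxx.
  by rewrite mem_fibers gx eqxx.
have [x' [gx' fx']] := hs i; rewrite gx row_action_lift permE -fx'.
by apply/eqP; rewrite eq ?fx' // gx gx'.
Qed.

Lemma relabel_free f s : onto f -> relabel row_action f s = f -> s = 1%g.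
Proof.
move=> /ontoP of_ e; apply/permP=> i; rewrite perm1.
have [//|x fx] := of_ (lift ord0 i).
have := congr1 (fun g : {ffun 'I_n -> 'I_k.+1} => g x) e;
  rewrite /= ffunE fx => {}e.
by apply: (@lift_inj _ ord0); rewrite -row_action_lift -[in LHS]e actKV.
Qed.

End OntoFunctions.

Section Numbering.

Variables (n k : nat) (rho : numbered_subquotient n k).

Definition numfun : {ffun 'I_n -> 'I_k.+1} :=
  [ffun x => oapp (lift ord0) ord0 [pick i | x \in rho i]].

Lemma numfunE x i : (numfun x == lift ord0 i) = (x \in rho i).
Proof.
have /andP[_ /forallP dis] := part_ofP rho.
rewrite ffunE; case: pickP => [j xj|no] /=.
  rewrite (inj_eq (@lift_inj _ ord0)); apply/eqP/idP => [<- //|xi].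
  apply: contraTeq xi => ji; have /forallP/(_ i)/implyP/(_ ji) := dis j.
  by move/disjointFr/(_ xj) => ->.
by rewrite no; apply/negP=> /eqP.
Qed.

Lemma onto_numfun : onto numfun.
Proof.
have /andP[/forallP n0 _] := part_ofP rho.
by apply/forallP=> i; have /set0Pn[x xi] := n0 i; apply/existsP; exists x;
  rewrite numfunE.
Qed.

Lemma rel_of_sym_elt s : rel_of (sym_elt rho s) = arrow numfun
  (relabel (row_action k) numfun s).
Proof.
apply/setP=> -[x y]; apply/rel_ofP/rcompP.
  case=> _ /imsetP[i _ ->] /= [xi yi]; exists (lift ord0 i).
    by rewrite mem_graph numfunE xi.
  rewrite mem_conv mem_graph ffunE andbT; move: yi; rewrite -numfunE => /eqP->.
  by rewrite row_action_lift permK.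
case=> c; rewrite mem_graph => /andP[xc n0].
have [i ei|/eqP] := unliftP ord0 c; last by rewrite (negPf n0).
rewrite mem_conv mem_graph ffunE n0 andbT => yc.
exists (rho i, rho (s i)); first exact: imset_f.
rewrite /= -!numfunE -ei xc; split=> //.
by rewrite -row_action_lift -ei -(eqP yc) actKV.
Qed.

Lemma PI_of_arrow s : PI_of (arrow numfun (relabel (row_action k) numfun s)) =
  sym_elt rho s.
Proof. by rewrite -rel_of_sym_elt PI_of_rel_of. Qed.

(** In terms of relations, the basis of a cell module consists of the arrows out
    of rho; by arrow_of these are parametrised by the numbered subquotients. *)
Lemma cell_basisE (z : PIstar n) :
  (z \in cell_basis rho) = (dom_per (rel_of z) == fibers ord0 numfun).
Proof.
have e : parts rho = PIdom (sym_elt rho 1).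
  rewrite /PIdom /raw_dom -imset_comp; exact: eq_imset.
rewrite inE e PIdom_dom_per rel_of_sym_elt dom_per_arrow // onto_relabel; exact:
  onto_numfun.
Qed.

End Numbering.

(** * Frames of a balanced tensor product *)

(** A frame of a module k[Z] (x)_B V: for z in the subset ok of the basis Z, the
    map i z is v |-> z (x) v and the map q z sends z' (x) v to the sum of the h
    v for z h = z'. These maps determine the module up to isomorphism by the
    equations below, which involve no quotient space any more and can be
    multiplied when modules are tensored. *)
Section Frames.

Variables (F : fieldType) (T : Type) (gT : finGroupType) (B : {group gT}).
Variables (Z : finType) (ok : pred Z) (ract : Z -> gT -> Z).
Variables (lact : T -> Z -> option Z) (d : nat) (V : gT -> 'M[F]_d).

Record frame N (r : T -> 'M[F]_N) (i : Z -> 'M[F]_(d, N))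
  (q : Z -> 'M[F]_(N, d))
  : Prop := Frame {
  frame_act : forall x z, ok z -> i z *m r x = oapp i 0 (lact x z);
  frame_move : forall z h, ok z -> h \in B -> i (ract z h) = V h *m i z;
  frame_dual : forall z z', ok z -> ok z' ->
    i z *m q z' = \sum_(h in B | ract z' h == z) V h;
  frame_span : \sum_(z | ok z) q z *m i z = #|B|%:R%:M }.

Record frame_action : Prop := FrameAction {
  ract1 : forall z, ract z 1%g = z;
  ractM : {in B &, forall g h z, ract z (g * h)%g = ract (ract z h) g};
  ract_ok : {in B, forall h z, ok (ract z h) = ok z};
  frame_repr1 : V 1%g = 1%:M;
  frame_reprM : {in B &, {morph V : g h / (g * h)%g >-> g *m h}};
  lact_ok : forall x z z', ok z -> lact x z = Some z' -> ok z';
  lact_ract : {in B, forall h x z, lact x (ract z h) = omap (ract^~ h)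
    (lact x z)} }.

Hypothesis aP : frame_action.
Hypothesis charF0 : [pchar F] =i pred0.

Lemma natr_neq0 m : (0 < m)%N -> m%:R != 0 :> F.
Proof. by move/pcharf0P: charF0 => ->; rewrite lt0n. Qed.

Lemma cardG_neq0 : #|B|%:R != 0 :> F.
Proof. exact/natr_neq0/cardG_gt0. Qed.

Lemma ractK z h : h \in B -> ract (ract z h) h^-1%g = z.
Proof. by move=> hB; rewrite -(ractM aP) ?groupV // mulVg (ract1 aP). Qed.

Lemma ractKV z h : h \in B -> ract (ract z h^-1%g) h = z.
Proof. by move=> hB; rewrite -(ractM aP) ?groupV // mulgV (ract1 aP). Qed.

(** Exactly one z' is sent to z by a given h. *)
Lemma orbit_sum m (w : gT -> Z -> 'M[F]_(d, m)) z : ok z ->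
  \sum_(z' | ok z') \sum_(h in B | ract z' h == z) w h z'
   = \sum_(h in B) w h (ract z h^-1%g).
Proof.
move=> okz; rewrite (exchange_big_dep (mem B)) /=; last by move=> ? ? _ /andP[].
apply: eq_bigr => h hB; rewrite (big_pred1 (ract z h^-1%g)) // => z'.
rewrite hB /=; apply/andP/eqP => [[_ /eqP<-]|->]; first by rewrite ractK.
by rewrite ractKV // eqxx (ract_ok aP) ?groupV.
Qed.

Section OneFrame.

Variables (N : nat) (r : T -> 'M[F]_N).
Variables (i : Z -> 'M[F]_(d, N)) (q : Z -> 'M[F]_(N, d)).
Hypothesis fr : frame r i q.

(** The images of the i z span the module. *)
Lemma frame_ext m (M M' : 'M[F]_(N, m)) :
  (forall z, ok z -> i z *m M = i z *m M') -> M = M'.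
Proof.
move=> h; apply: (scalerI cardG_neq0).
rewrite -!mul_scalar_mx -(frame_span fr) !mulmx_suml; apply: eq_bigr => z okz.
by rewrite -!mulmxA h.
Qed.

(** The homomorphism out of k[Z] (x)_B V given by the balanced map z (x) v |->
    Phi z v. The sum over all of Z counts each element of an orbit once for each
    group element, whence the denominator. *)
Definition fhom m (Phi : Z -> 'M[F]_(d, m)) : 'M[F]_(N, m) :=
  #|B|%:R^-1 *: \sum_(z | ok z) q z *m Phi z.

Lemma fhomE m (Phi : Z -> 'M[F]_(d, m)) :
    (forall z h, ok z -> h \in B -> Phi (ract z h) = V h *m Phi z) ->
  forall z, ok z -> i z *m fhom Phi = Phi z.
Proof.
move=> eqv z okz; rewrite /fhom -scalemxAr mulmx_sumr.
rewrite (eq_bigr (fun z' => \sum_(h | (h \in B) && (ract z' h == z)) V h *m Phi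
  z'));
  last by move=> z' okz'; rewrite mulmxA (frame_dual fr) // mulmx_suml.
rewrite orbit_sum //.
rewrite (eq_bigr (fun=> Phi z)) => [|h hB].
  by rewrite sumr_const -scaler_nat scalerA mulVf ?cardG_neq0 // scale1r.
by rewrite -eqv ?ractKV // (ract_ok aP) ?groupV.
Qed.

End OneFrame.

End Frames.

Section BalancedTensorFrame.

Variables (F : fieldType) (T : Type) (gT : finGroupType) (B : {group gT}).
Variables (Z : finType) (ok : pred Z) (ract : Z -> gT -> Z).
Variables (lact : T -> Z -> option Z) (d : nat) (V : gT -> 'M[F]_d).
Hypothesis aP : frame_action B ok ract lact V.

Variables (X : finType) (A : {set X}) (f : T -> X -> X) (fr : gT -> X -> X).
Variable u : Z -> X.
Hypothesis u_inj : {in ok &, injective u}.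
Hypothesis u_ok : forall z, ok z -> u z \in A.
Hypothesis u_onto : forall x, x \in A -> exists2 z, ok z & u z = x.
Hypothesis u_ract : forall z h, ok z -> h \in B -> fr h (u z) = u (ract z h).
Hypothesis u_lact : forall x z, ok z ->
  if lact x z is Some z' then f x (u z) = u z' else f x (u z) \notin A.

Local Notation L := (fun x => basis_mx F A (f x)).
Local Notation R := (fun h => basis_mx F A (fr h)).

(** The map v |-> x (x) v, which is 0 when x does not belong to the basis A;
    accordingly basis_mx, which sends basis elements that leave A to 0, needs no
    case distinction below. *)
Definition basis_row (x : X) : 'M[F]_(d, #|A| * d) :=
  \matrix_(i, j) ((enum_val (mxtens_unindex j).1 == x) &&
    ((mxtens_unindex j).2 == i))%:R.
Local Notation e := basis_row.

Lemma basis_row_notin x : x \notin A -> e x = 0.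
Proof.
move=> xA; apply/matrixP=> i j; rewrite !mxE.
by case: eqP => //= ex; rewrite -ex enum_valP in xA.
Qed.

Lemma basis_row_mul x (xA : x \in A) m (M : 'M[F]_(#|A| * d, m)) i j :
  (e x *m M) i j = M (mxtens_index (enum_rank_in xA x, i)) j.
Proof.
rewrite mxE (bigD1 (mxtens_index (enum_rank_in xA x, i))) //= big1 => [|l nel].
  by rewrite mxE mxtens_indexK /= enum_rankK_in // !eqxx mul1r addr0.
rewrite mxE; case: andP => [[/eqP e1 /eqP e2]|_]; last by rewrite mul0r.
case/eqP: nel; rewrite -(mxtens_unindexK l) [mxtens_unindex l]surjective_pairing
  e2.
by congr (mxtens_index (_, _)); apply: enum_val_inj; rewrite enum_rankK_in.
Qed.

Lemma basis_row_left x g : x \in A -> e x *m (basis_mx F A g *t 1%:M) = e (g x).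
Proof.
move=> xA; apply/matrixP=> i j; rewrite basis_row_mul.
case: (mxtens_indexP j) => j1 j2; rewrite tensmxE !mxE mxtens_indexK /=
  enum_rankK_in //.
by rewrite [g x == _]eq_sym [i == j2]eq_sym -natrM mulnb.
Qed.

Lemma basis_row_right x (W : 'M[F]_d) : x \in A ->
  e x *m (1%:M *t W) = W *m e x.
Proof.
move=> xA; apply/matrixP=> i j; rewrite basis_row_mul.
case: (mxtens_indexP j) => j1 j2; rewrite tensmxE !mxE (bigD1 j2) //= big1 =>
  [|l nel].
  rewrite mxE mxtens_indexK /= eqxx andbT addr0 mulrC; congr (_ * _%:R);
    congr nat_of_bool.
  by rewrite -(inj_eq enum_val_inj) enum_rankK_in // eq_sym.
by rewrite mxE mxtens_indexK /= [j2 == l]eq_sym (negPf nel) andbF mulr0.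
Qed.

Lemma basis_row_ext m (M M' : 'M[F]_(#|A| * d, m)) :
  (forall x, x \in A -> e x *m M = e x *m M') -> M = M'.
Proof.
move=> h; apply/matrixP=> i j; case: (mxtens_indexP i) => a b.
have aA := enum_valP a.
have := congr1 (fun N : 'M_(d, m) => N b j) (h _ aA).
by rewrite /= !basis_row_mul enum_valK_in.
Qed.

Definition from_rows m (phi : X -> 'M[F]_(d, m)) : 'M[F]_(#|A| * d, m) :=
  \matrix_(l, j) phi (enum_val (mxtens_unindex l).1) (mxtens_unindex l).2 j.

Lemma basis_row_from m (phi : X -> 'M[F]_(d, m)) x : x \in A ->
  e x *m from_rows phi = phi x.
Proof.
by move=> xA; apply/matrixP=> i j; rewrite basis_row_mul mxE mxtens_indexK /=
  enum_rankK_in.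
Qed.

Let K := balanced_relations B R V.
Let pr : 'M[F]_(#|A| * d, \rank (cokermx K)) := in_factmod K 1%:M.
Let sec : 'M[F]_(\rank (cokermx K), #|A| * d) := val_factmod 1%:M.

Let pr_sec : sec *m pr = 1%:M.
Proof. by rewrite /sec /pr -in_factmodE val_factmodK. Qed.

(** A linear map out of k[A] (x) V factors through the tensor product over B
    when it is balanced. *)
Lemma balanced_relations_mul m (phi : 'M[F]_(#|A| * d, m)) :
    (forall x h, x \in A -> h \in B -> e (fr h x) *m phi = V h *m e x *m phi) ->
  K *m phi = 0.
Proof.
move=> h; suff /submxP[w ->] : (K <= kermx phi)%MS by rewrite -mulmxA mulmx_ker
  mulmx0.
apply/sumsmx_subP=> g gB; rewrite genmxE; apply/sub_kermxP.
apply: basis_row_ext => x xA; rewrite mulmx0 mulmxA mulmxBr.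
by rewrite basis_row_left // basis_row_right // mulmxBl h // subrr.
Qed.

Let prK : K *m pr = 0.
Proof. by rewrite /pr -in_factmodE; apply/eqP; rewrite in_factmod_eq0. Qed.

Let pr_secK m (phi : 'M[F]_(#|A| * d, m)) : K *m phi = 0 ->
  pr *m (sec *m phi) = phi.
Proof.
move=> Kphi; have /submxP[w ew] : (1%:M - pr *m sec <= K)%MS.
  by rewrite -in_factmod_eq0 linearB /= in_factmodE -/pr
    [in_factmod K (pr *m sec)]in_factmodE -/pr mul1mx
    -mulmxA pr_sec mulmx1 subrr.
apply/eqP; rewrite mulmxA -subr_eq0 -[X in _ - X]mul1mx -mulmxBl -oppr_eq0
  -mulNmx opprB.
by rewrite ew -mulmxA Kphi mulmx0.
Qed.

Let bi z := e (u z) *m pr.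

Let prrel x h : x \in A -> h \in B -> e (fr h x) *m pr = V h *m e x *m pr.
Proof.
move=> xA hB.
have : e x *m ((R h *t 1%:M - 1%:M *t V h) *m pr) = 0.
  have /submxP[w ->] : (R h *t 1%:M - 1%:M *t V h <= K)%MS.
    by rewrite /K /balanced_relations (sumsmx_sup h) // genmxE.
  by rewrite -mulmxA prK !mulmx0.
rewrite mulmxA mulmxBr basis_row_left // basis_row_right // mulmxBl => /eqP.
by rewrite subr_eq0 => /eqP.
Qed.

Let bq_rows z' := from_rows (fun x => \sum_(h in B | u (ract z' h) == x) V h).
Let bq z' := sec *m bq_rows z'.

Let bq_rowsE z z' : ok z -> ok z' -> e (u z) *m bq_rows z' =
  \sum_(h in B | ract z' h == z) V h.
Proof.
move=> okz okz'; rewrite basis_row_from ?u_ok //; apply: eq_bigl => h.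
case: (boolP (h \in B)) => //= hB.
by rewrite (inj_in_eq u_inj) // ?inE // unfold_in (ract_ok aP).
Qed.

Let bq_rowsK z' : ok z' -> K *m bq_rows z' = 0.
Proof.
move=> okz'; apply: balanced_relations_mul => x h /u_onto[z okz <-] hB.
rewrite u_ract // -mulmxA !bq_rowsE ?(ract_ok aP) // mulmx_sumr.
rewrite (reindex_inj (mulgI h)) /=; apply: eq_big => [g|g /andP[gB _]].
  rewrite groupMl //.
  case: (boolP (g \in B)) => //= gB; rewrite (ractM aP) //.
  by apply/eqP/eqP => [/(congr1 (ract^~ h^-1%g))|-> //]; rewrite !(ractK aP).
rewrite (frame_reprM aP) //.
by rewrite groupMl // in gB.
Qed.

Let lact_pr x : K *m ((L x *t 1%:M) *m pr) = 0.
Proof.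
apply: balanced_relations_mul => y h /u_onto[z okz <-] hB.
rewrite u_ract // [LHS]mulmxA [RHS]mulmxA -[V h *m _ *m _]mulmxA !basis_row_left
  ?u_ok ?(ract_ok aP) //.
have := u_lact x okz; have := @u_lact x (ract z h);
  rewrite (ract_ok aP) // => /(_ okz).
rewrite (lact_ract aP) //; case E: (lact x z) => [z'|] /= h1 h2.
  have okz' := lact_ok aP okz E.
  by rewrite h1 h2 -u_ract // prrel ?u_ok.
by rewrite !basis_row_notin // mulmx0 mul0mx.
Qed.

(** Balanced maps out of k[A] (x) V are maps out of the quotient: this provides
    both the maps q z and the action. Here u identifies the subset ok of Z with
    the basis A. *)
Lemma balanced_tensor_frame :
  exists i q, frame B ok ract lact V (balanced_tensor L B R V) i q.
Proof.
exists bi, bq; split.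
- move=> x z okz; have -> : balanced_tensor L B R V x = sec *m
  ((L x *t 1%:M) *m pr).
    by rewrite /balanced_tensor in_factmodE -mulmxA.
  rewrite /bi -[LHS]mulmxA pr_secK ?lact_pr // mulmxA basis_row_left ?u_ok //.
  have := u_lact x okz; case E: (lact x z) => [z'|] /= => [->//|h].
  by rewrite basis_row_notin // mul0mx.
- by move=> z h okz hB; rewrite /bi -u_ract // prrel ?u_ok // -[LHS]mulmxA.
- by move=> z z' okz okz'; rewrite /bi /bq -mulmxA pr_secK ?bq_rowsK ?bq_rowsE.
have -> : \sum_(z | ok z) bq z *m bi z
    = sec *m (\sum_(z | ok z) bq_rows z *m e (u z)) *m pr.
  by rewrite mulmx_sumr mulmx_suml; apply: eq_bigr => z _;
    rewrite /bq /bi !mulmxA.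
suff E : (\sum_(z | ok z) bq_rows z *m e (u z)) *m pr = #|B|%:R *: pr.
  by rewrite -mulmxA E -scalemxAr pr_sec scalemx1.
apply: basis_row_ext => _ /u_onto[z okz <-].
rewrite mulmxA mulmx_sumr mulmx_suml.
rewrite (eq_bigr (fun z' => \sum_(h | (h \in B) && (ract z' h == z)) V h *m bi
  z'));
  last by move=> z' okz'; rewrite mulmxA bq_rowsE // -mulmxA mulmx_suml.
rewrite (orbit_sum aP) //.
rewrite (eq_bigr (fun=> bi z)) => [|h hB].
  by rewrite sumr_const -scalemxAr scaler_nat.
have okz' : ok (ract z h^-1%g) by rewrite (ract_ok aP) ?groupV.
by rewrite /bi mulmxA -prrel ?u_ok // u_ract // (ractKV aP).
Qed.

End BalancedTensorFrame.

(** * Cell modules and their tensor products *)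

(** The action on functions that all the modules below share: it is defined when
    the element loses no part of the subquotient. *)
Definition PI_act (n : nat) (P : finType) (pt : P) (x : PIstar n)
  (f : {ffun 'I_n -> P})
  : option {ffun 'I_n -> P} :=
  if compat pt (rel_of x) f then Some (push pt (rel_of x) f) else None.

Section CellFrame.

Variables (F : fieldType) (n k : nat) (rho : numbered_subquotient n k).
Variables (d : nat) (V : mx_representation F [set: 'S_k]%G d).

Local Notation ract := (relabel (row_action k)).
Local Notation theta := (numfun rho).

Lemma relabel_frame_action :
  frame_action [set: 'S_k]%G (@onto n k) ract (PI_act ord0) V.
Proof.
split.
- by move=> z; apply: relabel1.
- by move=> g h _ _ z; rewrite relabelM.
- by move=> h _ z; rewrite onto_relabel.
- exact: repr_mx1.
- by move=> g h; apply: repr_mxM.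
- move=> x z z' oz; rewrite /PI_act; case: ifP => // c [<-]; exact: onto_push.
move=> h _ x z; rewrite /PI_act compat_relabel //; last exact: row_action0.
by case: ifP => //= _; rewrite push_relabel //; exact: row_action0.
Qed.

(** The basis element of the cell module that corresponds to a numbered
    subquotient: it sends the part of rho with number c to the part of f with
    number c. *)
Definition cell_elt (f : {ffun 'I_n -> 'I_k.+1}) : PIstar n :=
  PI_of (arrow theta f).

Let otheta : onto theta := onto_numfun rho.

Lemma rel_of_cell_elt f : onto f -> rel_of (cell_elt f) = arrow theta f.
Proof. by move=> of_; rewrite rel_of_PI_of ?difun_arrow. Qed.

Lemma cell_elt_inj : {in @onto n k &, injective cell_elt}.
Proof.
move=> f g of_ og e; rewrite -(push_arrow otheta of_) -(push_arrow otheta og).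
by rewrite -(rel_of_cell_elt of_) -(rel_of_cell_elt og) e.
Qed.

Lemma cell_elt_in f : onto f -> cell_elt f \in cell_basis rho.
Proof. by move=> of_; rewrite cell_basisE (rel_of_cell_elt of_) dom_per_arrow.
  Qed.

Lemma cell_elt_onto x : x \in cell_basis rho ->
  exists2 f, onto f & cell_elt f = x.
Proof.
rewrite cell_basisE => /eqP e; have dx := difun_rel_of x.
exists (push ord0 (rel_of x) theta); first by apply: onto_push => //; apply:
  compat_dom_per.
by rewrite /cell_elt -arrow_of ?PI_of_rel_of.
Qed.

Lemma cell_elt_right f s : onto f ->
  PImul (cell_elt f) (sym_elt rho s) = cell_elt (ract f s).
Proof.
move=> of_; apply: rel_of_inj.
have om : onto (ract theta s) by rewrite onto_relabel.
have omf : onto (ract f s) by rewrite onto_relabel.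
have e1 := rel_of_sym_elt rho s; have e2 := rel_of_cell_elt of_.
rewrite (rel_of_cell_elt omf) rel_of_PImul e1 e2;
  first by rewrite -(arrow_relabel theta f s) arrow_comp.
rewrite arrow_conv !dom_per_arrow // fibers_relabel; last exact: row_action0.
by rewrite (per_idem (per_fibers _ _)).
Qed.

(** By rel_of_PImul and PIdom_PImul the product stays in the basis exactly when
    the action on functions is defined, and then agrees with it. *)
Lemma cell_elt_left x f : onto f ->
  if PI_act ord0 x f is Some g then PImul x (cell_elt f) = cell_elt g
  else PImul x (cell_elt f) \notin cell_basis rho.
Proof.
move=> of_.
have cE : dom_per (rel_of (cell_elt f))^v = fibers ord0 f.
  by rewrite (rel_of_cell_elt of_) arrow_conv dom_per_arrow.
rewrite /PI_act; case: ifPn => [c|].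
  apply: rel_of_inj; rewrite rel_of_PImul ?cE; last exact/eqP.
  have og := onto_push c of_; have eg := arrow_push theta c.
  move: (push ord0 (rel_of x) f) og eg => g og eg.
  by rewrite (rel_of_cell_elt of_) (rel_of_cell_elt og) eg.
apply: contra => h; apply/eqP; rewrite -cE; apply: PIdom_PImul.
apply/eqP; rewrite PIdom_dom_per; move: h; rewrite cell_basisE => /eqP->.
by rewrite (rel_of_cell_elt of_) dom_per_arrow.
Qed.

Lemma cell_frame : exists i q,
  frame [set: 'S_k]%G (@onto n k) ract (PI_act ord0) V
    (balanced_tensor (cell_left rho F) [set: 'S_k] (cell_right rho F) V) i q.
Proof.
apply: (balanced_tensor_frame relabel_frame_action cell_elt_inj cell_elt_in
  cell_elt_onto).
- by move=> z h oz _; apply: cell_elt_right.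
- by move=> x z oz; apply: cell_elt_left.
Qed.

End CellFrame.

Section TensorLinear.

Variable F : fieldType.

Lemma tensmx_suml (I : Type) (r : seq I) (P : pred I) m n p q
    (A : I -> 'M[F]_(m, n)) (B : 'M[F]_(p, q)) :
  (\sum_(i <- r | P i) A i) *t B = \sum_(i <- r | P i) A i *t B.
Proof.
apply/matrixP=> i j; case: (mxtens_indexP i) => i1 i2; case:
  (mxtens_indexP j) => j1 j2.
rewrite tensmxE !summxE mulr_suml; apply: eq_bigr => l _; by rewrite tensmxE.
Qed.

Lemma tensmx_sumr (I : Type) (r : seq I) (P : pred I) m n p q
    (B : I -> 'M[F]_(m, n)) (A : 'M[F]_(p, q)) :
  A *t (\sum_(i <- r | P i) B i) = \sum_(i <- r | P i) A *t B i.
Proof.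
apply/matrixP=> i j; case: (mxtens_indexP i) => i1 i2; case:
  (mxtens_indexP j) => j1 j2.
rewrite tensmxE !summxE mulr_sumr; apply: eq_bigr => l _; by rewrite tensmxE.
Qed.

Lemma tensmx_scalar m n (a b : F) : (a%:M : 'M_m) *t (b%:M : 'M_n) = (a * b)%:M.
Proof.
apply/matrixP=> i j; case: (mxtens_indexP i) => i1 i2; case:
  (mxtens_indexP j) => j1 j2.
rewrite tensmxE !mxE (can_eq (@mxtens_indexK _ _)) xpair_eqE.
by case: (i1 == j1); case: (i2 == j2); rewrite ?mulr1n ?mulr0n ?mul0r ?mulr0.
Qed.

End TensorLinear.

Section TensorFrame.

Variables (F : fieldType) (n k l : nat).
Variables (d1 : nat) (V1 : mx_representation F [set: 'S_k]%G d1).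
Variables (d2 : nat) (V2 : mx_representation F [set: 'S_l]%G d2).
Variables (N1 : nat) (r1 : PIstar n -> 'M[F]_N1)
  (i1 : {ffun 'I_n -> 'I_k.+1} -> 'M[F]_(d1, N1)).
Variable q1 : {ffun 'I_n -> 'I_k.+1} -> 'M[F]_(N1, d1).
Variables (N2 : nat) (r2 : PIstar n -> 'M[F]_N2)
  (i2 : {ffun 'I_n -> 'I_l.+1} -> 'M[F]_(d2, N2)).
Variable q2 : {ffun 'I_n -> 'I_l.+1} -> 'M[F]_(N2, d2).
Hypothesis fr1 : frame [set: 'S_k]%G (@onto n k) (relabel (row_action k))
  (PI_act ord0) V1 r1 i1 q1.
Hypothesis fr2 : frame [set: 'S_l]%G (@onto n l) (relabel (row_action l))
  (PI_act ord0) V2 r2 i2 q2.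

Local Notation P := ('I_k.+1 * 'I_l.+1)%type.
Local Notation gT := ('S_k * 'S_l)%type.

Definition row_label (f : {ffun 'I_n -> P}) : {ffun 'I_n -> 'I_k.+1} :=
  [ffun x => (f x).1].
Definition col_label (f : {ffun 'I_n -> P}) : {ffun 'I_n -> 'I_l.+1} :=
  [ffun x => (f x).2].
(** A pair of numbered subquotients, with k and l parts, is a function to pairs
    of numbers; its fibers are the parts of the coarsest subquotient that
    refines both. *)
Definition onto2 f := onto (row_label f) && onto (col_label f).

Lemma entry_act1 (c : P) : entry_act c (1%g : gT) = c.
Proof. by rewrite /entry_act /= !lift_perm1 !perm1; case: c. Qed.

Lemma entry_actM (c : P) : act_morph (@entry_act k l) c.
Proof. by move=> g h; rewrite /entry_act /= -!(lift_permM _ ord0) !permM. Qed.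

Definition entry_action : {action gT &-> P} :=
  TotalAction entry_act1 entry_actM.

Lemma entry_action0 g : entry_action (ord0, ord0) g = (ord0, ord0).
Proof. by rewrite /= /entry_act /= !lift_perm_id. Qed.

Local Notation pt := ((ord0, ord0) : P).
Local Notation lact2 := (@PI_act n P pt).

Lemma row_label_relabel f g : row_label (relabel entry_action f g) = relabel
  (row_action k) (row_label f) g.1.
Proof. by apply/ffunP=> x; rewrite !ffunE. Qed.

Lemma col_label_relabel f g : col_label (relabel entry_action f g) = relabel
  (row_action l) (col_label f) g.2.
Proof. by apply/ffunP=> x; rewrite !ffunE. Qed.

Lemma compatP (P' : finType) (p : P') (Q : {set 'I_n * 'I_n})
  (f : {ffun 'I_n -> P'}) :
  reflect ((forall x, f x != p -> (x, x) \in dom_per Q) /\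
           (forall x y, (x, y) \in dom_per Q -> f x = f y)) (compat p Q f).
Proof.
rewrite compatE; apply: (iffP eqP) => [e|[h1 h2]].
  have key x y : (x, y) \in dom_per Q -> f y != p -> f x = f y.
    move=> xy n0; have : (x, f y) \in graph p f.
      by rewrite -e; apply/rcompP; exists y; rewrite // mem_graph eqxx.
    by rewrite mem_graph => /andP[/eqP].
  split=> [x n0|x y xy].
    have : (x, f x) \in graph p f by rewrite mem_graph eqxx.
    rewrite -e dom_perE => /rcompP[y /rcompP[z xz _] _].
    by apply/rcompP; exists z; rewrite ?mem_conv.
  have [fy|n0] := eqVneq (f y) p; last exact: key.
  have [->//|n0] := eqVneq (f x) p.
  by apply/esym/key => //; rewrite -conv_dom_per mem_conv.
apply/setP=> -[x c]; apply/rcompP/idP => [[y xy]|].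
  by rewrite !mem_graph (h2 _ _ xy).
rewrite mem_graph => /andP[/eqP<- n0]; exists x; first exact: h1.
by rewrite mem_graph eqxx.
Qed.

(** An element acts on a tensor product of basis elements without losing a part
    of either factor exactly when it loses no part of their common refinement.
    This is why the set of values needs a single base point, the pair of zeros.
      *)
Lemma compat_pair Q f : compat pt Q f = compat ord0 Q (row_label f) && compat
  ord0 Q (col_label f).
Proof.
apply/compatP/andP => [[h1 h2]|[/compatP[h1 h2] /compatP[h3 h4]]].
  split; apply/compatP; split=> [x|x y xy]; rewrite !ffunE ?(h2 _ _ xy) // =>
    n0;
    by apply: h1; apply: contraNneq n0 => ->.
split=> [x|x y xy]; last first.
  have := h2 _ _ xy; have := h4 _ _ xy; rewrite !ffunE.
  by case: (f x) (f y) => a b [a' b'] /= -> ->.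
move: (h1 x) (h3 x); rewrite !ffunE; case: (f x) => a b /= ha hb.
by rewrite xpair_eqE negb_and => /orP[/ha|/hb].
Qed.

Lemma push_row_label Q f : row_label (push pt Q f) = push ord0 Q (row_label f).
Proof. by apply/ffunP=> y; rewrite !ffunE; case: pickP => [x _|_] //=;
  rewrite ffunE. Qed.

Lemma push_col_label Q f : col_label (push pt Q f) = push ord0 Q (col_label f).
Proof. by apply/ffunP=> y; rewrite !ffunE; case: pickP => [x _|_] //=;
  rewrite ffunE. Qed.

Lemma label_inj f g : row_label f = row_label g -> col_label f = col_label g ->
  f = g.
Proof.
move=> /ffunP e1 /ffunP e2; apply/ffunP=> x; have := e1 x; have := e2 x.
by rewrite !ffunE; case: (f x) (g x) => a b [c d] /= -> ->.
Qed.

Definition outer_repr (g : gT) : 'M[F]_(d1 * d2) := V1 g.1 *t V2 g.2.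

Lemma pair_frame_action :
  frame_action [set: gT]%G onto2 (relabel entry_action) lact2 outer_repr.
Proof.
split.
- by move=> z; apply: relabel1.
- by move=> g h _ _ z; rewrite relabelM.
- by move=> h _ z; rewrite /onto2 row_label_relabel col_label_relabel
  !onto_relabel.
- by rewrite /outer_repr !repr_mx1 tensmx_scalar mulr1.
- by move=> g h _ _; rewrite /outer_repr !repr_mxM ?inE // tensmx_mul.
- move=> x z z' /andP[o1 o2]; rewrite /PI_act; case: ifP => // c [<-].
  move: c; rewrite compat_pair => /andP[c1 c2].
  by rewrite /onto2 push_row_label push_col_label !onto_push.
move=> h _ x z; rewrite /PI_act compat_relabel //; last exact: entry_action0.
by case: ifP => //= _; rewrite push_relabel //; exact: entry_action0.
Qed.

Definition pair_i (f : {ffun 'I_n -> P}) : 'M[F]_(d1 * d2, N1 * N2) :=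
  i1 (row_label f) *t i2 (col_label f).
Definition pair_q (f : {ffun 'I_n -> P}) : 'M[F]_(N1 * N2, d1 * d2) :=
  q1 (row_label f) *t q2 (col_label f).

(** The equations of a frame are multiplicative, by the mixed product property
    of the tensor product of matrices. *)
Lemma tensor_frame :
  frame [set: gT]%G onto2 (relabel entry_action) lact2 outer_repr
    (tensor_module r1 r2) pair_i pair_q.
Proof.
split.
- move=> x z /andP[o1 o2]; rewrite /pair_i /tensor_module tensmx_mul.
  rewrite (frame_act fr1) // (frame_act fr2) // /PI_act compat_pair.
  case: ifP => c1 /=; last by rewrite tens0mx.
  case: ifP => c2 /=; last by rewrite tensmx0.
  by rewrite push_row_label push_col_label.
- move=> z h /andP[o1 o2] _; rewrite /pair_i row_label_relabel
  col_label_relabel.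
  by rewrite (frame_move fr1) ?inE // (frame_move fr2) ?inE // tensmx_mul.
- move=> z z' /andP[o1 o2] /andP[o1' o2']; rewrite /pair_i /pair_q tensmx_mul.
  rewrite (frame_dual fr1) // (frame_dual fr2) // tensmx_suml.
  rewrite (eq_bigr (fun h =>
    \sum_(h' in [set: 'S_l]%G | relabel (row_action l) (col_label z') h' ==
    col_label z)
     V1 h *t V2 h')) => [|h _]; last by rewrite tensmx_sumr.
  rewrite pair_big; apply: eq_big => [[g h]|[g h] _] //=; rewrite !inE /=.
  apply/andP/eqP => [[/eqP e1 /eqP e2]|<-].
    by apply: label_inj; rewrite ?row_label_relabel ?col_label_relabel.
  by rewrite row_label_relabel col_label_relabel.
pose join (p : {ffun 'I_n -> 'I_k.+1} * {ffun 'I_n -> 'I_l.+1}) :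
  {ffun 'I_n -> P} :=
  [ffun x => (p.1 x, p.2 x)].
have j1 p : row_label (join p) = p.1 by apply/ffunP=> x; rewrite !ffunE.
have j2 p : col_label (join p) = p.2 by apply/ffunP=> x; rewrite !ffunE.
rewrite (reindex join) /=; last first.
  exists (fun f => (row_label f, col_label f)) => [[f g]|f] _ /=;
    first by rewrite j1 j2.
  by apply: label_inj; rewrite ?j1 ?j2.
have -> : (#|[set: gT]|%:R%:M : 'M[F]_(N1 * N2)) = #|[set: 'S_k]%G|%:R%:M *t
  #|[set: 'S_l]%G|%:R%:M.
  by rewrite tensmx_scalar -natrM !cardsT card_prod.
rewrite -(frame_span fr1) -(frame_span fr2) tensmx_suml.
rewrite [RHS](eq_bigr (fun f => \sum_(g | onto g) (q1 f *m i1 f) *t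
  (q2 g *m i2 g)));
  last by move=> f _; rewrite tensmx_sumr.
rewrite pair_big; apply: eq_big => [[f g]|[f g] _] /=;
  first by rewrite /onto2 j1 j2.
by rewrite /pair_q /pair_i j1 j2 tensmx_mul.
Qed.

End TensorFrame.

(** * Modules graded by the subquotients *)

Section Graded.

Variables (F : fieldType) (n : nat).
Local Notation rel := {set 'I_n * 'I_n}.

(** The operator of an arrow Q of the groupoid of bijections between
    subquotients: the element Q of the semigroup acts after the projection to
    the summand of its domain. *)
Definition arrow_op d (r : PIstar n -> 'M[F]_d) (p : rel -> 'M[F]_d) (Q : rel) :
  'M[F]_d :=
  locked (p (dom_per Q) *m r (PI_of Q)).

Lemma arrow_opE d (r : PIstar n -> 'M[F]_d) p Q :
  arrow_op r p Q = p (dom_per Q) *m r (PI_of Q).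
Proof. by rewrite /arrow_op -lock. Qed.

(** A module over the semigroup that decomposes as a representation of the
    groupoid: p s is the projection to the summand of the subquotient s, and an
    element x acts on this summand through its restriction to s, or by 0 if x
    loses some part of s. *)
Record graded d (r : PIstar n -> 'M[F]_d) (p : rel -> 'M[F]_d) : Prop :=
  Graded {
  gr_orth : forall s t, p s *m p t = if s == t then p s else 0;
  gr_sum : \sum_s p s = 1%:M;
  gr_per : forall s, ~~ per s -> p s = 0;
  gr_act : forall s x, per s -> p s *m r x =
    if s ** dom_per (rel_of x) == s then p s *m r (PI_of (s ** rel_of x)) else
      0;
  gr_cod : forall Q, difun Q -> arrow_op r p Q *m p (dom_per Q^v) = arrow_op r p
    Q;
  gr_comp : forall Q R, difun Q -> difun R -> dom_per Q^v = dom_per R ->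
    arrow_op r p Q *m r (PI_of R) = arrow_op r p (Q ** R);
  gr_id : forall s, per s -> p s *m r (PI_of s) = p s }.

(** The idempotent of s acts as the sum of the projections p t over all t below
    s. Moebius inversion expresses p s by idempotents of the semigroup, with
    coefficients that do not depend on the module. Hence submodules and
    homomorphisms respect the grading. *)
Lemma gr_mobius s : exists mu : rel -> F, forall d (r : PIstar n -> 'M[F]_d) p,
  graded r p -> p s = \sum_t mu t *: r (PI_of t).
Proof.
have [k] := ubnP #|[set t : rel | per t && (t ** s == t)]|; elim:
  k s => // k IH s lek.
have [ps|nps] := boolP (per s); last first.
  exists (fun=> 0) => d r p gr; rewrite (gr_per gr nps) big1 // => t _.
  by rewrite scale0r.
pose low (t : rel) := [&& per t, t ** s == t & t != s].
have ex t : exists mu : rel -> F, low t -> forall d (r : PIstar n -> 'M[F]_d) p,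
    graded r p -> p t = \sum_u mu u *: r (PI_of u).
  case: (boolP (low t)) => [/and3P[pt /eqP ts nts]|_]; last by exists (fun=> 0).
  have [|mu hmu] := IH t; last by exists mu => _.
  rewrite ltnS in lek; apply: leq_trans lek; apply/proper_card/properP; split.
    apply/subsetP=> u; rewrite !inE => /andP[-> /eqP ut] /=.
    by rewrite -{1}ut -rcompA ts ut.
  exists s; rewrite !inE ps ?per_idem //=.
  by apply: contra nts => /eqP st; apply/eqP/per_anti.
have [M hM] := choice ex.
exists (fun u => (u == s)%:R - \sum_(t | low t) M t u) => d r p gr.
have es : r (PI_of s) = p s + \sum_(t | low t) p t.
  rewrite -[LHS]mul1mx -(gr_sum gr) mulmx_suml (bigD1 s) //= gr_id //;
    congr (_ + _).
  rewrite big_mkcond [RHS]big_mkcond; apply: eq_bigr => t _; rewrite /low.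
  have [pt|npt] := boolP (per t) => /=; last by rewrite (gr_per gr npt) mul0mx
    if_same.
  rewrite (gr_act gr) // rel_of_PI_of ?difun_per // dom_per_per //.
  case: (t == s) => /=; first by rewrite andbF.
  rewrite andbT; case: eqP => [ts|_] //; by rewrite ts (gr_id gr).
rewrite (eq_bigr (fun u => (u == s)%:R *: r (PI_of u)
    - \sum_(t | low t) M t u *: r (PI_of u))) => [|u _]; last first.
  by rewrite scalerBl scaler_suml.
rewrite sumrB (bigD1 s) //= eqxx scale1r big1 => [|u /negPf->];
  last by rewrite scale0r.
rewrite addr0 exchange_big /= es -[LHS]addr0 -addrA; congr (_ + _).
apply/esym/eqP; rewrite subr_eq0; apply/eqP/eq_bigr => t lt.
exact: (hM _ lt).
Qed.

Section OneGraded.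

Variables (d : nat) (r : PIstar n -> 'M[F]_d) (p : rel -> 'M[F]_d).
Hypothesis gr : graded r p.
Local Notation a := (arrow_op r p).

Lemma gr_stable U s : is_submodule r U -> stablemx U (p s).
Proof.
move=> sU; have [mu hmu] := gr_mobius s; rewrite (hmu _ _ _ gr).
rewrite mulmx_sumr summx_sub // => t _; rewrite -scalemxAr scalemx_sub //.
Qed.

Lemma gr_hom d' (r' : PIstar n -> 'M[F]_d') p' (f : 'M[F]_(d', d)) s :
  graded r' p' -> (forall x, r' x *m f = f *m r x) -> p' s *m f = f *m p s.
Proof.
move=> gr' fr; have [mu hmu] := gr_mobius s; rewrite (hmu _ _ _ gr)
  (hmu _ _ _ gr').
rewrite mulmx_suml mulmx_sumr; apply: eq_bigr => t _.
by rewrite -scalemxAl -scalemxAr fr.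
Qed.

Lemma op_stable U Q : is_submodule r U -> stablemx U (a Q).
Proof. by move=> sU; rewrite arrow_opE; apply: stablemxM (sU _); apply:
  gr_stable. Qed.

Lemma op_per s : per s -> a s = p s.
Proof. by move=> ps; rewrite arrow_opE dom_per_per // (gr_id gr). Qed.

Lemma op_cod Q s : difun Q -> a Q *m p s = if dom_per Q^v == s then a Q else 0.
Proof.
move=> dQ; rewrite -(gr_cod gr dQ) -mulmxA (gr_orth gr).
by case: eqP => _; rewrite ?mulmx0.
Qed.

Lemma op_comp Q R : difun Q -> difun R ->
  a Q *m a R = if dom_per Q^v == dom_per R then a (Q ** R) else 0.
Proof.
move=> dQ dR; rewrite [a R]arrow_opE mulmxA op_cod //.
by case: eqP => [e|_]; rewrite ?mul0mx ?(gr_comp gr).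
Qed.

Lemma op_act Q (x : PIstar n) : difun Q -> a Q *m r x =
  if dom_per Q^v ** dom_per (rel_of x) == dom_per Q^v then a (Q ** rel_of x)
    else 0.
Proof.
move=> dQ; have pQ := per_dom_per (difun_conv dQ).
rewrite -(gr_cod gr dQ) -mulmxA (gr_act gr) //.
case: eqP => [e|_]; last by rewrite mulmx0.
have le : dom_per (dom_per Q^v)^v ** dom_per (rel_of x) = dom_per
  (dom_per Q^v)^v.
  by rewrite (per_conv pQ) dom_per_per.
have dR := difun_rcomp_le (difun_per pQ) le.
have eR : dom_per (dom_per Q^v ** rel_of x) = dom_per Q^v.
  by rewrite (dom_per_rcomp_le (difun_per pQ) le) (dom_per_per pQ).
rewrite mulmxA (gr_cod gr dQ) (gr_comp gr) ?eR //.
by rewrite rcompA rcomp_cod_per.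
Qed.

(** Conversely each element acts as the sum of the arrows that it restricts to.
    Submodules and homomorphisms can therefore be tested on arrows. *)
Lemma act_op (x : PIstar n) : r x =
  \sum_(s | per s && (s ** dom_per (rel_of x) == s)) a (s ** rel_of x).
Proof.
rewrite -[LHS]mul1mx -(gr_sum gr) mulmx_suml [RHS]big_mkcond; apply:
  eq_bigr => s _.
have [ps|nps] := boolP (per s) => /=; last by rewrite (gr_per gr nps) mul0mx.
rewrite (gr_act gr) //; case: eqP => // e.
have le : dom_per s^v ** dom_per (rel_of x) = dom_per s^v by rewrite
  (per_conv ps) dom_per_per.
by rewrite arrow_opE dom_per_rcomp_le ?difun_per ?difun_rel_of // dom_per_per.
Qed.

Lemma difun_restr s (x : PIstar n) : per s -> s ** dom_per (rel_of x) = s ->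
  difun (s ** rel_of x).
Proof.
move=> ps e; apply: difun_rcomp_le; rewrite ?difun_per ?difun_rel_of //.
by rewrite (per_conv ps) dom_per_per.
Qed.

Lemma op_submodule (U : 'M[F]_d) : (forall Q, difun Q -> stablemx U (a Q)) ->
  is_submodule r U.
Proof.
move=> h x; rewrite act_op mulmx_sumr summx_sub // => s /andP[ps /eqP e].
exact/h/difun_restr.
Qed.

Lemma op_commute g : (forall Q, difun Q -> g *m a Q = a Q *m g) ->
  forall x, g *m r x = r x *m g.
Proof.
move=> h x; rewrite act_op mulmx_sumr mulmx_suml; apply:
  eq_bigr => s /andP[ps /eqP e].
exact/h/difun_restr.
Qed.

End OneGraded.
End Graded.

Section GradedMaschke.

Variables (F : fieldType) (n d : nat).
Hypothesis charF0 : [pchar F] =i pred0.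
Local Notation rel := {set 'I_n * 'I_n}.
Variables (r : PIstar n -> 'M[F]_d) (p : rel -> 'M[F]_d).
Hypothesis gr : graded r p.
Local Notation a := (arrow_op r p).

Definition arrows_from (s : rel) : {set rel} :=
  [set Q | difun Q && (dom_per Q == s)].

Lemma arrows_fromE s Q : (Q \in arrows_from s) = difun Q && (dom_per Q == s).
Proof. by rewrite inE. Qed.

(** This reindexes, in the averaging below, a sum over the arrows out of the
    codomain of R as a sum over the arrows out of its domain. *)
Lemma rcomp_arrows_from (R Q : rel) : difun R ->
  Q \in arrows_from (dom_per R^v) ->
  [/\ R ** Q \in arrows_from (dom_per R), R^v ** (R ** Q) = Q
    & (R ** Q)^v ** R = Q^v].
Proof.
move=> dR; rewrite arrows_fromE => /andP[dQ /eqP e].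
have le : dom_per R^v ** dom_per Q = dom_per R^v by rewrite e dom_per_idem //
  difun_conv.
have RRQ : R^v ** (R ** Q) = Q.
  by rewrite rcompA -{2}[R]convK -dom_perE -e dom_per_rcomp.
split=> //; last by rewrite -[in RHS]RRQ [in RHS]conv_rcomp convK.
by rewrite arrows_fromE (difun_rcomp_le dR le) (dom_per_rcomp_le dR le) eqxx.
Qed.

Lemma card_arrows_from (R : rel) : difun R ->
  #|arrows_from (dom_per R^v)| = #|arrows_from (dom_per R)|.
Proof.
move=> dR; rewrite -(@card_in_imset _ _ (fun Q => R ** Q)); last first.
  move=> Q Q' /(rcomp_arrows_from dR)[_ e _] /(rcomp_arrows_from dR)[_ e' _] /=
    h.
  by rewrite -e -e' h.
apply: eq_card => Q; apply/imsetP/idP => [[Q' Q'in ->]|Qin].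
  by have [] := rcomp_arrows_from dR Q'in.
have Qin' : Q \in arrows_from (dom_per (R^v)^v) by rewrite convK.
have [h1 h2 _] := rcomp_arrows_from (difun_conv dR) Qin'.
by exists (R^v ** Q) => //; rewrite -[LHS]h2 convK.
Qed.

(** Maschke's theorem for the groupoid: the separability idempotent is the sum
    over all arrows Q of Q (x) Q^-1, divided by the number of arrows out of the
    domain of Q. By the preceding lemmas this number is constant on connected
    components, so that the idempotent commutes with all arrows. *)
Lemma graded_projections : has_projections r.
Proof.
pose kap (s : rel) : F := #|arrows_from s|%:R^-1.
pose a1 Q := if difun Q then kap (dom_per Q) *: a Q else 0.
pose b1 Q := if difun Q then a Q^v else 0.
pose E g := \sum_Q a1 Q *m g *m b1 Q.
have EE g : E g = \sum_(Q | difun Q) kap (dom_per Q) *: (a Q *m g *m a Q^v).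
  rewrite [RHS]big_mkcond; apply: eq_bigr => Q _; rewrite /a1 /b1.
  by case: ifP => _; rewrite ?mulmx0 // -!scalemxAl.
apply: (separable_projections (a := a1) (b := b1)).
- move=> W sW Q; rewrite /a1; case: ifP => _; last by rewrite mulmx0 sub0mx.
  by rewrite -scalemxAr scalemx_sub // (op_stable gr).
- move=> W sW Q; rewrite /b1; case: ifP => _; last by rewrite mulmx0 sub0mx.
  by rewrite (op_stable gr).
- have -> : \sum_Q a1 Q *m b1 Q = E 1%:M.
    by apply: eq_bigr => Q _; rewrite mulmx1.
  rewrite EE -[RHS](gr_sum gr) (partition_big (fun Q => dom_per Q) predT) //=.
  apply: eq_bigr => s _; have [ps|nps] := boolP (per s); last first.
    rewrite (gr_per gr nps) big1 // => Q /andP[dQ /eqP e].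
    by case/negP: nps; rewrite -e per_dom_per.
  rewrite (eq_bigr (fun=> kap s *: p s)) => [|Q /andP[dQ /eqP e]].
    rewrite sumr_const (eq_card (B := arrows_from s)) => [|Q];
      last by rewrite !inE.
    rewrite -scaler_nat scalerA /kap mulfV ?scale1r //.
    apply: natr_neq0 => //; apply/card_gt0P; exists s.
    by rewrite arrows_fromE difun_per // dom_per_per ?eqxx.
  rewrite mulmx1 (op_comp gr) ?difun_conv // eqxx -dom_perE e (op_per gr) //.
move=> x g.
apply: (op_commute gr) => R dR; rewrite -/(E g) EE mulmx_suml mulmx_sumr.
rewrite (bigID (fun Q => dom_per Q == dom_per R)) /= [X in _ + X]big1 ?addr0;
  last first.
  move=> Q /andP[dQ ne]; rewrite -scalemxAl -mulmxA (op_comp gr) ?difun_conv //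
    convK.
  by rewrite (negPf ne) mulmx0 scaler0.
rewrite [RHS](bigID (fun Q => dom_per Q == dom_per R^v)) /= [X in _ = _ + X]big1
  ?addr0; last first.
  move=> Q /andP[dQ ne]; rewrite -scalemxAr !mulmxA (op_comp gr) //.
  by rewrite eq_sym (negPf ne) !mul0mx scaler0.
rewrite (reindex_onto (fun Q => R ** Q) (fun Q => R^v ** Q)) /=; last first.
  move=> Q h; have Qin : Q \in arrows_from (dom_per (R^v)^v) by rewrite convK
    arrows_fromE.
  by have [_ e _] := rcomp_arrows_from (difun_conv dR) Qin;
    rewrite -[RHS]e convK.
apply: eq_big => [Q|Q /andP[h /eqP e]].
  apply/andP/andP => [[h /eqP <-]|/andP h]; last first.
    have Qin : Q \in arrows_from (dom_per R^v) by rewrite arrows_fromE.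
    have [h1 h2 _] := rcomp_arrows_from dR Qin.
    by rewrite arrows_fromE in h1; split=> //; apply/eqP.
  have Qin : R ** Q \in arrows_from (dom_per (R^v)^v) by rewrite convK
    arrows_fromE.
  have [h1 _ _] := rcomp_arrows_from (difun_conv dR) Qin.
  by move: h1; rewrite arrows_fromE => /andP.
have Qin : Q \in arrows_from (dom_per R^v).
  have Qin : R ** Q \in arrows_from (dom_per (R^v)^v) by rewrite convK
    arrows_fromE.
  by rewrite -e; have [] := rcomp_arrows_from (difun_conv dR) Qin.
have [h1 h2 h3] := rcomp_arrows_from dR Qin.
move: h1 (Qin); rewrite !arrows_fromE => /andP[dRQ /eqP e1] /andP[dQ /eqP e2].
rewrite -scalemxAl -scalemxAr /kap e1 e2 card_arrows_from //; congr (_ *: _).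
rewrite -mulmxA (op_comp gr) ?difun_conv // convK e1 eqxx h3.
by rewrite !mulmxA (op_comp gr) // e2 eqxx.
Qed.

End GradedMaschke.

(** * Restriction to the group of one subquotient *)

Section Restriction.

Variables (F : fieldType) (n d m : nat) (tau : numbered_subquotient n m).
Local Notation rel := {set 'I_n * 'I_n}.
Variables (r : PIstar n -> 'M[F]_d) (p : rel -> 'M[F]_d).
Hypothesis gr : graded r p.
Local Notation a := (arrow_op r p).
Local Notation theta := (numfun tau).
Local Notation tp := (fibers ord0 theta).
Local Notation rt := (fun s : 'S_m => r (sym_elt tau s)).

Let otheta : onto theta := onto_numfun tau.

Lemma op_sym s : a (arrow theta (relabel (row_action m) theta s)) = p tp *m rt
  s.
Proof. by rewrite arrow_opE PI_of_arrow dom_per_arrow // onto_relabel. Qed.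

Lemma op_group_arrow Q : difun Q -> dom_per Q = tp -> dom_per Q^v = tp ->
  exists s, a Q = p tp *m rt s.
Proof.
move=> dQ e e'; have cQ : compat ord0 Q theta by apply: compat_dom_per.
have [|||s hs] := @onto_fibers_eq _ _ theta (push ord0 Q theta).
- exact: otheta.
- exact: onto_push.
- by rewrite fibers_push_dom_per.
by exists s; rewrite -op_sym -hs -arrow_of.
Qed.

Lemma p_sym s : p tp *m rt s *m p tp = p tp *m rt s.
Proof.
rewrite -op_sym (op_cod gr) ?difun_arrow ?onto_relabel //.
rewrite arrow_conv dom_per_arrow // fibers_relabel ?eqxx //; exact: row_action0.
Qed.

(** Let W be a nonzero submodule of U p for the group of tau. The arrows out of
    tau move W to a submodule I of U for the whole semigroup, so I = U. Only the
    arrows from tau to itself come back to tau, and they form the group; so U p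
    = I p is contained in W. *)
Lemma restriction_simple U : is_simple r U -> U *m p tp != 0 ->
  is_simple rt <<U *m p tp>>%MS.
Proof.
move=> [sU nU minU] nUp; split.
- move=> s; rewrite genmxE (eqmxMr _ (genmxE _)) -mulmxA -p_sym mulmxA
  submxMr //.
  rewrite mulmxA; apply: submx_trans (sU _); apply: submxMr.
  exact: (gr_stable gr).
- by rewrite -mxrank_eq0 genmxE mxrank_eq0.
move=> W sW; rewrite !genmxE => WU nW.
have Wp : W *m p tp = W.
  have /submxP[w ->] := WU; by rewrite -!mulmxA (gr_orth gr) eqxx.
pose Q0 (Q : rel) := difun Q && (dom_per Q == tp).
pose I := (\sum_(Q | Q0 Q) <<W *m a Q>>)%MS.
have sI : is_submodule r I.
  apply: (op_submodule gr) => R dR; rewrite sumsmxMr;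
    apply/sumsmx_subP=> Q /andP[dQ /eqP eQ].
  rewrite (eqmxMr _ (genmxE _)) -mulmxA (op_comp gr) //; case: eqP => e;
    last by rewrite mulmx0 sub0mx.
  have le : dom_per Q^v ** dom_per R = dom_per Q^v by rewrite e dom_per_idem.
  apply: (sumsmx_sup (Q ** R)); last by rewrite genmxE.
  by rewrite /Q0 (difun_rcomp_le dQ le) (dom_per_rcomp_le dQ le) eQ /=.
have WI : (W <= I)%MS.
  have pt := per_fibers ord0 theta.
  apply: (sumsmx_sup tp); first by rewrite /Q0 difun_per // dom_per_per /=.
  by rewrite genmxE (op_per gr) // Wp.
have IU : (I <= U)%MS.
  apply/sumsmx_subP=> Q _; rewrite genmxE; apply:
    submx_trans (op_stable gr Q sU).
  apply: submxMr; apply: submx_trans WU _; exact: (gr_stable gr).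
have UI : (U <= I)%MS.
  by apply: minU => //; apply: contraNneq nW => I0; rewrite -submx0 -I0.
apply: submx_trans (submxMr _ UI) _; rewrite sumsmxMr;
  apply/sumsmx_subP=> Q /andP[dQ /eqP eQ].
rewrite (eqmxMr _ (genmxE _)) -mulmxA (op_cod gr) //; case: eqP => e;
  last by rewrite mulmx0 sub0mx.
have [s ->] := op_group_arrow dQ eQ e.
by rewrite mulmxA Wp; apply: sW.
Qed.

End Restriction.

(** The summand of s in a module with a frame over functions is spanned by the z
    (x) v with z of subquotient s; all the axioms of a grading hold on these
    generators. *)
Section FrameGraded.

Variables (F : fieldType) (n : nat) (P : finType) (pt : P) (gT : finGroupType).
Hypothesis charF0 : [pchar F] =i pred0.
Variable to : {action gT &-> P}.
Hypothesis to_pt : forall g, to pt g = pt.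
Variables (ok : pred {ffun 'I_n -> P}) (d : nat) (V : gT -> 'M[F]_d).
Local Notation rel := {set 'I_n * 'I_n}.
Local Notation PI_act := (PI_act pt).
Local Notation fibers := (fibers pt).
Local Notation compat := (compat pt).
Local Notation push := (push pt).

Hypothesis aP : frame_action [set: gT]%G ok (relabel to) PI_act V.
Variables (N : nat) (r : PIstar n -> 'M[F]_N).
Variables (i : {ffun 'I_n -> P} -> 'M[F]_(d, N))
  (q : {ffun 'I_n -> P} -> 'M[F]_(N, d)).
Hypothesis fr : frame [set: gT]%G ok (relabel to) PI_act V r i q.

Definition frame_proj (s : rel) : 'M[F]_N :=
  fhom [set: gT]%G ok q (fun z => if fibers z == s then i z else 0).
Local Notation p := frame_proj.

Lemma frame_projE z s : ok z -> i z *m p s = if fibers z == s then i z else 0.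
Proof.
move=> okz; rewrite (fhomE aP charF0 fr) // => {}z h {}okz hB.
rewrite fibers_relabel //; case: ifP => _; last by rewrite mulmx0.
exact: (frame_move fr).
Qed.

Let act z x : ok z -> i z *m r x = if compat (rel_of x) z then i
  (push (rel_of x) z) else 0.
Proof. by move=> okz; rewrite (frame_act fr) // /PI_act; case: ifP. Qed.

Let okpush z x : ok z -> compat (rel_of x) z -> ok (push (rel_of x) z).
Proof. by move=> okz c; apply: (lact_ok aP okz (x := x));
  rewrite /PI_act c. Qed.

Lemma frame_graded : graded r p.
Proof.
have ext := frame_ext charF0 fr.
split.
- move=> s t; apply: ext => z okz; rewrite mulmxA frame_projE //.
  case: eqP => [<-|nz]; last by rewrite mul0mx; case: ifP => _;
    rewrite ?mulmx0 // frame_projE //; case: eqP.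
  by rewrite frame_projE //; case: eqP => [_|_];
    rewrite ?mulmx0 // frame_projE // eqxx.
- apply: ext => z okz; rewrite mulmx1 mulmx_sumr (bigD1 (fibers z)) //=
  frame_projE // eqxx.
  by rewrite big1 ?addr0 // => s /negPf ne; rewrite frame_projE // eq_sym ne.
- move=> s nps; apply: ext => z okz; rewrite mulmx0 frame_projE //.
  by case: eqP => // e; rewrite -e per_fibers in nps.
- move=> s x ps; apply: ext => z okz; rewrite mulmxA frame_projE //.
  case: eqP => [e|ne]; last first.
    rewrite mul0mx; case: ifP => _; rewrite ?mulmx0 // mulmxA frame_projE //.
    by case: eqP => // _; rewrite mul0mx.
  rewrite act // /compat e; case: ifP => [/eqP c|_]; last by rewrite mulmx0.
  rewrite mulmxA frame_projE // e eqxx act //.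
  have dR : difun (s ** rel_of x).
    by apply: difun_rcomp_le; rewrite ?difun_per ?difun_rel_of // (per_conv ps)
      dom_per_per.
  have cz : compat (rel_of x) z by rewrite /compat e c.
  by have [c' e'] := push_restr cz; rewrite rel_of_PI_of // -e c' e'.
- move=> Q dQ; apply: ext => z okz; rewrite arrow_opE !mulmxA frame_projE //.
  case: eqP => [e|_]; last by rewrite !mul0mx.
  have c := compat_dom_per dQ e; have c' : compat (rel_of (PI_of Q)) z by
    rewrite rel_of_PI_of.
  have okp := okpush okz c'.
  rewrite act // c' frame_projE // rel_of_PI_of // fibers_push_dom_per ?eqxx //.
- move=> Q R dQ dR e; apply: ext => z okz; rewrite !arrow_opE !mulmxA
  !frame_projE //.
  have le : dom_per Q^v ** dom_per R = dom_per Q^v by rewrite e dom_per_idem.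
  have dQR := difun_rcomp_le dQ le; rewrite (dom_per_rcomp_le dQ le).
  case: eqP => [ez|_]; last by rewrite !mul0mx.
  have c := compat_dom_per dQ ez; have c' : compat (rel_of (PI_of Q)) z by
    rewrite rel_of_PI_of.
  have okp := okpush okz c'.
  have cR : compat R (push Q z) by rewrite /compat fibers_push_dom_per // e
    dom_per_idem.
  have eQ := rel_of_PI_of dQ; rewrite eQ in okp.
  rewrite act // eQ c act // (rel_of_PI_of dR) cR.
  by have [c2 e2] := push_comp c cR; rewrite act // rel_of_PI_of // c2 e2.
move=> s ps; apply: ext => z okz; rewrite mulmxA frame_projE //.
case: eqP => [e|_]; last by rewrite mul0mx.
rewrite act // rel_of_PI_of ?difun_per // -e compat_fibers push_fibers //.
Qed.

End FrameGraded.

(** Here s is a representation of the symmetric group, rN the corresponding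
    module induced from the subquotient tau, given by a frame, and r any graded
    module. *)
Section CellMultiplicity.

Variables (F : fieldType) (n d m e : nat) (tau : numbered_subquotient n m).
Hypothesis charF0 : [pchar F] =i pred0.
Local Notation rel := {set 'I_n * 'I_n}.
Variables (r : PIstar n -> 'M[F]_d) (p : rel -> 'M[F]_d).
Hypothesis gr : graded r p.
Variable s : mx_representation F [set: 'S_m]%G e.
Variables (N : nat) (rN : PIstar n -> 'M[F]_N).
Variables (i : {ffun 'I_n -> 'I_m.+1} -> 'M[F]_(e, N))
  (q : {ffun 'I_n -> 'I_m.+1} -> 'M[F]_(N, e)).
Local Notation ract := (relabel (row_action m)).
Hypothesis fr : frame [set: 'S_m]%G (@onto n m) ract (PI_act ord0) s rN i q.

Local Notation a := (arrow_op r p).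
Local Notation theta := (numfun tau).
Local Notation tp := (fibers ord0 theta).
Local Notation rt := (fun g : 'S_m => r (sym_elt tau g)).

Let otheta : onto theta := onto_numfun tau.
Let aP := relabel_frame_action n s.
Let pN := frame_proj ord0 'S_m (@onto n m) i q.
Let grN : graded rN pN := frame_graded charF0 (@row_action0 m) aP fr.

Let pNE z t : onto z -> i z *m pN t = if fibers ord0 z == t then i z else 0.
Proof. exact: (frame_projE charF0 (@row_action0 m) aP fr). Qed.

Let i_dual : i theta *m q theta = 1%:M.
Proof.
rewrite (frame_dual fr) // (big_pred1 1%g) ?repr_mx1 // => g; rewrite inE /=.
apply/eqP/eqP => [/(relabel_free otheta)//|->]; exact: relabel1.
Qed.

Let i_mul z x : onto z -> compat ord0 (rel_of x) z ->
  i z *m rN x = i (push ord0 (rel_of x) z).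
Proof. by move=> oz c; rewrite (frame_act fr) // /PI_act c. Qed.

(** The summand of tau in rN is theta (x) s, a copy of s; an isomorphism from rN
    to U sends it to the summand U p of tau in U. *)
Lemma iso_restrict U : is_simple r U -> is_iso_to r U rN ->
  U *m p tp != 0 /\ is_iso_to rt <<U *m p tp>>%MS s.
Proof.
move=> [_ nU _] [f [ff fU frN]].
have iff : row_free (i theta *m f).
  apply: inj_row_free => v; rewrite mulmxA => /eqP;
    rewrite mulmx_free_eq0 // => /eqP vi.
  by rewrite -[v]mulmx1 -i_dual mulmxA vi mul0mx.
have pf := gr_hom gr tp grN frN.
have eU : (i theta *m f :=: U *m p tp)%MS.
  apply: eqmx_trans (eqmxMr _ fU); rewrite -pf; apply: eqmxMr; apply/eqmxP/andP;
    split.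
    have <- : i theta *m pN tp = i theta by rewrite pNE ?eqxx.
    exact: submxMl.
  rewrite /pN /frame_proj /fhom scalemx_sub // summx_sub // => z oz.
  case: eqP => [ez|_]; last by rewrite mulmx0 sub0mx.
  have [g ->] := onto_fibers_eq otheta oz (esym ez).
  by rewrite (frame_move fr) ?inE // mulmxA submxMl.
split; last first.
  exists (i theta *m f); split=> // [|g]; first by apply:
    eqmx_trans eU (eqmx_sym (genmxE _)).
  rewrite mulmxA -(frame_move fr) ?inE // -[RHS]mulmxA -frN mulmxA i_mul //.
    by rewrite rel_of_sym_elt push_arrow // onto_relabel.
  by rewrite rel_of_sym_elt compat_arrow // onto_relabel.
apply: contraNneq nU => U0; rewrite -mxrank_eq0 -fU mxrank_eq0.
have i0 : i theta = 0.
  apply/eqP; rewrite -(mulmx_free_eq0 _ ff) -mxrank_eq0 eU mxrank_eq0;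
    exact/eqP.
apply/eqP; apply: (frame_ext charF0 fr) => z oz; rewrite mulmx0.
(* If theta (x) s vanishes then s has dimension 0, and so does rN. *)
have e0 : (1%:M : 'M[F]_e) = 0 by rewrite -i_dual i0 mul0mx.
by rewrite -[LHS]mul1mx e0 mul0mx.
Qed.

(** A homomorphism h from s to the summand of tau extends to rN: the element z
    (x) v goes to h v moved along the arrow from theta to z. The extension is
    injective since every summand of rN is moved to that of tau by an invertible
    arrow, and it is surjective as U is simple. *)
Lemma iso_induce U : is_simple r U -> U *m p tp != 0 ->
  is_iso_to rt <<U *m p tp>>%MS s -> is_iso_to r U rN.
Proof.
move=> [sU nU minU] nUp [h [fh hU hs]].
have hU' : (h :=: U *m p tp)%MS by apply: eqmx_trans hU (genmxE _).
have hp : h *m p tp = h.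
  have /submxP[w ->] : (h <= U *m p tp)%MS by rewrite hU'.
  by rewrite -!mulmxA (gr_orth gr) eqxx.
pose Phi z := h *m a (arrow theta z).
pose f := fhom [set: 'S_m]%G (@onto n m) q Phi.
have fE z : onto z -> i z *m f = Phi z.
  apply: (fhomE aP charF0 fr) => {}z g oz _.
  have e1 : h *m rt g = h *m a (arrow theta (ract theta g)).
    by rewrite (op_sym tau r p) mulmxA hp.
  rewrite /Phi [RHS]mulmxA hs e1 -[RHS]mulmxA.
  rewrite (op_comp gr) ?difun_arrow ?onto_relabel //.
  rewrite arrow_conv !dom_per_arrow ?onto_relabel // fibers_relabel ?eqxx;
    last exact: row_action0.
  by rewrite -(arrow_relabel theta z g) arrow_comp // onto_relabel.
have frN x : rN x *m f = f *m r x.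
  apply: (frame_ext charF0 fr) => z oz; rewrite !mulmxA fE // (frame_act fr) //.
  rewrite /Phi -mulmxA (op_act gr) ?difun_arrow // arrow_conv dom_per_arrow //
    /PI_act /compat.
  case: ifP => c /=; last by rewrite mulmx0 mul0mx.
  by rewrite fE ?onto_push // /Phi arrow_push.
have ftheta : i theta *m f = h by rewrite fE // /Phi arrow_id (op_per gr)
  ?per_fibers.
have fU : (f <= U)%MS.
  rewrite /f /fhom scalemx_sub // summx_sub // => z oz.
  apply: submx_trans (submxMl _ _) _; rewrite /Phi.
  apply: submx_trans (op_stable gr _ sU); apply: submxMr; rewrite hU'.
  exact: (gr_stable gr).
exists f; split=> //; last first.
  apply/eqmxP; rewrite fU -(genmxE f) minU ?genmxE //.
    by move=> x; rewrite genmxE (eqmxMr _ (genmxE _)) -frN submxMl.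
  rewrite -mxrank_eq0 genmxE mxrank_eq0; apply: contraNneq nUp => f0.
  by rewrite -mxrank_eq0 -hU' -ftheta f0 mulmx0 mxrank0.
apply: inj_row_free => v vf.
rewrite -[v]mulmx1 -(gr_sum grN) mulmx_sumr big1 // => t _.
have vpf : v *m pN t *m f = 0.
  by rewrite -mulmxA (gr_hom gr t grN frN) mulmxA vf mul0mx.
have [/existsP[z /andP[oz /eqP ez]]|noz] :=
  boolP [exists z : {ffun 'I_n -> 'I_m.+1}, onto z && (fibers ord0 z == t)];
    last first.
  rewrite /pN /frame_proj /fhom big1 ?scaler0 ?mulmx0 // => z oz.
  case: eqP => [ez|_]; last by rewrite mulmx0.
  by case/negP: noz; apply/existsP; exists z; rewrite oz ez eqxx.
have /submxP[w ew] : (v *m pN t <= i z)%MS.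
  apply: submx_trans (submxMl _ _) _.
  rewrite /pN /frame_proj /fhom scalemx_sub // summx_sub // => z' oz'.
  case: eqP => [ez'|_]; last by rewrite mulmx0 sub0mx.
  have [|g ->] := onto_fibers_eq oz oz'; first by rewrite ez ez'.
  by rewrite (frame_move fr) ?inE // mulmxA submxMl.
rewrite ew; suff -> : w = 0 by rewrite mul0mx.
move: vpf; rewrite ew -mulmxA fE // /Phi =>
  /(congr1 (mulmx^~ (a (arrow z theta)))).
rewrite mul0mx -!mulmxA (op_comp gr) ?difun_arrow // arrow_conv
  !dom_per_arrow // eqxx.
rewrite arrow_comp // arrow_id (op_per gr) ?per_fibers // hp => /eqP.
by rewrite mulmx_free_eq0 // => /eqP.
Qed.

(** Restriction to the summand of tau sends a decomposition of r into simple
    modules to a decomposition of this summand into simple representations,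
    after deleting the zero terms; the terms isomorphic to rN become those
    isomorphic to s. *)
Lemma mult_in_restrict c : mult_in r 1%:M rN c -> mult_in rt (p tp) s c.
Proof.
case=> I [U [sU ->]]; have [simU sumU _] := sU.
have /mxdirect_sumsP dx := simple_sum_direct sU.
pose J := {x : I | U x *m p tp != 0}.
have sumP : (\sum_x <<U x *m p tp>> :=: p tp)%MS.
  apply: eqmx_trans (eqmx_sym (sumsmxMr_gen _ _ _)) _.
  by rewrite -[X in (_ :=: X)%MS]mul1mx; apply: eqmxMr.
have dP : mxdirect (\sum_x <<U x *m p tp>>)%MS.
  apply/mxdirect_sumsP => x _; apply/eqP; rewrite -submx0
    -[X in (_ <= X)%MS](dx x isT).
  have le y : (<<U y *m p tp>> <= U y)%MS.
    by rewrite genmxE; apply: (gr_stable gr); have [] := simU y.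
  rewrite capmxS //; apply/sumsmx_subP=> y yx.
  by apply: (sumsmx_sup y).
have zero x : U x *m p tp == 0 -> (<<U x *m p tp>> = 0 :> 'M[F]_d)%MS.
  by move/eqP->; apply: genmx0.
exists J, (fun j : J => <<U (val j) *m p tp>>%MS); split; first split.
- by move=> j; apply: (restriction_simple gr) => //; exact: (valP j).
- apply: eqmx_trans sumP; rewrite (bigID (fun x => U x *m p tp != 0)) /= .
  rewrite [X in (_ + X)%MS]big1 => [|x]; last by rewrite negbK => /zero.
  by rewrite addsmx0_id (big_sub (fun x => U x *m p tp != 0)).
- rewrite -sumP (mxdirectP dP) /= [RHS](bigID (fun x => U x *m p tp != 0)) /=.
  rewrite [X in (_ + X)%N]big1 => [|x]; last by rewrite negbK => /zero->;
    rewrite mxrank0.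
  by rewrite addn0 (big_sub (fun x => U x *m p tp != 0)).
rewrite /iso_count -(card_imset _ val_inj); apply: eq_card => x; rewrite inE.
apply/asboolP/imsetP => [h|[j]].
  have [nz h'] := iso_restrict (simU x) h.
  by exists (exist _ x nz); rewrite // inE; apply/asboolP.
rewrite inE => /asboolP h ->; apply: iso_induce => //; exact: (valP j).
Qed.

End CellMultiplicity.

Section GroupMaschke.

Variables (F : fieldType) (gT : finGroupType) (d : nat) (r : gT -> 'M[F]_d).
Hypothesis charF0 : [pchar F] =i pred0.
Hypothesis r1 : r 1%g = 1%:M.
Hypothesis rM : forall g h, r (g * h)%g = r g *m r h.

Lemma group_projections : has_projections r.
Proof.
have c0 : #|gT|%:R != 0 :> F by apply: natr_neq0 => //;
  rewrite -cardsT cardG_gt0.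
apply: (separable_projections (a := fun g => #|gT|%:R^-1 *: r g^-1%g) (b := r)).
- by move=> W sW g; rewrite -scalemxAr scalemx_sub.
- by move=> W sW g.
- rewrite (eq_bigr (fun=> #|gT|%:R^-1 *: 1%:M)) => [|g _].
    by rewrite sumr_const -scaler_nat scalerA mulfV // scale1r.
  by rewrite -scalemxAl -rM mulVg r1.
move=> x g; rewrite mulmx_suml mulmx_sumr (reindex_inj (mulIg x^-1%g)) /=.
apply: eq_bigr => h _; rewrite -!scalemxAl -scalemxAr; congr (_ *: _).
by rewrite -!mulmxA -rM mulgKV invMg invgK rM -mulmxA.
Qed.

End GroupMaschke.

(** * Modules induced from the stabilizers of matrices *)

Section OnesPerm.

Variables (k l m : nat) (M : 'M[bool]_(k.+1, l.+1)).
Variable e : 'I_m -> 'I_k.+1 * 'I_l.+1.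
Hypothesis eP : is_ones_numbering M e.
Local Notation gT := ('S_k * 'S_l)%type.
Implicit Type h : gT.

Let e_inj : injective e. Proof. by case: eP. Qed.

Lemma ones_numbered c : c \in ones M -> exists i, e i = c.
Proof. by case: eP => _ <- /imsetP[i _ ->]; exists i. Qed.

Lemma numbered_ones i : e i \in ones M.
Proof. by case: eP => _ <-; apply: imset_f. Qed.

Lemma ones_act (M' : 'M[bool]_(k.+1, l.+1)) h c :
  (c \in ones (mx01_act M' h)) = (entry_act c h^-1%g \in ones M').
Proof. by rewrite !inE mxE -surjective_pairing. Qed.

Lemma ones_inj : injective (@ones k l).
Proof.
move=> M1 M2 /setP h; apply/matrixP=> i j.
by have := h (i, j); rewrite !inE.
Qed.

Lemma stabilizerP h : reflect (mx01_act M h = M) (h \in stabilizer M).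
Proof. exact: (@astab1P _ _ (mx01_action k l) M h). Qed.

Lemma ones_permP h : h \in stabilizer M -> forall i, e (ones_perm e h i) =
  entry_act (e i) h.
Proof.
move/stabilizerP => Mh; rewrite /ones_perm; case:
  pickP => [s /forallP hs i|no] /=.
  exact/eqP.
have ex i : exists j, e j = entry_act (e i) h.
  apply: ones_numbered; rewrite -Mh ones_act -(entry_actM _ h h^-1%g) mulgV
    entry_act1.
  exact: numbered_ones.
have [s hs] := choice ex.
have s_inj : injective s.
  move=> i j eij; apply: e_inj.
  by apply: (@act_inj _ _ _ (entry_action k l) h); rewrite /= -!hs eij.
have /negP[] := no (perm s_inj).
by apply/forallP=> i; rewrite permE hs.
Qed.

Lemma ones_perm1 : ones_perm e 1%g = 1%g.
Proof.
apply/permP=> i; apply: e_inj; rewrite ones_permP ?entry_act1 ?perm1 //.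
Qed.

Lemma ones_permM : {in stabilizer M &, {morph ones_perm e : g h / (g * h)%g}}.
Proof.
move=> g h gS hS; apply/permP=> i; apply: e_inj.
rewrite permM !ones_permP //; last exact: groupM.
exact: entry_actM.
Qed.

Variables (F : fieldType) (d1 d2 : nat).
Variables (V1 : mx_representation F [set: 'S_k]%G d1).
Variables (V2 : mx_representation F [set: 'S_l]%G d2).

(** The right action of the stabilizer of M on the basis of the group algebra of
    'S_m, with products of permutations from left to right. *)
Definition ones_ract (t : 'S_m) h : 'S_m := (ones_perm e h * t)%g.
Definition right_mul (s t : 'S_m) : option 'S_m := Some (t * s)%g.

Lemma ind_frame_action : frame_action 'C[M | mx01_action k l]%G xpredT ones_ract
  right_mul
  (outer_repr V1 V2).
Proof.
split=> //.
- by move=> z; rewrite /ones_ract ones_perm1 mul1g.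
- by move=> g h gS hS z; rewrite /ones_ract ones_permM // mulgA.
- exact: (frame_repr1 (pair_frame_action 0 V1 V2)).
- by move=> g h _ _; apply: (frame_reprM (pair_frame_action 0 V1 V2));
  rewrite inE.
by move=> h _ x z; rewrite /right_mul /ones_ract /= mulgA.
Qed.

Definition ind_module : 'S_m -> _ := balanced_tensor
    (fun s : 'S_m => basis_mx F [set: 'S_m] (fun t => t * s)%g)
    (stabilizer M)
    (fun g : gT => basis_mx F [set: 'S_m] (fun t => ones_perm e g * t)%g)
    (outer_repr V1 V2).

Lemma ind_frame : exists i q,
  frame 'C[M | mx01_action k l]%G xpredT ones_ract right_mul (outer_repr V1 V2)
    ind_module i q.
Proof.
apply: (balanced_tensor_frame (u := id) ind_frame_action) => //.
by move=> x _; exists x.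
Qed.

End OnesPerm.

(** * Pairs of subquotients with a given common refinement *)

Section Labellings.

Variables (n k l m : nat) (tau : numbered_subquotient n m).
Local Notation theta := (numfun tau).
Local Notation P := ('I_k.+1 * 'I_l.+1)%type.
Local Notation gT := ('S_k * 'S_l)%type.
Local Notation pt := ((ord0, ord0) : P).
Implicit Type e : 'I_m -> P.

Let otheta : onto theta := onto_numfun tau.

(** The function that places the parts of tau, in the order given by t, at the
    entries of M equal to 1. Row and column of an entry are the numbers of the
    parts of the two subquotients that contain the given part of tau, and 0
    means that it lies outside of the support. The inverse of t turns left
    multiplication on 'S_m into the action of the group of tau. *)
Definition labelling e (t : 'S_m) : {ffun 'I_n -> P} :=
  [ffun x => if unlift ord0 (theta x) is Some i then e (t^-1%g i) else pt].

Lemma labellingE e t x i : theta x = lift ord0 i ->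
  labelling e t x = e (t^-1%g i).
Proof. by move=> ex; rewrite ffunE ex liftK. Qed.

Lemma labelling0 e t x : theta x = ord0 -> labelling e t x = pt.
Proof. by move=> ex; rewrite ffunE ex unlift_none. Qed.

Lemma theta_lift i : exists x, theta x = lift ord0 i.
Proof. by move/ontoP: otheta => h; apply: h. Qed.

Section OneMatrix.

Variables (M : 'M[bool]_(k.+1, l.+1)) (e : 'I_m -> P).
Hypothesis eP : is_ones_numbering M e.
Hypothesis MQ : M \in Qtilde k l m.

Let e_inj : injective e. Proof. by case: eP. Qed.

Lemma numbering_neq_pt i : e i != pt.
Proof.
have := numbered_ones eP i; rewrite inE; apply: contraTneq => ->.
by move: MQ; rewrite inE => /and4P[].
Qed.

Lemma fibers_labelling t : fibers pt (labelling e t) = fibers ord0 theta.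
Proof.
apply/setP=> -[x y]; rewrite !mem_fibers.
have [i ex|ex] := unliftP ord0 (theta x); last first.
  by rewrite (labelling0 _ _ ex) ex !eqxx !andbF.
rewrite (labellingE _ _ ex) ex numbering_neq_pt /= andbT.
have [j ey|ey] := unliftP ord0 (theta y); last first.
  by rewrite (labelling0 _ _ ey) ey (negPf (numbering_neq_pt _)).
rewrite (labellingE _ _ ey) ey (inj_eq e_inj) (inj_eq (@perm_inj _ _)).
by rewrite (inj_eq (@lift_inj _ ord0)) andbT.
Qed.

(** All parts of the two subquotients occur since no row or column of positive
    index vanishes. *)
Lemma onto_labelling t : onto2 (labelling e t).
Proof.
have hit c : c \in ones M -> exists x, labelling e t x = c.
  move=> /(ones_numbered eP)[i <-]; have [x ex] := theta_lift (t i).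
  by exists x; rewrite (labellingE _ _ ex) permK.
move: MQ; rewrite inE => /and4P[_ _ /forallP rows /forallP cols].
apply/andP; split; apply/ontoP => c n0.
  have /existsP[j Mcj] := implyP (rows c) n0.
  by have [|x ex] := hit (c, j); rewrite ?inE //; exists x; rewrite ffunE ex.
have /existsP[j Mcj] := implyP (cols c) n0.
by have [|x ex] := hit (j, c); rewrite ?inE //; exists x; rewrite ffunE ex.
Qed.

Lemma labelling_relabel t (h : gT) : h \in stabilizer M ->
  labelling e (ones_perm e h * t)%g = relabel (entry_action k l) (labelling e t)
    h.
Proof.
move=> hS; apply/ffunP=> x; rewrite [RHS]ffunE.
have [i ex|ex] := unliftP ord0 (theta x); last first.
  by rewrite !(labelling0 _ _ ex) entry_action0.
rewrite !(labellingE _ _ ex) invMg permM.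
apply: (@act_inj _ _ _ (entry_action k l) h); rewrite actKV /=.
by rewrite -(ones_permP eP) // permKV.
Qed.

Lemma labelling_push t (s : 'S_m) :
  compat pt (rel_of (sym_elt tau s)) (labelling e t) /\
  push pt (rel_of (sym_elt tau s)) (labelling e t) = labelling e (t * s)%g.
Proof.
rewrite rel_of_sym_elt; set Q := arrow _ _.
have os : onto (relabel (row_action m) theta s) by rewrite onto_relabel.
split; first by rewrite /compat fibers_labelling dom_per_arrow // per_idem
  ?per_fibers.
apply/ffunP=> y; rewrite ffunE.
have memQ x : ((x, y) \in Q) =
    (theta x == row_action m (theta y) s^-1%g) && (theta x != ord0).
  have mE : relabel (row_action m) theta s y = row_action m (theta y) s^-1%g.
    by rewrite [LHS]ffunE.
  apply/rcompP/andP => [[c]|[/eqP ex n0]].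
    rewrite mem_conv !mem_graph mE => /andP[/eqP-> n0] /andP[/eqP-> _].
    by rewrite eqxx.
  exists (theta x); first by rewrite mem_graph eqxx.
  by rewrite mem_conv mem_graph mE ex eqxx -ex.
have [i ey|ey] := unliftP ord0 (theta y); last first.
  rewrite (labelling0 _ _ ey); case: pickP => [x|//] /=.
  by rewrite memQ ey row_action0 => /andP[->].
rewrite (labellingE _ _ ey) invMg permM.
have eQ x : ((x, y) \in Q) = (theta x == lift ord0 (s^-1%g i)).
  rewrite memQ ey row_action_lift; case: eqP => //= ->.
  by rewrite eq_sym neq_lift.
case: pickP => [x|no] /=; first by rewrite eQ => /eqP ex;
  rewrite (labellingE _ _ ex).
by have [x ex] := theta_lift (s^-1%g i); have := no x; rewrite eQ ex eqxx.
Qed.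

(** The set of values of a labelling determines the matrix. *)
Lemma labelling_eq M' e' t t' (h : gT) : is_ones_numbering M' e' ->
  relabel (entry_action k l) (labelling e t) h = labelling e' t' ->
    M' = mx01_act M h^-1%g.
Proof.
move=> eP' E; apply: ones_inj; apply/setP=> c; rewrite ones_act invgK.
have Ei i : entry_act (e (t^-1%g i)) h^-1%g = e' (t'^-1%g i).
  have [x ex] := theta_lift i.
  have := congr1 (fun f : {ffun 'I_n -> P} => f x) E.
  by rewrite /= ffunE !(labellingE _ _ ex).
have hK (c' : P) : entry_act (entry_act c' h^-1%g) h = c'.
  exact: (actKV (entry_action k l)).
apply/idP/idP => [/(ones_numbered eP')[i <-]|/(ones_numbered eP)[i ei]].
  by have := Ei (t' i); rewrite permK => <-; rewrite hK; apply: numbered_ones.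
have hK' : entry_act (entry_act c h) h^-1%g = c by exact:
  (actK (entry_action k l)).
have := Ei (t i); rewrite permK ei hK' => ->.
exact: numbered_ones.
Qed.

Lemma labelling_fiber t t' (h : gT) : h \in stabilizer M ->
  relabel (entry_action k l) (labelling e t) h = labelling e t' ->
    t' = (ones_perm e h * t)%g.
Proof.
move=> hS; rewrite -labelling_relabel // => E; apply: invg_inj; apply/permP=> i.
have [x ex] := theta_lift i.
have := congr1 (fun f : {ffun 'I_n -> P} => f x) E.
by rewrite /= !(labellingE _ _ ex) => /e_inj.
Qed.

End OneMatrix.

(** Conversely a pair of numbered subquotients with common refinement tau is a
    labelling: the matrix has its ones at the values of f, and these are
    numbered by the parts of tau. *)
Lemma labelling_onto f : onto2 f -> fibers pt f = fibers ord0 theta ->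
  exists M t e, [/\ M \in Qtilde k l m, is_ones_numbering M e & f = labelling e
    t].
Proof.
move=> /andP[/ontoP o1 /ontoP o2] et.
have eq x y : theta x != ord0 -> (theta x == theta y) = (f x == f y).
  move=> n0; have : ((x, y) \in fibers pt f) = ((x, y) \in fibers ord0 theta) by
    rewrite et.
  have : ((x, x) \in fibers pt f) = ((x, x) \in fibers ord0 theta) by rewrite
    et.
  by rewrite !mem_fibers !eqxx n0 /= => ->; rewrite !andbT.
have eq0 x : (f x == pt) = (theta x == ord0).
  have : ((x, x) \in fibers pt f) = ((x, x) \in fibers ord0 theta) by rewrite
    et.
  by rewrite !mem_fibers !eqxx /= => /(congr1 negb); rewrite !negbK.
have [x_ hx] := choice theta_lift.
pose e i := f (x_ i).
have fE x i : theta x = lift ord0 i -> f x = e i.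
  by move=> ex; apply/eqP; rewrite -eq ex ?hx.
have e_inj : injective e.
  move=> i j /eqP; rewrite -eq !hx; last by rewrite eq_sym neq_lift.
  by rewrite (inj_eq (@lift_inj _ ord0)) => /eqP.
pose M := \matrix_(a, b) [exists i, e i == (a, b)] : 'M[bool]_(k.+1, l.+1).
have onesM : ones M = e @: [set: 'I_m].
  apply/setP=> c; rewrite inE mxE -surjective_pairing; apply/existsP/imsetP.
    by case=> i /eqP <-; exists i.
  by case=> i _ ->; exists i.
have in_ones x : f x != pt -> f x \in ones M.
  rewrite eq0 => n0; have [i ex|/eqP] := unliftP ord0 (theta x);
    last by rewrite (negPf n0).
  by rewrite onesM (fE _ _ ex); apply: imset_f.
exists M, 1%g, e; split; last first.
- apply/ffunP=> x; have [i ex|ex] := unliftP ord0 (theta x).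
    by rewrite (labellingE _ _ ex) invg1 perm1; apply: fE.
  by rewrite (labelling0 _ _ ex); apply/eqP; rewrite eq0 ex.
- by split.
rewrite inE onesM card_imset // cardsT card_ord eqxx /=; apply/and3P; split.
- rewrite mxE; apply/existsP => -[i]; rewrite /e eq0 hx;
  by rewrite eq_sym (negPf (neq_lift _ _)).
- apply/forallP=> a; apply/implyP=> n0; have [x] := o1 a n0;
  rewrite ffunE => ex.
  apply/existsP; exists (f x).2; have := in_ones x; rewrite inE ex => -> //.
  by apply: contraNneq n0 => fx; rewrite -ex fx.
apply/forallP=> a; apply/implyP=> n0; have [x] := o2 a n0; rewrite ffunE => ex.
apply/existsP; exists (f x).1; have := in_ones x; rewrite inE ex => -> //.
by apply: contraNneq n0 => fx; rewrite -ex fx.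
Qed.

Variables (X : {set 'M[bool]_(k.+1, l.+1)})
  (e_ : 'M[bool]_(k.+1, l.+1) -> 'I_m -> P).
Hypothesis XP : orbit_representatives m X.
Hypothesis eP_ : forall M, M \in X -> is_ones_numbering M (e_ M).

Lemma representative_in M : M \in X -> M \in Qtilde k l m.
Proof. by case/and3P: XP => _ /subsetP h _; apply: h. Qed.

Lemma representative_exists M : M \in Qtilde k l m ->
  exists2 M', M' \in X & exists h : gT, M = mx01_act M' h.
Proof.
move=> MQ; case/and3P: XP => _ _ /forall_inP card1.
have /cards1P[M' eM'] := card1 _ (imset_f _ MQ).
have : M' \in X :&: orbit (mx01_action k l) [set: gT] M by rewrite eM' set11.
rewrite inE orbit_sym => /andP[M'X /orbitP[h _ eh]]; exists M' => //;
  by exists h.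
Qed.

Lemma representative_unique M M' (h : gT) : M \in X -> M' \in X ->
  M' = mx01_act M h -> M' = M.
Proof.
move=> MX M'X e'; case/and3P: XP => _ _ /forall_inP card1.
have /cards1P[M0 eM0] := card1 _ (imset_f _ (representative_in MX)).
have in1 N : N \in X -> N \in orbit (mx01_action k l) [set: gT] M -> N = M0.
  by move=> NX No; apply/set1P; rewrite -eM0 inE NX.
rewrite (in1 M) ?orbit_refl //; apply: in1 => //.
by apply/orbitP; exists h; rewrite ?inE.
Qed.

(** Up to relabelling by the two symmetric groups, only the matrices in X occur,
    because every matrix in the orbit of M has its ones at translates of those
    of M. *)
Lemma labelling_cover f : onto2 f -> fibers pt f = fibers ord0 theta ->
  exists2 M, M \in X & exists t (h : gT), f = relabel (entry_action k l)
    (labelling (e_ M) t) h.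
Proof.
move=> of_ tf; have [M0 [t0 [e0 [M0Q e0P ->]]]] := labelling_onto of_ tf.
have [M MX [h eM0]] := representative_exists M0Q; exists M => //.
have eP := eP_ MX; have e_inj : injective (e_ M) by case: eP.
have ex i : exists j, e_ M j = entry_act (e0 i) h^-1%g.
  by apply: (ones_numbered eP); rewrite -ones_act -eM0; apply: numbered_ones.
have [s hs] := choice ex.
have s_inj : injective s.
  case: e0P => e0_inj _ i j eij; apply: e0_inj.
  by apply: (@act_inj _ _ _ (entry_action k l) h^-1%g); rewrite /= -!hs eij.
(* The permutation s compares the numbering of the ones of M0, moved by h, to
   the chosen numbering of those of M. *)
exists ((perm s_inj)^-1 * t0)%g, h^-1%g; apply/ffunP=> x;
  rewrite [RHS]ffunE invgK.
have [i ei|ei] := unliftP ord0 (theta x); last first.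
  by rewrite !(labelling0 _ _ ei) entry_action0.
rewrite !(labellingE _ _ ei) invMg invgK permM (permE s_inj) hs.
by rewrite -[LHS](actKV (entry_action k l) h).
Qed.

End Labellings.

(** * Decomposition of a tensor product of cell modules *)

Section Decomposition.

Variables (F : fieldType) (n k l m : nat) (tau : numbered_subquotient n m).
Hypothesis charF0 : [pchar F] =i pred0.
Local Notation theta := (numfun tau).
Local Notation P := ('I_k.+1 * 'I_l.+1)%type.
Local Notation gT := ('S_k * 'S_l)%type.
Local Notation pt := ((ord0, ord0) : P).
Local Notation relabel := (relabel (entry_action k l)).
Local Notation tp := (fibers ord0 theta).

Variables (d1 : nat) (V1 : mx_representation F [set: 'S_k]%G d1).
Variables (d2 : nat) (V2 : mx_representation F [set: 'S_l]%G d2).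
Local Notation V := (outer_repr V1 V2).
Variables (N : nat) (r : PIstar n -> 'M[F]_N).
Variables (i : {ffun 'I_n -> P} -> 'M[F]_(d1 * d2, N))
  (q : {ffun 'I_n -> P} -> 'M[F]_(N, d1 * d2)).
Hypothesis fr : frame [set: gT]%G (@onto2 n k l) relabel (PI_act pt) V r i q.

Let aP := pair_frame_action n V1 V2.
Local Notation p := (frame_proj pt gT (@onto2 n k l) i q).
Local Notation lab := (labelling (k := k) (l := l) tau).
Local Notation rt := (fun s : 'S_m => r (sym_elt tau s)).

(** The contribution of one matrix to the summand of tau in the tensor product.
    The outer genmx hides the sum from mxdirect, which would look into it. *)
Definition lab_span (e : 'I_m -> P) : 'M[F]_N :=
  <<(\sum_(t : 'S_m) <<i (lab e t)>>)%MS>>%MS.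

Lemma lab_spanE e : (lab_span e :=: \sum_(t : 'S_m) <<i (lab e t)>>)%MS.
Proof. exact: genmxE. Qed.

Lemma lab_in_span e t : (i (lab e t) <= lab_span e)%MS.
Proof. by rewrite lab_spanE (sumsmx_sup t) ?genmxE. Qed.

(** The map t (x) v |-> labelling t (x) v is balanced over the stabilizer, hence
    defined on the induced module. Its left inverse uses the dual maps of both
    frames: if a relabelling by h turns one labelling for M into another one,
    then h stabilizes M, and the two permutations differ by the action of h. *)
Lemma ind_embedding M (e : 'I_m -> P) : is_ones_numbering M e ->
  M \in Qtilde k l m ->
  exists j, [/\ row_free j, (j :=: lab_span e)%MS
    & forall s, ind_module M e V1 V2 s *m j = j *m rt s].
Proof.
move=> eP MQ; have aI := ind_frame_action eP V1 V2.
have [iI [qI frI]] := ind_frame eP V1 V2.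
have okl t : onto2 (lab e t) by apply: onto_labelling eP MQ t.
pose j := fhom 'C[M | mx01_action k l]%G xpredT qI (fun t => i (lab e t)).
have jE t : iI t *m j = i (lab e t).
  apply: (fhomE aI charF0 frI) => // {}t h _ hS.
  by rewrite (labelling_relabel tau eP) // (frame_move fr) ?inE.
exists j; split.
- apply/row_freeP.
  (* Each element of the stabilizer contributes once to the left inverse. *)
  exists (#|stabilizer M|%:R^-1 *: \sum_t q (lab e t) *m iI t).
  apply: (frame_ext charF0 frI) => t _; rewrite mulmx1 mulmxA jE.
  rewrite -scalemxAr mulmx_sumr.
  rewrite (eq_bigr (fun t' =>
    \sum_(h in 'C[M | mx01_action k l]%G | ones_ract e t' h == t)
      V h *m iI t')) => [|t' _].
    rewrite (orbit_sum aI) // (eq_bigr (fun=> iI t)) => [|h hS].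
      rewrite sumr_const -scaler_nat scalerA mulVf ?scale1r //.
      exact: (cardG_neq0 [group of 'C[M | mx01_action k l]] charF0).
    by rewrite -(frame_move frI) // (ractKV aI).
  rewrite mulmxA (frame_dual fr) // mulmx_suml; apply: eq_bigl => h;
    rewrite inE /=.
  apply/eqP/andP => [E|[hS /eqP<-]]; last by rewrite
    -(labelling_relabel tau eP).
  have hS : h \in stabilizer M.
    apply/stabilizerP; have := labelling_eq eP eP E => e1.
    by rewrite {1}e1 -mx01_actM mulVg mx01_act1.
  by split=> //; rewrite /ones_ract (labelling_fiber eP hS E).
- apply/eqmxP/andP; split.
    rewrite /j /fhom scalemx_sub // summx_sub // => t _.
    by apply: submx_trans (submxMl _ _) (lab_in_span _ _).
  by rewrite lab_spanE; apply/sumsmx_subP=> t _; rewrite genmxE -jE submxMl.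
move=> s; apply: (frame_ext charF0 frI) => t _.
rewrite [LHS]mulmxA [RHS]mulmxA (frame_act frI) //= !jE (frame_act fr) //
  /PI_act.
by have [-> ->] := labelling_push tau eP MQ t s.
Qed.

Lemma ind_projections M (e : 'I_m -> P) : is_ones_numbering M e ->
  has_projections (ind_module M e V1 V2).
Proof.
move=> eP; have [iI [qI frI]] := ind_frame eP V1 V2.
apply: group_projections => // [|g h]; apply: (frame_ext charF0 frI) => t _.
  by rewrite (frame_act frI) //= mulg1 mulmx1.
by rewrite mulmxA !(frame_act frI) //= mulgA.
Qed.

Section Representatives.

Variables (X : {set 'M[bool]_(k.+1, l.+1)})
  (e_ : 'M[bool]_(k.+1, l.+1) -> 'I_m -> P).
Hypothesis XP : orbit_representatives m X.
Hypothesis eP_ : forall M, M \in X -> is_ones_numbering M (e_ M).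

(** The summand of tau is spanned by the f (x) v with f of subquotient tau, and
    relabelling f by h only changes v to h v. *)
Lemma lab_span_sum : (\sum_(M in X) lab_span (e_ M) :=: p tp)%MS.
Proof.
have pE z s : onto2 z -> i z *m p s = if fibers pt z == s then i z else 0.
  exact: (frame_projE charF0 (@entry_action0 k l) aP fr).
apply/eqmxP/andP; split.
  apply/sumsmx_subP=> M MX; rewrite lab_spanE; apply/sumsmx_subP=> t _;
    rewrite genmxE.
  have eP := eP_ MX; have MQ := representative_in XP MX.
  have okl := onto_labelling tau eP MQ t.
  by have := pE _ tp okl; rewrite (fibers_labelling tau eP MQ) eqxx => <-;
    apply: submxMl.
rewrite /frame_proj /fhom scalemx_sub // summx_sub // => z oz.
case: eqP => [tz|_]; last by rewrite mulmx0 sub0mx.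
have [M MX [t [h ->]]] := labelling_cover XP eP_ oz tz.
have okl := onto_labelling tau (eP_ MX) (representative_in XP MX) t.
apply: submx_trans (submxMl _ _) _; apply: (sumsmx_sup M) => //.
rewrite (frame_move fr) ?inE //; apply: submx_trans (submxMl _ _)
  (lab_in_span _ _).
Qed.

(** The operator pi M, which keeps the functions that are relabellings of
    labellings for M and kills the other ones, is well defined as it respects
    the relabelling. It is the identity on the span of M and vanishes on the
    spans of the other representatives. *)
Lemma lab_span_direct : mxdirect (\sum_(M in X) lab_span (e_ M))%MS.
Proof.
pose S M (z : {ffun 'I_n -> P}) :=
  [exists t, [exists h : gT, z == relabel (lab (e_ M) t) h]].
have SP M z : reflect (exists t (h : gT), z = relabel (lab (e_ M) t) h) (S M z).
  apply: (iffP existsP) => [[t /existsP[h /eqP->]]|[t [h ->]]]; exists t;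
    first by exists h.
  by apply/existsP; exists h.
have Smove M z (h : gT) : S M (relabel z h) = S M z.
  apply/SP/SP => [[t [g E]]|[t [g ->]]]; exists t.
    by exists (h^-1 * g)%g; rewrite relabelM -E -relabelM mulVg relabel1.
  by exists (h * g)%g; rewrite relabelM.
pose pi M := fhom [set: gT]%G (@onto2 n k l) q
  (fun z => if S M z then i z else 0).
have piE M z : onto2 z -> i z *m pi M = if S M z then i z else 0.
  apply: (fhomE aP charF0 fr) => {}z h oz _; rewrite Smove.
  by case: ifP => _; rewrite ?mulmx0 // (frame_move fr) ?inE.
have okl M t : M \in X -> onto2 (lab (e_ M) t).
  by move=> MX; apply: onto_labelling (eP_ MX) (representative_in XP MX) t.
have pi1 M : M \in X -> lab_span (e_ M) *m pi M = lab_span (e_ M).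
  move=> MX; have : (lab_span (e_ M) <= \sum_t <<i (lab (e_ M) t)>>)%MS by
    rewrite lab_spanE.
  case/sub_sumsmxP=> u ->; rewrite mulmx_suml; apply: eq_bigr => t _.
  rewrite -mulmxA; congr (_ *m _); have /submxP[w ->] :
    (<<i (lab (e_ M) t)>> <= i (lab (e_ M) t))%MS.
    by rewrite genmxE.
  rewrite -mulmxA piE ?okl // (_ : S M _ = true) //.
  by apply/SP; exists t, 1%g; rewrite relabel1.
have pi0 M M' : M \in X -> M' \in X -> M' != M ->
  (lab_span (e_ M') <= kermx (pi M))%MS.
  move=> MX M'X ne; rewrite lab_spanE; apply/sumsmx_subP=> t _; rewrite genmxE;
    apply/sub_kermxP.
  rewrite piE ?okl //; case: SP => // -[t' [h E]].
  have e1 := labelling_eq (eP_ MX) (eP_ M'X) (esym E).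
  by rewrite (representative_unique XP MX M'X e1) eqxx in ne.
apply/mxdirect_sumsP=> M MX; apply/eqP; rewrite -submx0; set U := (_ :&: _)%MS.
have /submxP[w ew] : (U <= lab_span (e_ M))%MS by apply: capmxSl.
have : (U <= kermx (pi M))%MS.
  apply: submx_trans (capmxSr _ _) _; apply/sumsmx_subP=> M' /andP[M'X ne].
  exact: pi0.
by move/sub_kermxP; rewrite ew -mulmxA pi1 // => ->; rewrite sub0mx.
Qed.

(** The summand of tau, as a representation of its group, is the direct sum of
    the induced modules. *)
Lemma mult_in_lab e0 (s : 'S_m -> 'M[F]_e0) :
  mult_in rt (p tp) s
    (\sum_(M in X) multiplicity (ind_module M (e_ M) V1 V2) s)%N.
Proof.
apply: mult_in_eqmx lab_span_sum _; apply: mult_in_sum lab_span_direct => M MX.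
have eP := eP_ MX; have [j [fj jE js]] := ind_embedding eP
  (representative_in XP MX).
apply: mult_in_eqmx (eqmx_trans (genmxE _) jE) _.
apply: mult_in_transport fj js _.
exact/multiplicity_in/ind_projections.
Qed.

End Representatives.

End Decomposition.

(** Both sides compute the multiplicity of V in the summand of tau of the tensor
    product: the left hand side by restriction of a decomposition over the
    semigroup, the right hand side through the induced modules. *)
Theorem tensor_multiplicity (F : fieldType) (charF0 : [pchar F] =i pred0)
    (n k l m d1 d2 e : nat)
    (V1 : mx_representation F [set: 'S_k]%G d1)
    (V2 : mx_representation F [set: 'S_l]%G d2)
    (V : mx_representation F [set: 'S_m]%G e)
    (rho : numbered_subquotient n k) (sigma : numbered_subquotient n l)
    (tau : numbered_subquotient n m)
    (X : {set 'M[bool]_(k.+1, l.+1)}) (XP : orbit_representatives m X)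
    (e_ : 'M[bool]_(k.+1, l.+1) -> 'I_m -> 'I_k.+1 * 'I_l.+1)
    (eP_ : forall M, M \in X -> is_ones_numbering M (e_ M)) :
  multiplicity
    (tensor_module
       (balanced_tensor (cell_left rho F) [set: 'S_k] (cell_right rho F) V1)
       (balanced_tensor (cell_left sigma F) [set: 'S_l] (cell_right sigma F)
         V2))
    (balanced_tensor (cell_left tau F) [set: 'S_m] (cell_right tau F) V)
  = (\sum_(M in X) multiplicity (ind_module M (e_ M) V1 V2) V)%N.
Proof.
have [i1 [q1 fr1]] := cell_frame rho V1; have [i2 [q2 fr2]] :=
  cell_frame sigma V2.
have [i3 [q3 fr3]] := cell_frame tau V.
have fr := tensor_frame fr1 fr2.
have gr := frame_graded charF0 (@entry_action0 k l) (pair_frame_action n V1 V2)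
  fr.
apply: (mult_in_unique _ (mult_in_lab tau charF0 fr XP eP_ V)).
apply: (mult_in_restrict tau charF0 gr fr3).
exact/multiplicity_in/(graded_projections charF0 gr).
Qed.

Theorem corollary16 (F : closedFieldType) (charF0 : [pchar F] =i pred0)
    (n k l m : nat) (le_kn : (k <= n)%N) (le_ln : (l <= n)%N)
      (le_mn : (m <= n)%N)
    (lam mu nu : seq nat)
    (lamP : is_partition_of lam k) (muP : is_partition_of mu l)
    (nuP : is_partition_of nu m)
    (rho : numbered_subquotient n k) (sigma : numbered_subquotient n l)
    (tau : numbered_subquotient n m)
    (X : {set 'M[bool]_(k.+1, l.+1)}) (XP : orbit_representatives m X)
    (e : 'M[bool]_(k.+1, l.+1) -> 'I_m -> 'I_k.+1 * 'I_l.+1)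
    (eP : forall M, M \in X -> is_ones_numbering M (e M)) :
  multiplicity (tensor_module (simpleN rho F lam) (simpleN sigma F mu))
               (simpleN tau F nu)
  = (\sum_(M in X) multiplicity (ind_res F lam mu M (e M)) (specht F m nu))%N.
Proof.
exact: (tensor_multiplicity charF0 (specht F k lam) (specht F l mu)
  (specht F m nu)
  rho sigma tau XP eP).
Qed.
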